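(* Let $n\ge1$, $0<s\le1/2$, $a\ge2s$, and let $b$ satisfy $1/b>(a-2s)/(2s)$. Let $(t_k)_{k=1}^\infty$ be a sequence of real numbers with $1>t_1>t_2>t_3>\dots>0$ and $\lim_{k\to\infty}t_k=0$, and set $$A_j=\{t_k : 2^{-j-1}<t_k\le 2^{-j}\},\qquad j=1,2,3,\dots.$$ Assume that there is a constant $C$ such that $\#A_j\le C2^{bj}$ for $j=1,2,3,\dots$, and that $f\in H_s(\mathbb{R}^n)$. Then $$\lim_{k\to\infty}S_{t_k}f(x)=f(x)$$ for almost every $x\in\mathbb{R}^n$.
   Context: $\#A$ denotes the number of elements of a set $A$. The Fourier transform is $\hat f(\xi)=\int_{\mathbb{R}^n}e^{-i\xi\cdot x}f(x)\,dx$. For $f\in L^2(\mathbb{R}^n)$ and $a>0$, $S_tf(x)=(2\pi)^{-n}\int_{\mathbb{R}^n}e^{i\xi\cdot x}e^{it|\xi|^a}\hat f(\xi)\,d\xi$, i.e. $S_tf$ is the $L^2$ function with Fourier transform $e^{it|\xi|^a}\hat f(\xi)$. The Sobolev space is $H_s=\{f\in\mathscr{S}' : \|f\|_{H_s}<\infty\}$ with $\|f\|_{H_s}=\left(\int_{\mathbb{R}^n}(1+|\xi|^2)^s|\hat f(\xi)|^2\,d\xi\right)^{1/2}$. *)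

(* Defs.v *)
From HB Require Import structures.
From mathcomp Require Import all_boot all_order all_algebra.
From mathcomp Require Import complex.
From mathcomp Require Import all_classical all_reals all_analysis.

Set Implicit Arguments.
Unset Strict Implicit.
Unset Printing Implicit Defensive.

Import Order.TTheory GRing.Theory Num.Theory.
Import numFieldNormedType.Exports.

Local Open Scope classical_set_scope.
Local Open Scope ring_scope.

(* ['rV[R]_n] plays the role of R^n: its topology and differential calculus come
   from the library; it is equipped here with the product sigma-algebra of the
   Borel sets of [R], generated by the coordinates as for [n.-tuple]. *)
Section rV_measurable.
Context {R : realType} (n : nat).

Definition rV_coord (i : 'I_n) (x : 'rV[R]_n) : measurableTypeR R := x ord0 i.

Let rV_set0 : g_sigma_preimage rV_coord set0.
Proof. exact: sigma_algebra0. Qed.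

Let rV_setC A : g_sigma_preimage rV_coord A -> g_sigma_preimage rV_coord (~` A).
Proof. exact: sigma_algebraC. Qed.

Let rV_bigcup (F : (set 'rV[R]_n)^nat) :
  (forall i, g_sigma_preimage rV_coord (F i)) ->
  g_sigma_preimage rV_coord (\bigcup_i (F i)).
Proof. exact: sigma_algebra_bigcup. Qed.

HB.instance Definition _ := @isMeasurable.Build
  (measure_tuple_display default_measure_display) 'rV[R]_n
  (g_sigma_preimage rV_coord) rV_set0 rV_setC rV_bigcup.

Lemma measurable_rV_coord i : measurable_fun setT (rV_coord i).
Proof.
move=> _ Y mY; rewrite setTI; apply: sub_sigma_algebra => /=.
rewrite -bigcup_seq/=; exists i => /=; first by rewrite mem_index_enum.
by exists Y => //; rewrite setTI.
Qed.

Lemma measurable_to_rV d (T : measurableType d) (f : T -> 'rV[R]_n) :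
  (forall i, measurable_fun setT (rV_coord i \o f)) -> measurable_fun setT f.
Proof.
move=> mf; suff H : g_sigma_preimage (fun i => rV_coord i \o f) `<=` measurable.
  move=> _ A mA; apply: H; rewrite g_sigma_preimage_comp; exists A => //.
apply: smallest_sub; first exact: sigma_algebra_measurable.
rewrite -bigcup_seq => A [i _ [B mB <-]]; exact: mf.
Qed.

End rV_measurable.

Lemma sigma_finite_prod d1 d2 (T1 : measurableType d1) (T2 : measurableType d2)
    (R : realType) (m1 : {sigma_finite_measure set T1 -> \bar R})
    (m2 : {sigma_finite_measure set T2 -> \bar R}) :
  sigma_finite setT (m1 \x m2)%E.
Proof.
have /sigma_finiteP[F [TF ndF Foo]] := sigma_finiteT m1.
have /sigma_finiteP[G [TG ndG Goo]] := sigma_finiteT m2.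
exists (fun n => F n `*` G n).
 rewrite -setXTT TF TG predeqE => -[x y]; split.
    move=> [/= [n _ Fnx] [k _ Gky]]; exists (maxn n k) => //; split.
    - by move: x Fnx; exact/subsetPset/ndF/leq_maxl.
    - by move: y Gky; exact/subsetPset/ndG/leq_maxr.
  by move=> [n _ []/= ? ?]; split; exists n.
move=> k; have [? ?] := Foo k; have [? ?] := Goo k.
split; first exact: measurableX.
by rewrite product_measure1E// lte_mul_pinfty// ge0_fin_numE.
Qed.

Section lebesgue_rV.
Context {R : realType}.

Definition cons_rV n (p : measurableTypeR R * 'rV[R]_n) : 'rV[R]_n.+1 :=
  \row_i if unlift ord0 i is Some j then p.2 ord0 j else p.1.

Definition uncons_rV n (x : 'rV[R]_n.+1) : measurableTypeR R * 'rV[R]_n :=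
  (x ord0 ord0, \row_i x ord0 (lift ord0 i)).

Lemma cons_rV0 n p : @cons_rV n p ord0 ord0 = p.1.
Proof. by rewrite mxE unlift_none. Qed.

Lemma cons_rVS n p i : @cons_rV n p ord0 (lift ord0 i) = p.2 ord0 i.
Proof. by rewrite mxE liftK. Qed.

Lemma cons_rVK n : cancel (@cons_rV n) (@uncons_rV n).
Proof.
case=> r x; rewrite /uncons_rV cons_rV0; congr (_, _).
by apply/rowP => i; rewrite mxE cons_rVS.
Qed.

Lemma uncons_rVK n : cancel (@uncons_rV n) (@cons_rV n).
Proof.
move=> x; apply/rowP => i; case: (unliftP ord0 i) => [j ->|->].
  by rewrite cons_rVS mxE.
by rewrite cons_rV0.
Qed.

Lemma measurable_cons_rV n : measurable_fun setT (@cons_rV n).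
Proof.
apply: measurable_to_rV => i; case: (unliftP ord0 i) => [j ->|->].
  rewrite (_ : _ \o _ = rV_coord j \o snd).
    by apply: measurableT_comp; [exact: measurable_rV_coord|exact: measurable_snd].
  by apply/funext => p; rewrite /= /rV_coord cons_rVS.
rewrite (_ : _ \o _ = fst); first exact: measurable_fst.
by apply/funext => p; rewrite /= /rV_coord cons_rV0.
Qed.

Lemma measurable_uncons_rV n : measurable_fun setT (@uncons_rV n).
Proof.
apply/measurable_fun_pair; first exact: (measurable_rV_coord ord0).
apply: measurable_to_rV => i.
rewrite (_ : _ \o _ = rV_coord (lift ord0 i)); first exact: measurable_rV_coord.
by apply/funext => p; rewrite /= /rV_coord mxE.
Qed.

Section step.
Variables (n : nat) (mu : {sigma_finite_measure set 'rV[R]_n -> \bar R}).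

Definition leb_cons : set 'rV[R]_n.+1 -> \bar R :=
  pushforward (@lebesgue_measure R \x mu)%E (@cons_rV n).

Let leb_cons0 : leb_cons set0 = 0%E.
Proof. by rewrite /leb_cons /pushforward preimage_set0 measure0. Qed.

Let leb_cons_ge0 A : (0 <= leb_cons A)%E.
Proof. exact: (measure_ge0 (product_measure1 _ _)). Qed.

Let leb_cons_sigma_additive : semi_sigma_additive leb_cons.
Proof.
by apply: measure_semi_sigma_additive; exact: measurable_cons_rV.
Qed.

HB.instance Definition _ := isMeasure.Build _ _ _ leb_cons
  leb_cons0 leb_cons_ge0 leb_cons_sigma_additive.

Let leb_cons_sigma_finite : sigma_finite setT leb_cons.
Proof.
have [F FT Foo] := sigma_finite_prod (@lebesgue_measure R) mu.
exists (fun k => @uncons_rV n @^-1` F k).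
  by rewrite -preimage_bigcup -FT preimage_setT.
move=> k; have [mF Fk] := Foo k; split.
  by rewrite -[X in measurable X]setTI; exact: measurable_uncons_rV.
rewrite /leb_cons /pushforward -comp_preimage.
by rewrite (_ : _ \o _ = id) ?preimage_id//; apply/funext/cons_rVK.
Qed.

HB.instance Definition _ := Measure_isSigmaFinite.Build _ _ _ leb_cons
  leb_cons_sigma_finite.

End step.

(* n-dimensional Lebesgue measure, as an iterated product measure; see
   [lebesgue_rV_box]. *)
Fixpoint lebesgue_rV n : {sigma_finite_measure set 'rV[R]_n -> \bar R} :=
  match n with
  | 0 => \d_ (0 : 'rV[R]_0)
  | m.+1 => leb_cons (lebesgue_rV m)
  end.

Lemma measurable_box n (A : 'I_n -> set (measurableTypeR R)) :
  (forall i, measurable (A i)) ->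
  measurable [set x : 'rV[R]_n | forall i, A i (rV_coord i x)].
Proof.
move=> mA; rewrite [X in measurable X](_ : _ =
  \bigcap_(i in [set: 'I_n]) (@rV_coord R n i @^-1` A i)).
  apply: fin_bigcap_measurable; first exact: finite_finset.
  move=> i _; rewrite -[X in measurable X]setTI.
  exact: measurable_rV_coord.
by apply/seteqP; split => x /= H i; [move=> _|]; exact: H.
Qed.

Lemma lebesgue_rV_box n (A : 'I_n -> set (measurableTypeR R)) :
  (forall i, measurable (A i)) ->
  lebesgue_rV n [set x | forall i, A i (rV_coord i x)] =
  (\prod_(i < n) lebesgue_measure (A i))%E.
Proof.
elim: n A => [|n IHn] A mA.
  rewrite big_ord0 /= diracE mem_set// => -[]//.
rewrite big_ord_recl -(IHn (fun i => A (lift ord0 i)))//.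
rewrite -product_measure1E//; last first.
  exact: (@measurable_box n (fun i => A (lift ord0 i))).
rewrite /= /leb_cons /pushforward; congr (product_measure1 _ _ _).
apply/seteqP; split => -[r x] /=.
  move=> H; split; first by have := H ord0; rewrite /rV_coord cons_rV0.
  by move=> i; have := H (lift ord0 i); rewrite /rV_coord cons_rVS.
move=> [Ar Ax] i; rewrite /rV_coord; case: (unliftP ord0 i) => [j ->|->].
  by rewrite cons_rVS; exact: Ax.
by rewrite cons_rV0.
Qed.

End lebesgue_rV.

Section euclidean.
Context {R : realType} {n : nat}.
Local Notation E := 'rV[R]_n.
Local Notation mu := (@lebesgue_rV R n).
Implicit Types (f g u phi : E -> R[i]) (T U : (E -> R[i]) -> R[i]).

(* The library norm [`|x|] on ['rV[R]_n] is the sup norm. *)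
Definition dotp (x y : E) : R := \sum_i x ord0 i * y ord0 i.
Definition enorm (x : E) : R := Num.sqrt (dotp x x).

Definition expi (theta : R) : R[i] := Complex (cos theta) (sin theta).

Definition fRe f : E -> R := fun x => complex.Re (f x).
Definition fIm f : E -> R := fun x => complex.Im (f x).

Definition cmeasurable f :=
  measurable_fun setT (fRe f) /\ measurable_fun setT (fIm f).

Definition cintegrable f :=
  mu.-integrable setT (EFin \o fRe f) /\ mu.-integrable setT (EFin \o fIm f).

Definition cintegral f : R[i] :=
  Complex (Rintegral mu setT (fRe f)) (Rintegral mu setT (fIm f)).

Definition in_L2 f :=
  (fRe f \in Lfun mu 2%:E) /\ (fIm f \in Lfun mu 2%:E).

Definition fourier phi : E -> R[i] :=
  fun xi => cintegral (fun x => expi (- dotp xi x) * phi x).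

(* [pderivs [:: i1; ...; ik] h] is $\partial_{i_1}\cdots\partial_{i_k} h$. *)
Definition pderiv (i : 'I_n) (h : E -> R) : E -> R :=
  fun x => 'D_(delta_mx ord0 i) h x.
Definition pderivs (l : seq 'I_n) (h : E -> R) : E -> R := foldr pderiv h l.
Definition cpderivs (l : seq 'I_n) phi : E -> R[i] :=
  fun x => Complex (pderivs l (fRe phi) x) (pderivs l (fIm phi) x).

Definition smooth (h : E -> R) :=
  forall (l : seq 'I_n) (x : E), differentiable (pderivs l h) x.

Definition seminorm_le (N : nat) (l : seq 'I_n) phi (M : R) :=
  forall x, (1 + enorm x) ^+ N * Normc.normc (cpderivs l phi x) <= M.

Definition schwartz phi :=
  [/\ smooth (fRe phi), smooth (fIm phi)
    & forall N l, exists M, seminorm_le N l phi M].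

(* Tempered distributions are total functionals on [E -> R[i]] of which only
   the values on Schwartz functions are relevant. *)
Definition tempered T :=
  (forall (c : R[i]) phi psi, schwartz phi -> schwartz psi ->
     T (fun x => c * phi x + psi x) = c * T phi + T psi) /\
  (exists (N k : nat) (C : R), forall phi M, schwartz phi ->
     (forall l : seq 'I_n, (size l <= k)%N -> seminorm_le N l phi M) ->
     Normc.normc (T phi) <= C * M).

Definition eq_distr T U := forall phi, schwartz phi -> T phi = U phi.

(* [regular_fun f]: [f] defines the distribution [distr_of f], all the pairings
   [\int f phi] being absolutely convergent. *)
Definition regular_fun f :=
  cmeasurable f /\ forall phi, schwartz phi -> cintegrable (fun x => f x * phi x).
Definition distr_of f : (E -> R[i]) -> R[i] :=
  fun phi => cintegral (fun x => f x * phi x).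

Definition fourier_distr T : (E -> R[i]) -> R[i] := fun phi => T (fourier phi).

Definition is_fourier T g :=
  regular_fun g /\ eq_distr (fourier_distr T) (distr_of g).

(* The $H_s$ norm of a distribution whose Fourier transform is [g]. *)
Definition sobolev_norm_of (s : R) g : \bar R :=
  ((\int[mu]_xi ((1 + enorm xi ^+ 2) `^ s * Normc.normc (g xi) ^+ 2)%:E)
     `^ (1 / 2))%E.

Definition sobolev (s : R) T :=
  tempered T /\ exists g, is_fourier T g /\ (sobolev_norm_of s g < +oo)%E.

(* For [s > 0] the elements of $H_s$ are functions; [in_sobolev s f] says that
   the function [f], seen as a distribution, belongs to $H_s$. *)
Definition in_sobolev (s : R) f := regular_fun f /\ sobolev s (distr_of f).

Definition is_schrodinger (a t : R) f u :=
  in_L2 u /\ exists g, is_fourier (distr_of f) g /\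
    is_fourier (distr_of u) (fun xi => expi (t * enorm xi `^ a) * g xi).

(* The $L^2$ function [is_schrodinger] is determined up to a null set only;
   [schrodinger] selects a representative ([0] if there were none). *)
Definition schrodinger (a t : R) f : E -> R[i] :=
  xget (fun=> 0) [set u | is_schrodinger a t f u].

End euclidean.

Definition dyadic_block (R : realType) (t : nat -> R) (j : nat) : set R :=
  [set x | range t x /\ 2 ^- j.+1 < x <= 2 ^- j].

(* Main.v *)
(* Cut f^ into the annuli rho^m <= |xi| < rho^(m+1), where rho^(2s) = 2^b, and let
   u_m(t) be the corresponding piece of S_t f. By Plancherel the squared L^2 norm of
   u_m(t) - u_m(t') is at most K M_m min(1, (lam_m (t - t'))^2), where M_m is the mass
   of |f^|^2 on the annulus and lam_m = rho^((m+1)a); the Sobolev norm bounds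
   \sum_m 2^(bm) M_m, and the condition on b gives lam_m <= L 2^((1+b)m).
   Let F_(m,j) be the maximum of |u_m(t) - u_m(0)|^2 over t in A_j. If j <= m, the
   number of points of A_j bounds its integral by K C 2^(bj) M_m; if m < j, a
   discrete Sobolev inequality on (0, 2^-j] bounds it by 3 K lam_m 2^-j M_m. Both are
   at most const * 2^(bm) M_m p^|m-j| with p < 1, so that the squares of
   \sum_m F_(m,j)^(1/2) have a finite integral when summed over j, and
   S_(t_k) f -> f almost everywhere. *)
Require Import Defs.
From HB Require Import structures.
From mathcomp Require Import all_boot all_order all_algebra.
From mathcomp Require Import complex.
From mathcomp Require Import all_classical all_reals all_analysis.
From mathcomp Require Import measurable_realfun lebesgue_integral_under ring lra.
Set Implicit Arguments.
Unset Strict Implicit.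
Unset Printing Implicit Defensive.
Import Order.TTheory GRing.Theory Num.Theory.
Import numFieldNormedType.Exports.
Local Open Scope classical_set_scope.
Local Open Scope ring_scope.

(** * Integrable functions *)

(** All estimates are on real integrals: with f^ = g1 + i g2, the real part of S_t f is a difference
    of a cosine and a sine transform, and the imaginary part has the same form for (g2, -g1), so
    each estimate is proved once and used twice. The choice of rho makes the Sobolev weight on the
    m-th annulus at least 2^(bm), the growth rate of the bound on #A_j; hence the two bounds meet at
    j = m and decay on both sides of it. Comparing with time 0 rather than with another point of the
    sequence makes summability over j yield convergence at once, without approximating f by smooth
    functions. The other obstacle is identification: f, its transform and S_t f are tied together
    only by pairings with Schwartz functions, and S_t f is an arbitrary representative. The blocks
    are explicit integrals, so their series must be shown to have the right transform, and functions
    with equal pairings must agree almost everywhere. Gaussians serve for both: their transforms are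
    explicit, they regularise Parseval's formula, and their averages determine a function. *)

Section L1_theory.
Context d (T : measurableType d) (R : realType).
Variable mu : {measure set T -> \bar R}.
Implicit Types h k : T -> R.

Definition L1 h := mu.-integrable [set: T] (EFin \o h).

Lemma L1_measurable h : L1 h -> measurable_fun setT h.
Proof. by move=> /measurable_int/measurable_EFinP. Qed.

Lemma L1_dominated h k : measurable_fun setT h -> (forall x, `|h x| <= k x) ->
  L1 k -> L1 h.
Proof.
move=> mh hk; apply: le_integrable => //; first exact/measurable_EFinP.
by move=> x _ /=; rewrite lee_fin (le_trans (hk x))// ler_norm.
Qed.

Lemma L1D h k : L1 h -> L1 k -> L1 (fun x => h x + k x).
Proof. by move=> ih ik; apply: (integrableD _ ih ik). Qed.

Lemma L1N h : L1 h -> L1 (fun x => - h x).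
Proof. by move=> ih; apply: (integrableN ih). Qed.

Lemma L1B h k : L1 h -> L1 k -> L1 (fun x => h x - k x).
Proof. by move=> ih ik; apply: (integrableB _ ih ik). Qed.

Lemma L1Z c h : L1 h -> L1 (fun x => c * h x).
Proof. by move=> ih; apply: (integrableZl _ c ih). Qed.

Lemma L1_norm h : L1 h -> L1 (fun x => `|h x|).
Proof. exact: integrable_norm. Qed.

Lemma L1_eq h k : h =1 k -> L1 h -> L1 k.
Proof. by move=> /funext ->. Qed.

Lemma L1_bounded_mul h k K : L1 h -> measurable_fun setT k ->
  (forall x, `|k x| <= K) -> L1 (fun x => h x * k x).
Proof.
move=> ih mk kK; apply: (@L1_dominated _ (fun x => K * `|h x|)).
- by apply: measurable_funM => //; exact: L1_measurable.
- by move=> x; rewrite normrM mulrC ler_wpM2r.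
- exact/L1Z/L1_norm.
Qed.

Lemma EFin_Rint h : L1 h ->
  (Rintegral mu setT h)%:E = (\int[mu]_x (h x)%:E)%E.
Proof. by move=> ih; rewrite fineK//; exact: integrable_fin_num. Qed.

Lemma le_Rint h k : L1 h -> L1 k -> (forall x, h x <= k x) ->
  Rintegral mu setT h <= Rintegral mu setT k.
Proof. by move=> ih ik hk; apply: le_Rintegral. Qed.

Lemma norm_Rint h : L1 h ->
  `|Rintegral mu setT h| <= Rintegral mu setT (fun x => `|h x|).
Proof. exact: le_normr_Rintegral. Qed.

Lemma eq_Rint h k : h =1 k -> Rintegral mu setT h = Rintegral mu setT k.
Proof. by move=> /funext ->. Qed.

Lemma RintD h k : L1 h -> L1 k ->
  Rintegral mu setT (fun x => h x + k x) =
  Rintegral mu setT h + Rintegral mu setT k.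
Proof. by move=> ? ?; exact: RintegralD. Qed.

Lemma RintB h k : L1 h -> L1 k ->
  Rintegral mu setT (fun x => h x - k x) =
  Rintegral mu setT h - Rintegral mu setT k.
Proof. by move=> ? ?; exact: RintegralB. Qed.

Lemma RintZ c h : L1 h ->
  Rintegral mu setT (fun x => c * h x) = c * Rintegral mu setT h.
Proof. by move=> ?; exact: RintegralZl. Qed.

Lemma RintN h : L1 h ->
  Rintegral mu setT (fun x => - h x) = - Rintegral mu setT h.
Proof.
move=> ih; rewrite -mulN1r -RintZ//.
by apply: eq_Rint => x; rewrite mulN1r.
Qed.

Lemma L1_ge0 h : measurable_fun setT h -> (forall x, 0 <= h x) ->
  (\int[mu]_x (h x)%:E < +oo)%E -> L1 h.
Proof.
move=> mh h0 ih; apply/integrableP; split; first exact/measurable_EFinP.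
rewrite (eq_integral (fun x => (h x)%:E))// => x _.
by rewrite /= ger0_norm.
Qed.

Lemma integral_L1_lty h : L1 h -> (\int[mu]_x (h x)%:E < +oo)%E.
Proof. by move=> ih; rewrite -EFin_Rint// ltry. Qed.

Lemma L1_dominated_cvg (h_ : nat -> T -> R) h k :
  (forall n, measurable_fun setT (h_ n)) -> measurable_fun setT h ->
  {ae mu, forall x, h_ ^~ x @ \oo --> h x} -> L1 k ->
  {ae mu, forall x, forall n, `|h_ n x| <= k x} ->
  L1 h /\ (fun n => Rintegral mu setT (h_ n)) @ \oo --> Rintegral mu setT h.
Proof.
move=> mh_ mh hc ik hk.
have [] := @dominated_convergence _ T R mu setT measurableT
  (fun n => EFin \o h_ n) (EFin \o h) (EFin \o k).
- by move=> n; exact/measurable_EFinP.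
- exact/measurable_EFinP.
- apply: filterS hc => x hx _; by apply: cvg_EFin; [exact: nearW|exact: hx].
- exact: ik.
- by apply: filterS hk => x hx n _ /=; rewrite lee_fin.
move=> ih _ hcv; split => //.
have {}hcv : ((\int[mu]_x (h_ n x)%:E)%E @[n --> \oo] -->
   (Rintegral mu setT h)%:E)%E by rewrite EFin_Rint.
exact: fine_cvg hcv.
Qed.

End L1_theory.

(** * Fubini's theorem for a product [A x * k (x, y) * B y] with bounded kernel *)

Section Fubini_kernel.
Context d1 d2 (T1 : measurableType d1) (T2 : measurableType d2) (R : realType).
Variables (m1 : {sigma_finite_measure set T1 -> \bar R}).
Variables (m2 : {sigma_finite_measure set T2 -> \bar R}).
Variables (A : T1 -> R) (B : T2 -> R) (k : T1 * T2 -> R) (K : R).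
Hypotheses (iA : L1 m1 A) (iB : L1 m2 B).
Hypotheses (mk : measurable_fun setT k) (kK : forall z, `|k z| <= K).

Let f (z : T1 * T2) : R := A z.1 * (k z * B z.2).

Let mf : measurable_fun setT f.
Proof.
apply: measurable_funM.
  by apply: measurableT_comp => //; exact: (L1_measurable iA).
apply: measurable_funM => //.
by apply: measurableT_comp => //; exact: (L1_measurable iB).
Qed.

Lemma L1_kernel_l x : L1 m2 (fun y => k (x, y) * B y).
Proof.
apply: (L1_eq (h := fun y => B y * k (x, y))); first by move=> y; rewrite mulrC.
by apply: (@L1_bounded_mul _ _ _ _ _ _ K) => //; exact: measurableT_comp.
Qed.

Lemma L1_kernel_r y : L1 m1 (fun x => A x * k (x, y)).
Proof. by apply: (@L1_bounded_mul _ _ _ _ _ _ K) => //; exact: measurableT_comp. Qed.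

(** By Tonelli it is enough to bound the iterated integral of [|f|], and the bound [K] on the kernel
    reduces it to [K] times the product of the L1 norms of [A] and [B]. *)
Let if2 : (m1 \x m2)%E.-integrable setT (EFin \o f).
Proof.
apply/integrable12ltyP; first exact/measurable_EFinP.
have K0 : 0 <= K by rewrite (le_trans _ (kK point)).
apply: (@le_lt_trans _ _
  (\int[m1]_x (`|A x| * (K * Rintegral m2 setT (fun y => `|B y|)))%:E)%E).
  apply: ge0_le_integral => //.
  - by move=> x _; apply: integral_ge0.
  - apply: (measurable_fun_fubini_tonelli_F (m2 := m2) (fun z => `|(f z)%:E|)%E) => //.
    by apply: measurableT_comp => //; exact/measurable_EFinP.
  - apply/measurable_EFinP; apply: measurable_funM => //.
    by apply: measurableT_comp => //; exact: (L1_measurable iA).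
  - move=> x _.
    have iK : L1 m2 (fun y => `|A x| * (K * `|B y|)).
      by apply: L1Z; apply: L1Z; exact: L1_norm.
    apply: (@le_trans _ _ (\int[m2]_y (`|A x| * (K * `|B y|))%:E)%E).
      apply: ge0_le_integral => //.
      + apply/measurable_EFinP; apply: measurableT_comp => //.
        exact: (measurableT_comp mf).
      + exact: measurable_int iK.
      + move=> y _ /=; rewrite lee_fin /f /= !normrM ler_wpM2l//.
        by rewrite ler_wpM2r.
    rewrite -EFin_Rint// RintZ//; last by apply: L1Z; exact: L1_norm.
    by rewrite RintZ//; exact: L1_norm.
apply: integral_L1_lty.
apply: (L1_eq (h := fun x => (K * Rintegral m2 setT (fun y => `|B y|)) * `|A x|)).
  by move=> x; rewrite mulrC.
exact/L1Z/L1_norm.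
Qed.

Let innerE x : (\int[m2]_y (f (x, y))%:E)%E =
  (A x * Rintegral m2 setT (fun y => k (x, y) * B y))%:E.
Proof.
rewrite -RintZ; last exact: L1_kernel_l.
by rewrite EFin_Rint//; apply: L1Z; exact: L1_kernel_l.
Qed.

Let innerE' y : (\int[m1]_x (f (x, y))%:E)%E =
  (B y * Rintegral m1 setT (fun x => A x * k (x, y)))%:E.
Proof.
rewrite -RintZ; last exact: L1_kernel_r.
rewrite EFin_Rint; last by apply: L1Z; exact: L1_kernel_r.
by apply: eq_integral => x _; congr EFin; rewrite /f /=; ring.
Qed.

Lemma L1_Fubini_kernel :
  L1 m1 (fun x => A x * Rintegral m2 setT (fun y => k (x, y) * B y)).
Proof.
rewrite /L1; have := integrable_fubini_F if2.
by congr (integrable _ _ _); apply/funext => x; exact: innerE.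
Qed.

Lemma Rint_Fubini_kernel :
  Rintegral m1 setT (fun x => A x * Rintegral m2 setT (fun y => k (x, y) * B y)) =
  Rintegral m2 setT (fun y => B y * Rintegral m1 setT (fun x => A x * k (x, y))).
Proof.
congr fine.
have := Fubini if2 => H.
rewrite (eq_integral (fun x => (\int[m2]_y (EFin \o f) (x, y))%E)); last first.
  by move=> x _; rewrite innerE.
by rewrite H; apply: eq_integral => y _; rewrite -innerE'.
Qed.

End Fubini_kernel.

Section kernel_measurable.
Context d1 d2 (T1 : measurableType d1) (T2 : measurableType d2) (R : realType).
Variables (m2 : {sigma_finite_measure set T2 -> \bar R}).
Variables (B : T2 -> R) (k : T1 * T2 -> R) (K : R).
Hypotheses (iB : L1 m2 B).
Hypotheses (mk : measurable_fun setT k) (kK : forall z, `|k z| <= K).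

(** No integrable factor in [x] is present here, so measurability comes from Tonelli applied to the
    positive and negative parts of the integrand. *)
Lemma measurable_kernel_Rint :
  measurable_fun setT (fun x => Rintegral m2 setT (fun y => k (x, y) * B y)).
Proof.
pose f z : \bar R := (k z * B z.2)%:E.
have mf : measurable_fun setT f.
  apply/measurable_EFinP; apply: measurable_funM => //.
  by apply: measurableT_comp => //; exact: (L1_measurable iB).
apply/measurable_EFinP.
rewrite (_ : _ \o _ = (fun x => \int[m2]_y f^\+ (x, y) - \int[m2]_y f^\- (x, y))%E).
  apply: emeasurable_funB.
    by apply: (measurable_fun_fubini_tonelli_F (m2 := m2) f^\+%E) => //; exact: measurable_funepos.
  by apply: (measurable_fun_fubini_tonelli_F (m2 := m2) f^\-%E) => //; exact: measurable_funeneg.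
apply/funext => x /=; rewrite EFin_Rint; last exact: (@L1_kernel_l _ _ _ _ _ _ _ _ K).
rewrite integralE; congr (_ - _)%E; apply: eq_integral => y _.
  by rewrite -[LHS]/((f \o (fun y => (x, y)))^\+%E y) funepos_comp.
by rewrite -[LHS]/((f \o (fun y => (x, y)))^\-%E y) funeneg_comp.
Qed.

Lemma kernel_Rint_bounded x :
  `|Rintegral m2 setT (fun y => k (x, y) * B y)| <=
  K * Rintegral m2 setT (fun y => `|B y|).
Proof.
have ik := @L1_kernel_l _ _ _ _ _ m2 B k K iB mk kK x.
apply: (le_trans (norm_Rint ik)); rewrite -RintZ; last exact: L1_norm.
apply: le_Rint; first exact: L1_norm.
  by apply: L1Z; exact: L1_norm.
by move=> y; rewrite normrM ler_wpM2r.
Qed.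

End kernel_measurable.

(** * Gaussians on the line *)

Section real_derivatives.
Context {R : realType}.
Implicit Types (f g : R -> R) (x a b : R).

Lemma is_derive_add f g x a b : is_derive x (1 : R) f a -> is_derive x (1 : R) g b ->
  is_derive x (1 : R) (fun y => f y + g y) (a + b).
Proof. by move=> fa gb; apply: (@is_deriveD _ _ _ f g). Qed.

Lemma is_derive_mul f g x a b : is_derive x (1 : R) f a -> is_derive x (1 : R) g b ->
  is_derive x (1 : R) (fun y => f y * g y) (a * g x + f x * b).
Proof.
move=> fa gb; apply: (is_derive_eq (@is_deriveM _ _ f g x 1 a b fa gb)).
by rewrite /GRing.scale/= addrC (mulrC (g x)).
Qed.

Lemma is_derive_const c x : is_derive x (1 : R) (fun=> c : R) 0.
Proof. exact: is_derive_cst. Qed.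

Lemma is_derive_var x : is_derive x (1 : R) (fun y : R => y) 1.
Proof. exact: is_derive_id. Qed.

Lemma is_derive_comp f g x a b : is_derive (g x) (1 : R) f a ->
  is_derive x (1 : R) g b -> is_derive x (1 : R) (fun y => f (g y)) (a * b).
Proof. by move=> fa gb; apply: (is_derive1_comp fa gb). Qed.

Lemma is_derive_affine a b x : is_derive x (1 : R) (fun y => a * y + b) a.
Proof.
apply: (is_derive_eq (is_derive_add (is_derive_mul (is_derive_const a x)
  (is_derive_var x)) (is_derive_const b x))).
by rewrite mul0r add0r addr0 mulr1.
Qed.

Lemma is_derive_continuous f f' : (forall x, is_derive x (1 : R) f (f' x)) ->
  continuous f.
Proof.
move=> df x; apply/differentiable_continuous/derivable1_diffP.
exact: (@ex_derive _ _ _ _ _ _ _ (df x)).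
Qed.

Lemma measurable_cos : measurable_fun setT (@cos R).
Proof. by apply: continuous_measurable_fun; exact: continuous_cos. Qed.

Lemma measurable_sin : measurable_fun setT (@sin R).
Proof. by apply: continuous_measurable_fun; exact: continuous_sin. Qed.

End real_derivatives.

Section gaussian_line.
Context {R : realType}.
Local Notation mu := (@lebesgue_measure R).
Implicit Types (c x y xi theta : R).

Definition gs c x : R := expR (- (c * x ^+ 2)).

Lemma gs_ge0 c x : 0 <= gs c x. Proof. exact: expR_ge0. Qed.

Lemma is_derive_gs c x : is_derive x (1 : R) (gs c) (- (2 * c * x) * gs c x).
Proof.
rewrite /gs.
have h : is_derive x (1 : R) (fun y => - (c * y ^+ 2)) (- (2 * c * x)).
  have -> : (fun y => - (c * y ^+ 2)) = (fun y => - c * (y * y)).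
    by apply/funext => y; rewrite expr2 mulNr.
  apply: (is_derive_eq (is_derive_mul (is_derive_const (- c) x)
    (is_derive_mul (is_derive_var x) (is_derive_var x)))).
  by ring.
apply: (is_derive_eq (is_derive_comp (is_derive_expR _) h)).
by rewrite mulrC.
Qed.

Lemma continuous_gs c : continuous (gs c).
Proof. exact: (is_derive_continuous (is_derive_gs c)). Qed.

Lemma measurable_gs c : measurable_fun setT (gs c).
Proof. by apply: continuous_measurable_fun; exact: continuous_gs. Qed.

(** Up to its total mass, the Gaussian centred at [y] is the normal density of variance [1 / (2c)],
    which supplies integrability and the value of the integral. *)
Let gs_normal c x y : 0 < c ->
  gs c (x - y) = Num.sqrt (pi / c) * normal_pdf y (Num.sqrt (2 * c)^-1) x.
Proof.
move=> c0; have s0 : 0 < Num.sqrt (2 * c)^-1 by rewrite sqrtr_gt0 invr_gt0 mulr_gt0.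
rewrite normal_pdfE ?gt_eqF// /normal_peak /normal_fun sqr_sqrtr; last first.
  by rewrite invr_ge0 mulr_ge0// ltW.
have -> : ((2 * c)^-1 * pi *+ 2) = pi / c :> R.
  by rewrite -mulr_natr; field; rewrite gt_eqF.
rewrite mulrA divff ?mul1r; last by rewrite gt_eqF// sqrtr_gt0 divr_gt0// pi_gt0.
congr expR; rewrite -mulr_natr; field.
by rewrite gt_eqF.
Qed.

Lemma L1_gs c y : 0 < c -> L1 mu (fun x => gs c (x - y)).
Proof.
move=> c0; have s0 : 0 < Num.sqrt (2 * c)^-1 by rewrite sqrtr_gt0 invr_gt0 mulr_gt0.
apply: (@L1_eq _ _ _ mu (fun x => Num.sqrt (pi / c) * normal_pdf y (Num.sqrt (2 * c)^-1) x)).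
  by move=> x; rewrite gs_normal.
by apply: L1Z; apply: integrable_normal_pdf; rewrite gt_eqF.
Qed.

Lemma integral_gs c y : 0 < c ->
  (\int[mu]_x (gs c (x - y))%:E = (Num.sqrt (pi / c))%:E)%E.
Proof.
move=> c0; have s0 : 0 < Num.sqrt (2 * c)^-1 by rewrite sqrtr_gt0 invr_gt0 mulr_gt0.
under eq_integral do rewrite gs_normal// EFinM.
rewrite integralZl//; last by apply: integrable_normal_pdf; rewrite gt_eqF.
by rewrite integral_normal_pdf ?mule1// gt_eqF.
Qed.

Lemma L1_gs0 c : 0 < c -> L1 mu (gs c).
Proof.
by move=> c0; apply: (@L1_eq _ _ _ mu (fun x => gs c (x - 0)) _ _ (L1_gs 0 c0)) => x; rewrite subr0.
Qed.

(** Half of the Gaussian absorbs the linear factor: [|x| <= 1 + x^2], and [z * expR (- z) <= 1] with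
    [z = c x^2 / 2] bounds [gs (c / 2) x * x^2] by [2 / c]. *)
Lemma L1_gs_mul c (k : R -> R) K : 0 < c -> measurable_fun setT k ->
  (forall x, `|k x| <= K * (1 + `|x|)) -> L1 mu (fun x => gs c x * k x).
Proof.
move=> c0 mk kK.
have K0 : 0 <= K.
  by have := le_trans (normr_ge0 _) (kK 0); rewrite normr0 addr0 mulr1.
apply: (@L1_dominated _ _ _ mu _
  (fun x => K * (2 * gs c x + 2 / c * gs (c / 2) x))).
- by apply: measurable_funM => //; exact: measurable_gs.
- move=> x; rewrite normrM (ger0_norm (gs_ge0 _ _)).
  apply: (le_trans (ler_wpM2l (gs_ge0 _ _) (kK x))).
  rewrite mulrCA ler_wpM2l//.
  have -> : gs c x = gs (c / 2) x * gs (c / 2) x.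
    by rewrite /gs -expRD; congr expR; field.
  have h1 : gs (c / 2) x * (c / 2 * x ^+ 2) <= 1.
    rewrite [leRHS](_ : _ = gs (c / 2) x * expR (c / 2 * x ^+ 2)); last first.
      by rewrite /gs -expRD addNr expR0.
    rewrite ler_wpM2l ?gs_ge0// (le_trans _ (expR_ge1Dx _))//.
    by rewrite lerDr.
  have h2 : `|x| <= 1 + x ^+ 2 by rewrite -(real_normK (num_real x)); nra.
  set G := gs (c / 2) x in h1 *; have G0 : 0 <= G by exact: gs_ge0.
  rewrite mulrDr mulr1.
  have h3 : G * x ^+ 2 <= 2 / c.
    have -> : G * x ^+ 2 = 2 / c * (G * (c / 2 * x ^+ 2)) by field; rewrite gt_eqF.
    by rewrite ler_piMr// divr_ge0// ltW.
  have h4 : G * G * `|x| <= G * G + G * (2 / c).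
    apply: (le_trans (ler_wpM2l (mulr_ge0 G0 G0) h2)).
    by rewrite mulrDr mulr1 lerD2l -mulrA ler_wpM2l.
  rewrite [leRHS](_ : _ = G * G + (G * G + G * (2 / c))); last by ring.
  by rewrite lerD2l.
- by apply: L1Z; apply: L1D; apply: L1Z; apply: L1_gs0 => //; rewrite divr_gt0.
Qed.

Lemma cvg_gs c (u : nat -> R) : 0 < c -> (forall n, n%:R <= `|u n|) ->
  (fun n => gs c (u n)) @ \oo --> (0 : R).
Proof.
move=> c0 un; apply/cvgrPdist_lt => e e0.
near=> n; rewrite sub0r normrN ger0_norm ?gs_ge0//.
have n0 : (0 : R) < n%:R by rewrite ltr0n; near: n; exact: nbhs_infty_gt.
have h : c * n%:R <= c * u n ^+ 2.
  rewrite ler_pM2l// -(real_normK (num_real (u n))).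
  rewrite (@le_trans _ _ (n%:R ^+ 2))//; last by rewrite ler_pXn2r ?nnegrE ?ler0n.
  by rewrite expr2 ler_peMr ?ler0n// ler1n; near: n; exact: nbhs_infty_gt.
apply: (@le_lt_trans _ _ (expR (- (c * n%:R)))).
  by rewrite ler_expR lerN2.
rewrite expRN invf_plt ?posrE ?expR_gt0//.
apply: (lt_le_trans _ (expR_ge1Dx _)).
rewrite (@lt_trans _ _ (c * n%:R))//; last by rewrite ltrDr.
rewrite -ltr_pdivrMl//; near: n.
exact: nbhs_infty_gtr.
Unshelve. all: by end_near. Qed.

Let phase_meas xi theta : measurable_fun setT (fun x : R => xi * x + theta).
Proof. by apply: measurable_funD => //; apply: measurable_funM. Qed.

Let is_derive_gs_sin c xi theta x :
  is_derive x (1 : R) (fun y => gs c y * sin (xi * y + theta))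
    (gs c x * (xi * cos (xi * x + theta) - 2 * c * x * sin (xi * x + theta))).
Proof.
apply: (is_derive_eq (is_derive_mul (is_derive_gs c x)
  (is_derive_comp (is_derive_sin _) (is_derive_affine xi theta x)))).
by ring.
Qed.

(** The integrand is the derivative of [gs c x * sin (xi x + theta)], which vanishes at infinity;
    the fundamental theorem of calculus on [[-(n+1), n+1]] and dominated convergence give the value.
    This is the integration by parts behind [Rint_gs_cos]. *)
Let Rint_derive_gs c xi theta : 0 < c ->
  Rintegral mu setT
    (fun x => gs c x * (xi * cos (xi * x + theta) - 2 * c * x * sin (xi * x + theta))) = 0.
Proof.
move=> c0; set f := fun x => _.
have cf : continuous f.
  have dmul x : is_derive x (1:R) (fun y => xi * cos (xi * y + theta) - 2 * c * y * sin (xi * y + theta))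
     (- (xi ^+ 2 + 2 * c) * sin (xi * x + theta) - 2 * c * xi * x * cos (xi * x + theta)).
    have -> : (fun y => xi * cos (xi * y + theta) - 2 * c * y * sin (xi * y + theta)) =
      (fun y => xi * cos (xi * y + theta) + (- 2 * c) * (y * sin (xi * y + theta))).
      by apply/funext => y; ring.
    apply: (is_derive_eq (is_derive_add
      (is_derive_mul (is_derive_const xi x)
         (is_derive_comp (is_derive_cos _) (is_derive_affine xi theta x)))
      (is_derive_mul (is_derive_const (- 2 * c) x)
        (is_derive_mul (is_derive_var x)
         (is_derive_comp (is_derive_sin _) (is_derive_affine xi theta x)))))).
    by ring.
  by apply: is_derive_continuous => x; exact: (is_derive_mul (is_derive_gs c x) (dmul x)).
pose F x := gs c x * sin (xi * x + theta).
have dF x : is_derive x (1 : R) F (f x) by exact: is_derive_gs_sin.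
have mf : measurable_fun setT f by exact: continuous_measurable_fun.
have i_f : L1 mu f.
  apply: (@L1_gs_mul _ _ (`|xi| + 2 * c)) => //.
    apply: measurable_funB; apply: measurable_funM => //.
    - by apply: measurableT_comp; [exact: measurable_cos|exact: phase_meas].
    - by apply: measurableT_comp; [exact: measurable_sin|exact: phase_meas].
  move=> x; apply: (le_trans (ler_normB _ _)).
  have := cos_max (xi * x + theta); have := sin_max (xi * x + theta).
  set C := cos _; set S := sin _ => S1 C1.
  rewrite !normrM (ger0_norm (ltW c0)) normr_nat.
  have h1 : `|xi| * `|C| <= `|xi| by rewrite ler_piMr.
  have h2 : 2 * c * `|x| * `|S| <= 2 * c * `|x| by rewrite ler_piMr// !mulr_ge0// ltW.
  apply: (le_trans (lerD h1 h2)).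
  have : 0 <= `|xi| * `|x| by rewrite mulr_ge0.
  by nra.
have ftc n : Rintegral mu `[- n.+1%:R, n.+1%:R] f = F n.+1%:R - F (- n.+1%:R).
  rewrite /Rintegral (@continuous_FTC2 _ f F)//.
  - by apply: (@lt_trans _ _ 0); rewrite ?oppr_lt0 ltr0n.
  - by apply: continuous_subspaceT.
  - have cF := is_derive_continuous dF.
    split.
    + by move=> x _; exact: (@ex_derive _ _ _ _ _ _ _ (dF x)).
    + exact/cvg_at_right_filter/cF.
    + exact/cvg_at_left_filter/cF.
  - by move=> x _; rewrite derive1E; exact: (@derive_val _ _ _ _ _ _ _ (dF x)).
have lim1 : (fun n : nat => Rintegral mu `[- n.+1%:R, n.+1%:R] f) @ \oo --> (0 : R).
  rewrite (_ : (fun n : nat => _) = (fun n => F n.+1%:R - F (- n.+1%:R))); last first.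
    exact/funext.
  rewrite -[X in _ --> X](subr0 (0 : R)); apply: cvgB.
    apply: (@squeeze_cvgr _ _ _ _ (fun n => - gs c n.+1%:R) (fun n => gs c n.+1%:R)).
    - apply: nearW => n; rewrite -ler_norml /F normrM ger0_norm ?gs_ge0//.
      by rewrite ler_piMr ?gs_ge0 ?sin_max.
    - rewrite -[X in _ --> X]oppr0; apply: cvgN; apply: cvg_gs => // n.
      by rewrite ger0_norm ?ler0n ?ler_nat.
    - by apply: cvg_gs => // n; rewrite ger0_norm ?ler0n ?ler_nat.
  apply: (@squeeze_cvgr _ _ _ _ (fun n => - gs c (- n.+1%:R)) (fun n => gs c (- n.+1%:R))).
  - apply: nearW => n; rewrite -ler_norml /F normrM ger0_norm ?gs_ge0//.
    by rewrite ler_piMr ?gs_ge0 ?sin_max.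
  - rewrite -[X in _ --> X]oppr0; apply: cvgN; apply: cvg_gs => // n.
    by rewrite normrN ger0_norm ?ler0n ?ler_nat.
  - by apply: cvg_gs => // n; rewrite normrN ger0_norm ?ler0n ?ler_nat.
have [_ lim2] : L1 mu f /\
  (fun n : nat => Rintegral mu setT (f \_ `[- n.+1%:R, n.+1%:R])) @ \oo --> Rintegral mu setT f.
  apply: (@L1_dominated_cvg _ _ _ mu _ _ (fun x => `|f x|)) => //.
  - move=> n; apply: (iffLR (measurable_restrictT f (measurable_itv _))).
    exact: (measurable_funS measurableT (@subsetT _ _) mf).
  - apply: aeW => x; apply: cvg_near_cst; near=> n.
    rewrite patchE mem_set//= in_itv/= -ler_norml.
    apply: (@le_trans _ _ n%:R); last by rewrite ler_nat.
    by near: n; exact: nbhs_infty_ger.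
  - exact: L1_norm.
  - by apply: aeW => x n; rewrite patchE; case: ifP => // _; rewrite normr0.
apply/esym; apply: (cvg_unique _ lim1) => //=.
move: lim2; rewrite (_ : (fun n => _) = (fun n : nat => Rintegral mu `[- n.+1%:R, n.+1%:R] f))//.
by apply/funext => n; rewrite [RHS]Rintegral_mkcond.
Unshelve. all: by end_near. Qed.

Lemma L1_gs_cos c xi theta : 0 < c -> L1 mu (fun x => gs c x * cos (xi * x + theta)).
Proof.
move=> c0; apply: (@L1_gs_mul _ _ 1) => //.
  by apply: measurableT_comp; [exact: measurable_cos|exact: phase_meas].
by move=> x; rewrite mul1r (le_trans (cos_max _))// lerDl.
Qed.

(** As a function of [xi] the integral [F] solves [F' = - xi / (2c) * F]: differentiation under the
    integral sign produces a factor [- x], and integration by parts trades it for [xi]. Hence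
    [F xi * expR (xi^2 / (4c))] is constant, equal to its value at 0. *)
Lemma Rint_gs_cos c xi theta : 0 < c ->
  Rintegral mu setT (fun x => gs c x * cos (xi * x + theta)) =
  cos theta * (Num.sqrt (pi / c) * expR (- (xi ^+ 2 / (4 * c)))).
Proof.
move=> c0.
pose f (xi : R) (x : measurableTypeR R) := gs c x * cos (xi * x + theta).
pose F xi := Rintegral mu setT (f xi).
have df z x : is_derive z (1 : R) (f ^~ x) (- x * gs c x * sin (z * x + theta)).
  rewrite /f.
  have h : is_derive z (1 : R) (fun y => y * x + theta) x.
    have -> : (fun y => y * x + theta) = (fun y => x * y + theta).
      by apply/funext => y; rewrite mulrC.
    exact: is_derive_affine.
  apply: (is_derive_eq (is_derive_mul (is_derive_const (gs c x) z)
     (is_derive_comp (is_derive_cos _) h))).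
  by ring.
have dfE z x : partial1of2 f z x = - x * gs c x * sin (z * x + theta).
  by rewrite partial1of2E; exact: (@derive_val _ _ _ _ _ _ _ (df z x)).
have dF z : is_derive z (1 : R) F (- z / (2 * c) * F z).
  have zI : `]z - 1, z + 1[%classic z.
    by rewrite /= in_itv/= ltrBlDr ltrDl ltr01.
  have igx : L1 mu (fun x => gs c x * `|x|).
    by apply: (@L1_gs_mul _ _ 1) => // x; rewrite normr_id mul1r lerDr.
  have hyp1 x : `]z - 1, z + 1[%classic x -> mu.-integrable setT (EFin \o f x).
    by move=> _; exact: L1_gs_cos.
  have hyp2 x y : `]z - 1, z + 1[%classic x -> [set: R] y -> derivable (f ^~ y) x 1.
    by move=> _ _; exact: (@ex_derive _ _ _ _ _ _ _ (df x y)).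
  have hyp3 (y : R) : 0 <= gs c y * `|y| by rewrite mulr_ge0// gs_ge0.
  have hyp4 x y : `]z - 1, z + 1[%classic x -> [set: R] y ->
      `|partial1of2 f x y| <= gs c y * `|y|.
    move=> _ _; rewrite dfE !normrM normrN (ger0_norm (gs_ge0 _ _)).
    rewrite (mulrC `|y|) ler_piMr ?sin_max// mulr_ge0// gs_ge0.
  have d1 := @derivable_under_integral _ _ _ mu f setT measurableT z (z - 1) (z + 1)
    zI hyp1 hyp2 _ hyp3 igx hyp4.
  have d2 := @differentiation_under_integral _ _ _ mu f setT measurableT z (z - 1) (z + 1)
    zI hyp1 hyp2 _ hyp3 igx hyp4.
  apply: DeriveDef; first exact: d1.
  rewrite -derive1E d2.
  have i1 : L1 mu (fun x => gs c x * (- x * sin (z * x + theta))).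
    apply: (@L1_gs_mul _ _ 1) => //.
      apply: measurable_funM; first exact: measurable_funN.
      by apply: measurableT_comp; [exact: measurable_sin|exact: phase_meas].
    move=> x; rewrite normrM normrN mul1r (le_trans (ler_piMr _ (sin_max _)))//.
    by rewrite lerDr.
  (* Adding the vanishing integral of [Rint_derive_gs] cancels the cosine term and leaves the sine
     integral, which is the derivative of [F]. *)
  have -> : - z / (2 * c) * F z = (Rintegral mu setT
       (fun x => gs c x * (z * cos (z * x + theta) - 2 * c * x * sin (z * x + theta))) - z * F z) / (2 * c).
    by rewrite Rint_derive_gs//; ring.
  have -> : Rintegral mu setT
       (fun x => gs c x * (z * cos (z * x + theta) - 2 * c * x * sin (z * x + theta))) =
     z * F z + (2 * c) * Rintegral mu setT (fun x => gs c x * (- x * sin (z * x + theta))).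
    rewrite /F -RintZ; last exact: L1_gs_cos.
    rewrite -RintZ// -RintD; last 2 first.
    - by apply: L1Z; exact: L1_gs_cos.
    - exact: L1Z.
    by apply: eq_Rint => x; rewrite /f; ring.
  rewrite addrAC subrr add0r mulrC mulKf; last by rewrite gt_eqF// mulr_gt0.
  by apply: eq_Rint => x; rewrite dfE; ring.
pose P z := F z * expR (z ^+ 2 / (4 * c)).
have dP z : is_derive z (1 : R) P 0.
  have hq : is_derive z (1 : R) (fun y => y ^+ 2 / (4 * c)) (z / (2 * c)).
    have -> : (fun y => y ^+ 2 / (4 * c)) = (fun y => (4 * c)^-1 * (y * y)).
      by apply/funext => y; rewrite expr2 mulrC.
    apply: (is_derive_eq (is_derive_mul (is_derive_const _ z)
      (is_derive_mul (is_derive_var z) (is_derive_var z)))).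
    by field; rewrite gt_eqF.
  apply: (is_derive_eq (is_derive_mul (dF z) (is_derive_comp (is_derive_expR _) hq))).
  by ring.
have P0 := is_derive_0_is_cst xi 0 dP.
have F0 : F 0 = cos theta * Num.sqrt (pi / c).
  rewrite /F (@eq_Rint _ _ _ mu _ (fun x => cos theta * gs c x)); last first.
    by move=> x; rewrite /f mul0r add0r mulrC.
  rewrite RintZ; last exact: L1_gs0.
  congr (_ * _); rewrite -[RHS]/(fine (Num.sqrt (pi / c))%:E) -(integral_gs 0 c0).
  by congr fine; apply: eq_integral => x _; rewrite subr0.
have : F xi = P xi * expR (- (xi ^+ 2 / (4 * c))).
  by rewrite /P -mulrA -expRD subrr expR0 mulr1.
rewrite P0 /P F0 expr0n/= mul0r expR0 mulr1 -mulrA.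
by move=> <-.
Qed.

End gaussian_line.

(** * Gaussians on R^n *)

Section rV_measurability.
Context {R : realType} (n : nat).
Local Notation E := 'rV[R]_n.

Lemma measurable_coord d (T : measurableType d) (f : T -> E) i :
  measurable_fun setT f -> measurable_fun setT (fun t => f t ord0 i).
Proof.
move=> mf; apply: (@measurableT_comp _ _ _ _ _ _ (rV_coord i)) => //.
exact: measurable_rV_coord.
Qed.

Lemma measurable_dotp d (T : measurableType d) (f g : T -> E) :
  measurable_fun setT f -> measurable_fun setT g ->
  measurable_fun setT (fun t => dotp (f t) (g t)).
Proof.
move=> mf mg; rewrite /dotp; apply: measurable_sum => i.
by apply: measurable_funM; exact: measurable_coord.
Qed.

Lemma measurable_rVB d (T : measurableType d) (f g : T -> E) :
  measurable_fun setT f -> measurable_fun setT g ->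
  measurable_fun setT (fun t => f t - g t).
Proof.
move=> mf mg; apply: measurable_to_rV => i.
rewrite (_ : _ \o _ = (fun t => f t ord0 i - g t ord0 i)); last first.
  by apply/funext => t; rewrite /rV_coord /= !mxE.
by apply: measurable_funB; exact: measurable_coord.
Qed.

Lemma measurable_enorm d (T : measurableType d) (f : T -> E) :
  measurable_fun setT f -> measurable_fun setT (fun t => enorm (f t)).
Proof.
move=> mf; apply: (@measurableT_comp _ _ _ _ _ _ (@Num.sqrt R)); last exact: measurable_dotp.
by apply: continuous_measurable_fun; exact: sqrt_continuous.
Qed.

Lemma dotpC (x y : E) : dotp x y = dotp y x.
Proof. by apply: eq_bigr => i _; rewrite mulrC. Qed.

Lemma dotpDl (x y z : E) : dotp (x + y) z = dotp x z + dotp y z.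
Proof. by rewrite /dotp -big_split; apply: eq_bigr => i _; rewrite mxE mulrDl. Qed.

Lemma dotpNl (x z : E) : dotp (- x) z = - dotp x z.
Proof. by rewrite /dotp -sumrN; apply: eq_bigr => i _; rewrite mxE mulNr. Qed.

Lemma dotpBl (x y z : E) : dotp (x - y) z = dotp x z - dotp y z.
Proof. by rewrite dotpDl dotpNl. Qed.

Lemma dotpZl (c : R) (x z : E) : dotp (c *: x) z = c * dotp x z.
Proof. by rewrite /dotp mulr_sumr; apply: eq_bigr => i _; rewrite mxE mulrA. Qed.

Lemma dotpDr (x y z : E) : dotp z (x + y) = dotp z x + dotp z y.
Proof. by rewrite !(dotpC z) dotpDl. Qed.

Lemma dotpBr (x y z : E) : dotp z (x - y) = dotp z x - dotp z y.
Proof. by rewrite !(dotpC z) dotpBl. Qed.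

Lemma dotpNr (x z : E) : dotp z (- x) = - dotp z x.
Proof. by rewrite !(dotpC z) dotpNl. Qed.

Lemma dotpZr (c : R) (x z : E) : dotp z (c *: x) = c * dotp z x.
Proof. by rewrite !(dotpC z) dotpZl. Qed.

Lemma dotp0l (x : E) : dotp 0 x = 0.
Proof. by rewrite /dotp big1// => i _; rewrite mxE mul0r. Qed.

Lemma dotpxx_ge0 (x : E) : 0 <= dotp x x.
Proof. by apply: sumr_ge0 => i _; rewrite -expr2 sqr_ge0. Qed.

Lemma enorm_ge0 (x : E) : 0 <= enorm x.
Proof. exact: sqrtr_ge0. Qed.

Lemma sqr_enorm (x : E) : enorm x ^+ 2 = dotp x x.
Proof. by rewrite sqr_sqrtr// dotpxx_ge0. Qed.

Lemma sqr_coord_le (x : E) i : x ord0 i ^+ 2 <= dotp x x.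
Proof.
rewrite /dotp (bigD1 i)//= expr2 lerDl.
by apply: sumr_ge0 => j _; rewrite -expr2 sqr_ge0.
Qed.

Lemma coord_le_enorm (x : E) i : `|x ord0 i| <= enorm x.
Proof.
rewrite -(@ler_pXn2r _ 2%N) ?nnegrE ?enorm_ge0// real_normK ?num_real//.
by rewrite sqr_enorm sqr_coord_le.
Qed.

Lemma norm_le_enorm (x : E) : `|x| <= enorm x.
Proof.
rewrite -[leLHS]/(mx_norm x).
have [->|/mx_norm_neq0[[i j] ->]] := eqVneq (mx_norm x) 0; first exact: enorm_ge0.
by rewrite (ord1 i); exact: coord_le_enorm.
Qed.

End rV_measurability.

(** * Lebesgue measure on R^n through iterated integrals *)

Section iterated_integrals.
Context {R : realType}.
Local Notation leb := (@lebesgue_measure R).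

Lemma dotp_cons n (r s : measurableTypeR R) (x y : 'rV[R]_n) :
  dotp (cons_rV (r, x)) (cons_rV (s, y)) = r * s + dotp x y.
Proof.
rewrite /dotp big_ord_recl !cons_rV0; congr (_ + _).
by apply: eq_bigr => i _; rewrite !cons_rVS.
Qed.

Lemma ge0_integral_rVS n (f : 'rV[R]_n.+1 -> \bar R) :
  measurable_fun setT f -> (forall x, (0 <= f x)%E) ->
  (\int[lebesgue_rV n.+1]_x f x =
   \int[leb]_r \int[lebesgue_rV n]_x f (cons_rV (r, x)))%E.
Proof.
move=> mf f0.
rewrite -(fubini_tonelli1 (fun p => f (cons_rV p)))//; last first.
  by apply: measurableT_comp => //; exact: measurable_cons_rV.
have := @ge0_integral_pushforward _ _ _ _ R _ (@measurable_cons_rV R n)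
  (leb \x lebesgue_rV n)%E setT f measurableT mf (fun x _ => f0 x).
by rewrite preimage_setT.
Qed.

Lemma Rint_rVS n (h : 'rV[R]_n.+1 -> R) : L1 (lebesgue_rV n.+1) h ->
  (forall r, L1 (lebesgue_rV n) (fun x => h (cons_rV (r, x)))) ->
  Rintegral (lebesgue_rV n.+1) setT h =
  Rintegral leb setT
    (fun r => Rintegral (lebesgue_rV n) setT (fun x => h (cons_rV (r, x)))).
Proof.
move=> ih ihr; have mh := L1_measurable ih.
have mhc : measurable_fun setT (h \o @cons_rV R n).
  by apply: measurableT_comp => //; exact: measurable_cons_rV.
have ihc : (leb \x lebesgue_rV n)%E.-integrable setT (EFin \o (h \o @cons_rV R n)).
  apply/integrableP; split; first exact/measurable_EFinP.
  rewrite fubini_tonelli1//; last first.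
    by apply: measurableT_comp => //; exact/measurable_EFinP.
  move/integrableP : ih => [_]; rewrite ge0_integral_rVS//.
  by apply: measurableT_comp => //; exact/measurable_EFinP.
congr fine.
have := @integral_pushforward _ _ _ _ R _ (@measurable_cons_rV R n)
  (leb \x lebesgue_rV n)%E setT (EFin \o h).
rewrite preimage_setT => H.
transitivity (\int[leb \x lebesgue_rV n]_p (h (cons_rV p))%:E)%E.
  by apply: H => //; exact/measurable_EFinP.
have <- := integral12_prod_meas1 ihc.
by apply: eq_integral => r _; rewrite EFin_Rint.
Qed.

Lemma ge0_integral_prod n (h : 'I_n -> R -> R) :
  (forall i, measurable_fun setT (h i)) -> (forall i x, 0 <= h i x) ->
  (\int[lebesgue_rV n]_x (\prod_(i < n) h i (x ord0 i))%:E =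
   \prod_(i < n) \int[leb]_r (h i r)%:E)%E.
Proof.
elim: n h => [|n IHn] h mh h0.
  rewrite /= integral_dirac//; last first.
    rewrite (_ : (fun x => _) = cst 1%E)//.
    by apply/funext => x; rewrite big_ord0.
  by rewrite !big_ord0 diracT mul1e.
have mP m (k : 'I_m -> R -> R) : (forall i, measurable_fun setT (k i)) ->
    measurable_fun setT (fun x : 'rV[R]_m => \prod_(i < m) k i (x ord0 i)).
  move=> mk; apply: measurable_prod => i _.
  by apply: (@measurableT_comp _ _ _ _ _ _ (k i)) => //; exact: measurable_coord.
rewrite ge0_integral_rVS; last 2 first.
- by apply/measurable_EFinP; exact: mP.
- by move=> x; rewrite lee_fin prodr_ge0.
rewrite big_ord_recl -(IHn (fun i => h (lift ord0 i)))//.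
set V := (\int[lebesgue_rV n]_x _)%E.
have V0 : (0 <= V)%E by apply: integral_ge0 => x _; rewrite lee_fin prodr_ge0.
rewrite -ge0_integralZr//; last 2 first.
- by have /measurable_EFinP := mh ord0.
- by move=> x _; rewrite lee_fin.
apply: eq_integral => r _; rewrite -ge0_integralZl_EFin//; last 2 first.
- by move=> x _; rewrite lee_fin prodr_ge0.
- apply/measurable_EFinP; exact: (mP n (fun i => h (lift ord0 i))).
apply: eq_integral => x _; rewrite big_ord_recl cons_rV0 EFinM; congr (_ * _%:E)%E.
by apply: eq_bigr => i _; rewrite cons_rVS.
Qed.

End iterated_integrals.

Section gaussian.
Context {R : realType}.
Local Notation leb := (@lebesgue_measure R).
Implicit Types (c theta : R).

Definition gauss n c (x : 'rV[R]_n) : R := expR (- (c * dotp x x)).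

Lemma gauss_ge0 n c (x : 'rV[R]_n) : 0 <= gauss c x.
Proof. exact: expR_ge0. Qed.

Lemma gauss_le1 n c (x : 'rV[R]_n) : 0 <= c -> gauss c x <= 1.
Proof. by move=> c0; rewrite -expR0 ler_expR oppr_le0 mulr_ge0// dotpxx_ge0. Qed.

Lemma measurable_gauss n c d (T : measurableType d) (f : T -> 'rV[R]_n) :
  measurable_fun setT f -> measurable_fun setT (fun t => gauss c (f t)).
Proof.
move=> mf; apply: (@measurableT_comp _ _ _ _ _ _ (fun z : R => expR (- (c * z)))).
  by apply: measurableT_comp => //; apply: measurable_funN; exact: measurable_funM.
exact: measurable_dotp.
Qed.

Lemma gauss_prod n c (x y : 'rV[R]_n) :
  gauss c (x - y) = \prod_(i < n) gs c (x ord0 i - y ord0 i).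
Proof.
rewrite /gauss /gs -expR_sum sumrN; congr (expR (- _)).
by rewrite /dotp mulr_sumr; apply: eq_bigr => i _; rewrite !mxE expr2.
Qed.

Lemma integral_gauss n c (y : 'rV[R]_n) : 0 < c ->
  (\int[lebesgue_rV n]_x (gauss c (x - y))%:E = (Num.sqrt (pi / c) ^+ n)%:E)%E.
Proof.
move=> c0; under eq_integral do rewrite gauss_prod.
rewrite (ge0_integral_prod (h := fun i r => gs c (r - y ord0 i))); last 2 first.
- by move=> i; apply: measurableT_comp; [exact: measurable_gs|exact: measurable_funB].
- by move=> i x; exact: gs_ge0.
rewrite (eq_bigr (fun=> (Num.sqrt (pi / c))%:E)); last by move=> i _; rewrite integral_gs.
by rewrite prodEFin prodr_const card_ord.
Qed.

Lemma L1_gauss n c (y : 'rV[R]_n) : 0 < c ->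
  L1 (lebesgue_rV n) (fun x => gauss c (x - y)).
Proof.
move=> c0; apply: L1_ge0.
- by apply: measurable_gauss; exact: measurable_rVB.
- by move=> x; exact: gauss_ge0.
- by rewrite integral_gauss// ltry.
Qed.

Lemma Rint_gauss n c (y : 'rV[R]_n) : 0 < c ->
  Rintegral (lebesgue_rV n) setT (fun x => gauss c (x - y)) = Num.sqrt (pi / c) ^+ n.
Proof. by move=> c0; rewrite /Rintegral integral_gauss. Qed.

Lemma L1_gauss0 n c : 0 < c -> L1 (lebesgue_rV n) (@gauss n c).
Proof.
move=> c0; have := L1_gauss (0 : 'rV[R]_n) c0.
by apply: L1_eq => x; rewrite subr0.
Qed.

Lemma L1_gauss_cos n c (xi : 'rV[R]_n) theta : 0 < c ->
  L1 (lebesgue_rV n) (fun x => gauss c x * cos (dotp xi x + theta)).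
Proof.
move=> c0; apply: (@L1_bounded_mul _ _ _ _ _ _ 1); first exact: L1_gauss0.
  apply: measurableT_comp; first exact: measurable_cos.
  by apply: measurable_funD => //; exact: measurable_dotp.
by move=> x; exact: cos_max.
Qed.

(** Induction on the dimension: for a fixed first coordinate [r] the integral over the others has
    the same form with phase [s r + theta], and a one-dimensional integral in [r] remains. The free
    phase is what closes the induction; [theta = - pi / 2] also turns the cosine into a sine. *)
Lemma Rint_gauss_cos n c (xi : 'rV[R]_n) theta : 0 < c ->
  Rintegral (lebesgue_rV n) setT (fun x => gauss c x * cos (dotp xi x + theta)) =
  cos theta * (Num.sqrt (pi / c) ^+ n * gauss (4 * c)^-1 xi).
Proof.
move=> c0; elim: n xi theta => [|n IHn] xi theta.
  rewrite /Rintegral /= integral_dirac//; last first.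
    by apply/measurable_EFinP; exact: L1_measurable (@L1_gauss_cos 0 c xi theta c0).
  by rewrite diracT mul1e /= /gauss /dotp !big_ord0 !mulr0 oppr0 expR0 expr0 add0r !mulr1 mul1r.
rewrite -(uncons_rVK xi); case: (uncons_rV xi) => s eta {xi}.
have E r x : gauss c (cons_rV (r, x)) * cos (dotp (cons_rV (s, eta)) (cons_rV (r, x)) + theta)
   = gs c r * (gauss c x * cos (dotp eta x + (s * r + theta))).
  rewrite !dotp_cons /gauss dotp_cons mulrA /gs -expRD -expr2; congr (expR _ * cos _); ring.
rewrite Rint_rVS; last 2 first.
- exact: L1_gauss_cos.
- move=> r; apply: (L1_eq (fun x => esym (E r x))).
  by apply: L1Z; exact: L1_gauss_cos.
pose K := Num.sqrt (pi / c) ^+ n * gauss (4 * c)^-1 eta.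
rewrite (@eq_Rint _ _ _ leb _ (fun r => K * (gs c r * cos (s * r + theta)))); last first.
  move=> r; rewrite (@eq_Rint _ _ _ _ _ (fun x => gs c r * (gauss c x * cos (dotp eta x + (s * r + theta))))).
    rewrite RintZ; last exact: L1_gauss_cos.
    by rewrite IHn /K; ring.
  by move=> x; rewrite E.
rewrite RintZ; last exact: L1_gs_cos.
rewrite Rint_gs_cos// /K [Num.sqrt (pi / c) ^+ n.+1]exprS.
have -> : gauss (4 * c)^-1 (cons_rV (s, eta)) = gauss (4 * c)^-1 eta * expR (- (s ^+ 2 / (4 * c))).
  rewrite /gauss dotp_cons -expRD; congr expR; rewrite expr2; ring.
by ring.
Qed.

End gaussian.

(** * Trigonometric transforms *)

Section L2_theory.
Context d (T : measurableType d) (R : realType).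
Variable mu : {measure set T -> \bar R}.
Implicit Types h k : T -> R.

Definition L2 h := measurable_fun setT h /\ L1 mu (fun x => h x ^+ 2).

Lemma L2_mul h k : L2 h -> L2 k -> L1 mu (fun x => h x * k x).
Proof.
move=> [mh ih] [mk ik]; apply: (@L1_dominated _ _ _ mu _ (fun x => h x ^+ 2 + k x ^+ 2)).
- exact: measurable_funM.
- move=> x; rewrite normrM -(real_normK (num_real (h x))) -(real_normK (num_real (k x))).
  have := normr_ge0 (h x); have := normr_ge0 (k x).
  by move: `|h x| `|k x| => u v; nra.
- exact: L1D.
Qed.

Lemma Rint0 : Rintegral mu setT (fun=> 0 : R) = 0.
Proof. by rewrite Rintegral_cst// mul0r. Qed.

Lemma L2D h k : L2 h -> L2 k -> L2 (fun x => h x + k x).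
Proof.
move=> lh lk; have ihk := L2_mul lh lk; case: lh lk => mh ih [mk ik].
split; first exact: measurable_funD.
apply: (@L1_eq _ _ _ mu (fun x => h x ^+ 2 + (2 * (h x * k x) + k x ^+ 2))).
  by move=> x; ring.
by apply: L1D => //; apply: L1D => //; exact: L1Z.
Qed.

Lemma L2Z c h : L2 h -> L2 (fun x => c * h x).
Proof.
move=> [mh ih]; split; first exact: measurable_funM.
apply: (@L1_eq _ _ _ mu (fun x => c ^+ 2 * h x ^+ 2)); last exact: L1Z.
by move=> x; rewrite exprMn.
Qed.

Lemma L2_eq h k : h =1 k -> L2 h -> L2 k.
Proof. by move=> /funext ->. Qed.

Lemma L2N h : L2 h -> L2 (fun x => - h x).
Proof. by move=> /(L2Z (-1)); apply: L2_eq => x; rewrite mulN1r. Qed.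

Lemma L2B h k : L2 h -> L2 k -> L2 (fun x => h x - k x).
Proof. by move=> lh lk; apply: L2D => //; exact: L2N. Qed.

Lemma L2_bounded h K : L1 mu h -> (forall x, `|h x| <= K) -> L2 h.
Proof.
move=> ih hK; have mh := L1_measurable ih; split => //.
by apply: (@L1_eq _ _ _ mu (fun x => h x * h x)) => //; exact: (@L1_bounded_mul _ _ _ _ _ _ K).
Qed.

Lemma L2_bounded_mul h (w : T -> R) K : L2 h -> measurable_fun setT w ->
  (forall x, `|w x| <= K) -> L2 (fun x => h x * w x).
Proof.
move=> [mh ih] mw wK; split; first exact: measurable_funM.
apply: (@L1_eq _ _ _ mu (fun x => h x ^+ 2 * w x ^+ 2)).
  by move=> x; rewrite exprMn.
apply: (@L1_bounded_mul _ _ _ _ _ _ (K ^+ 2)) => //; first exact: measurable_funX.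
by move=> x; rewrite normrX ler_pXn2r ?nnegrE// (le_trans _ (wK x)).
Qed.

End L2_theory.

Section trigonometric_transform.
Context {R : realType} {n : nat}.
Local Notation E := 'rV[R]_n.
Local Notation mu := (@lebesgue_rV R n).
Implicit Types (h k : E -> R) (w : R -> R) (delta : R).

(** For real [h], [tft cos h] is the real part of the Fourier transform of [h], and [tft sin h] is
    the opposite of its imaginary part. *)
Definition tft w h (x : E) : R :=
  Rintegral mu setT (fun xi => w (dotp x xi) * h xi).

Lemma measurable_dotp_comp w d (T : measurableType d) (f g : T -> E) :
  measurable_fun setT w -> measurable_fun setT f -> measurable_fun setT g ->
  measurable_fun setT (fun t => w (dotp (f t) (g t))).
Proof. by move=> mw mf mg; apply: measurableT_comp => //; exact: measurable_dotp. Qed.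

Section one_kernel.
Variable w : R -> R.
Hypotheses (mw : measurable_fun setT w) (w1 : forall t, `|w t| <= 1).

Let mk : measurable_fun setT (fun z : E * E => w (dotp z.1 z.2)).
Proof. exact: measurable_dotp_comp. Qed.

Lemma L1_tft_arg h x : L1 mu h -> L1 mu (fun xi => w (dotp x xi) * h xi).
Proof. by move=> ih; exact: (L1_kernel_l ih mk (fun z => w1 _)). Qed.

Lemma measurable_tft h : L1 mu h -> measurable_fun setT (tft w h).
Proof. by move=> ih; exact: (measurable_kernel_Rint ih mk (fun z => w1 _)). Qed.

Lemma tft_bounded h x : L1 mu h ->
  `|tft w h x| <= Rintegral mu setT (fun y => `|h y|).
Proof.
move=> ih; have := kernel_Rint_bounded ih mk (fun z => w1 _) x.
by rewrite mul1r.
Qed.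

Lemma tftB h k x : L1 mu h -> L1 mu k ->
  tft w (fun y => h y - k y) x = tft w h x - tft w k x.
Proof.
move=> ih ik; rewrite /tft -RintB; try exact: L1_tft_arg.
by apply: eq_Rint => y; rewrite mulrBr.
Qed.

Lemma L1_gauss_tft h delta : 0 < delta -> L1 mu h ->
  L1 mu (fun x => gauss delta x * tft w h x).
Proof.
move=> d0 ih; apply: (L1_bounded_mul (L1_gauss0 n d0)).
  exact: measurable_tft.
by move=> x; exact: tft_bounded.
Qed.

Lemma Rint_mul_tft h (A : E -> R) : L1 mu h -> L1 mu A ->
  Rintegral mu setT (fun x => A x * tft w h x) =
  Rintegral mu setT (fun xi => h xi * Rintegral mu setT (fun x => A x * w (dotp x xi))).
Proof. by move=> ih iA; exact: (Rint_Fubini_kernel iA ih mk (fun z => w1 _)). Qed.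

Lemma L1_mul_tft h (A : E -> R) : L1 mu h -> L1 mu A ->
  L1 mu (fun x => A x * tft w h x).
Proof. by move=> ih iA; exact: (L1_Fubini_kernel iA ih mk (fun z => w1 _)). Qed.

Lemma L1_mul_trig (A : E -> R) xi : L1 mu A -> L1 mu (fun x => A x * w (dotp x xi)).
Proof. by move=> iA; exact: (L1_kernel_r iA mk (fun z => w1 _)). Qed.

Lemma L1_mul_trig2 h (A : E -> R) : L1 mu h -> L1 mu A ->
  L1 mu (fun xi => h xi * Rintegral mu setT (fun x => A x * w (dotp x xi))).
Proof.
move=> ih iA.
apply: (@L1_eq _ _ _ mu (fun xi => h xi * tft w A xi)); last exact: L1_mul_tft.
move=> xi; congr (_ * _); apply: eq_Rint => x.
by rewrite mulrC dotpC.
Qed.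

End one_kernel.

Local Notation cosT := (tft cos).
Local Notation sinT := (tft sin).
Let mC : measurable_fun setT (@cos R). Proof. exact: measurable_cos. Qed.
Let mS : measurable_fun setT (@sin R). Proof. exact: measurable_sin. Qed.

(** The Fourier transform of [gauss delta], that is [(2 pi)^n] times the heat kernel at time
    [delta]; its total mass is therefore the same for every [delta]. *)
Definition heat delta (z : E) : R := Num.sqrt (pi / delta) ^+ n * gauss (4 * delta)^-1 z.

Lemma heat_ge0 delta z : 0 <= heat delta z.
Proof. by rewrite mulr_ge0 ?gauss_ge0// exprn_ge0// sqrtr_ge0. Qed.

Lemma gaussN c (z : E) : gauss c (- z) = gauss c z.
Proof. by rewrite /gauss dotpNl dotpNr opprK. Qed.

Lemma gauss_distC c (x y : E) : gauss c (x - y) = gauss c (y - x).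
Proof. by rewrite -gaussN opprB. Qed.

Lemma heat_le delta z : 0 < delta -> heat delta z <= Num.sqrt (pi / delta) ^+ n.
Proof.
move=> d0; rewrite ler_piMr ?exprn_ge0 ?sqrtr_ge0// gauss_le1//.
by rewrite invr_ge0 mulr_ge0// ltW.
Qed.

Lemma measurable_heat delta d (T : measurableType d) (f : T -> E) :
  measurable_fun setT f -> measurable_fun setT (fun t => heat delta (f t)).
Proof. by move=> mf; apply: measurable_funM => //; exact: measurable_gauss. Qed.

Lemma heat_mass delta (xi : E) : 0 < delta ->
  L1 mu (fun eta => heat delta (xi - eta)) /\
  Rintegral mu setT (fun eta => heat delta (xi - eta)) = (2 * pi) ^+ n.
Proof.
move=> d0; have c0 : 0 < (4 * delta)^-1 by rewrite invr_gt0 mulr_gt0.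
have E1 : (fun eta => heat delta (xi - eta)) =
   (fun eta => Num.sqrt (pi / delta) ^+ n * gauss (4 * delta)^-1 (eta - xi)).
  by apply/funext => eta; rewrite /heat gauss_distC.
rewrite E1; split; first by apply: L1Z; exact: L1_gauss.
rewrite RintZ; last exact: L1_gauss.
rewrite Rint_gauss// -exprMn; congr (_ ^+ n).
rewrite -sqrtrM; last by rewrite divr_ge0// ?pi_ge0// ltW.
have -> : pi / delta * (pi / (4 * delta)^-1) = (2 * pi) ^+ 2 :> R.
  by field; rewrite gt_eqF.
by rewrite sqrtr_sqr ger0_norm// mulr_ge0// pi_ge0.
Qed.

(** Half of the Gaussian absorbs [|z|^2] at the price of [8 delta], by [z * expR (- z) <= 1]; the
    wider Gaussian that is left, with its prefactor, has mass [(sqrt 8 * pi)^n], independent of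
    [delta]. The factor [delta] expresses the concentration of the kernel. *)
Lemma heat_second_moment : exists2 M : R, 0 <= M & forall delta (xi : E), 0 < delta ->
  L1 mu (fun eta => heat delta (xi - eta) * dotp (xi - eta) (xi - eta)) /\
  Rintegral mu setT (fun eta => heat delta (xi - eta) * dotp (xi - eta) (xi - eta))
    <= delta * M.
Proof.
exists (8 * (Num.sqrt 8 * pi) ^+ n).
  by rewrite mulr_ge0// exprn_ge0// mulr_ge0 ?sqrtr_ge0 ?pi_ge0.
move=> delta xi d0; have c0 : 0 < (8 * delta)^-1 by rewrite invr_gt0 mulr_gt0.
pose B eta := 8 * delta * (Num.sqrt (pi / delta) ^+ n * gauss (8 * delta)^-1 (eta - xi)).
have iB : L1 mu B by apply: L1Z; apply: L1Z; exact: L1_gauss.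
have hB eta : heat delta (xi - eta) * dotp (xi - eta) (xi - eta) <= B eta.
  rewrite /heat /B gauss_distC.
  have -> : dotp (xi - eta) (xi - eta) = dotp (eta - xi) (eta - xi).
    by rewrite -(opprB eta xi) dotpNl dotpNr opprK.
  set q := dotp _ _; have q0 : 0 <= q by exact: dotpxx_ge0.
  rewrite [leRHS]mulrCA -mulrA ler_wpM2l ?exprn_ge0 ?sqrtr_ge0//.
  rewrite /gauss -/q.
  have -> : expR (- ((4 * delta)^-1 * q)) = expR (- ((8 * delta)^-1 * q)) * expR (- ((8 * delta)^-1 * q)).
    by rewrite -expRD; congr expR; field; rewrite gt_eqF.
  rewrite -mulrA [leRHS]mulrC ler_wpM2l ?expR_ge0//.
  have -> : expR (- ((8 * delta)^-1 * q)) * q = 8 * delta * (expR (- ((8 * delta)^-1 * q)) * ((8 * delta)^-1 * q)).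
    by field; rewrite gt_eqF.
  rewrite ler_piMr//; first by rewrite mulr_ge0// ltW.
  rewrite expRN mulrC ler_pdivrMr ?expR_gt0// mul1r.
  by rewrite (le_trans _ (expR_ge1Dx _))// lerDr.
have i1 : L1 mu (fun eta => heat delta (xi - eta) * dotp (xi - eta) (xi - eta)).
  apply: (@L1_dominated _ _ _ mu _ B) => //.
    have mxe : measurable_fun setT (fun eta : E => xi - eta) by exact: measurable_rVB.
    by apply: measurable_funM; [exact: measurable_heat|exact: measurable_dotp].
  by move=> eta; rewrite ger0_norm// mulr_ge0 ?heat_ge0 ?dotpxx_ge0.
split => //; apply: (le_trans (le_Rint i1 iB hB)).
rewrite /B RintZ; last by apply: L1Z; exact: L1_gauss.
rewrite RintZ; last exact: L1_gauss.
rewrite Rint_gauss// -exprMn.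
rewrite -sqrtrM; last by rewrite divr_ge0// ?pi_ge0// ltW.
have -> : pi / delta * (pi / (8 * delta)^-1) = 8 * pi ^+ 2 :> R.
  by field; rewrite gt_eqF.
rewrite sqrtrM// sqrtr_sqr ger0_norm ?pi_ge0//.
by rewrite (mulrC 8 delta) mulrA.
Qed.

Section pairing.
Variables (h k : E -> R) (delta : R).
Hypotheses (ih : L1 mu h) (ik : L1 mu k) (d0 : 0 < delta).

Let inner theta xi :
  Rintegral mu setT (fun x => gauss delta x *
    Rintegral mu setT (fun eta => cos (dotp x (xi - eta) + theta) * k eta)) =
  cos theta * Rintegral mu setT (fun eta => heat delta (xi - eta) * k eta).
Proof.
have mker : measurable_fun setT (fun z : E * E => cos (dotp z.1 (xi - z.2) + theta)).
  apply: measurableT_comp => //; apply: measurable_funD => //.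
  by apply: measurable_dotp => //; exact: measurable_rVB.
rewrite (Rint_Fubini_kernel (L1_gauss0 n d0) ik mker (fun z => cos_max _)) /=.
rewrite -RintZ; last first.
  apply: (@L1_eq _ _ _ mu (fun eta => k eta * heat delta (xi - eta))).
    by move=> eta; rewrite mulrC.
  apply: (L1_bounded_mul (K := Num.sqrt (pi / delta) ^+ n) ik).
    by apply: measurable_heat; exact: measurable_rVB.
  by move=> eta; rewrite ger0_norm ?heat_ge0// heat_le.
apply: eq_Rint => eta.
rewrite (@eq_Rint _ _ _ mu _ (fun x => gauss delta x * cos (dotp (xi - eta) x + theta))).
  by rewrite Rint_gauss_cos// /heat; ring.
by move=> x; rewrite dotpC.
Qed.

Let i1 xi x : L1 mu (fun eta => cos (dotp x xi) * (cos (dotp x eta) * k eta)).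
Proof. by apply: L1Z; apply: L1_tft_arg => //; exact: cos_max. Qed.

(** The integrand is the real part of [h^] times the conjugate of [k^], damped by a Gaussian so that
    Fubini applies; integrating in [x] first turns [cos (x . (xi - eta))] into
    [heat delta (xi - eta)]. *)
Lemma gauss_pairing_cos :
  Rintegral mu setT (fun x => gauss delta x * (cosT h x * cosT k x + sinT h x * sinT k x)) =
  Rintegral mu setT (fun xi => h xi * Rintegral mu setT (fun eta => heat delta (xi - eta) * k eta)).
Proof.
have iC : L1 mu (fun x => gauss delta x * cosT k x) by apply: L1_gauss_tft => //; exact: cos_max.
have iS : L1 mu (fun x => gauss delta x * sinT k x) by apply: L1_gauss_tft => //; exact: sin_max.
rewrite (@eq_Rint _ _ _ mu _ (fun x => (gauss delta x * cosT k x) * cosT h x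
   + (gauss delta x * sinT k x) * sinT h x)); last by move=> x; ring.
rewrite RintD; last 2 first.
- by apply: L1_mul_tft => //; exact: cos_max.
- by apply: L1_mul_tft => //; exact: sin_max.
rewrite Rint_mul_tft//; last exact: cos_max.
rewrite Rint_mul_tft//; last exact: sin_max.
rewrite -RintD; last 2 first.
- by apply: L1_mul_trig2 => //; exact: cos_max.
- by apply: L1_mul_trig2 => //; exact: sin_max.
apply: eq_Rint => xi; rewrite -mulrDr; congr (_ * _).
rewrite -RintD; last 2 first.
- by apply: L1_mul_trig => //; exact: cos_max.
- by apply: L1_mul_trig => //; exact: sin_max.
have := inner 0 xi; rewrite cos0 mul1r => <-; apply: eq_Rint => x.
rewrite -!mulrA -mulrDr; congr (_ * _).
rewrite (mulrC (cosT k x)) (mulrC (sinT k x)) /tft.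
have jC := @L1_tft_arg _ mC (@cos_max R) k x ik.
have jS := @L1_tft_arg _ mS (@sin_max R) k x ik.
rewrite -RintZ// -RintZ// -RintD; [|exact: L1Z..].
by apply: eq_Rint => eta; rewrite dotpBr addr0 cosB; ring.
Qed.

(** Imaginary part of the same product. The damping Gaussian is even, so the sine of
    [x . (xi - eta)] integrates to zero. *)
Lemma gauss_pairing_sin :
  Rintegral mu setT (fun x => gauss delta x * (sinT h x * cosT k x - cosT h x * sinT k x)) = 0.
Proof.
have iC : L1 mu (fun x => gauss delta x * cosT k x) by apply: L1_gauss_tft => //; exact: cos_max.
have iS : L1 mu (fun x => gauss delta x * sinT k x) by apply: L1_gauss_tft => //; exact: sin_max.
rewrite (@eq_Rint _ _ _ mu _ (fun x => (gauss delta x * cosT k x) * sinT h x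
   - (gauss delta x * sinT k x) * cosT h x)); last by move=> x; ring.
rewrite RintB; last 2 first.
- by apply: L1_mul_tft => //; exact: sin_max.
- by apply: L1_mul_tft => //; exact: cos_max.
rewrite Rint_mul_tft//; last exact: sin_max.
rewrite Rint_mul_tft//; last exact: cos_max.
rewrite -RintB; last 2 first.
- by apply: L1_mul_trig2 => //; exact: sin_max.
- by apply: L1_mul_trig2 => //; exact: cos_max.
rewrite -[RHS](Rint0 mu); apply: eq_Rint => xi; rewrite -mulrBr; apply/eqP; rewrite mulf_eq0; apply/orP; right; apply/eqP.
rewrite -RintB; last 2 first.
- by apply: L1_mul_trig => //; exact: sin_max.
- by apply: L1_mul_trig => //; exact: cos_max.
(* The phase [- pi / 2] changes the cosine into a sine, and the factor [cos theta] in [inner]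
   becomes 0. *)
have := inner (- (pi / 2)) xi; rewrite cosN cos_pihalf mul0r => <-; apply: eq_Rint => x.
rewrite -!mulrA -mulrBr; congr (_ * _).
rewrite (mulrC (cosT k x)) (mulrC (sinT k x)) /tft.
have jC := @L1_tft_arg _ mC (@cos_max R) k x ik.
have jS := @L1_tft_arg _ mS (@sin_max R) k x ik.
rewrite -RintZ// -RintZ// -RintB; [|exact: L1Z..].
apply: eq_Rint => eta; rewrite dotpBr cosB cos_pihalf sin_pihalf sinB; ring.
Qed.

End pairing.

Lemma Rint_heat_conv delta (q : E -> R) : 0 < delta -> L1 mu q -> (forall x, 0 <= q x) ->
  L1 mu (fun xi => Rintegral mu setT (fun eta => heat delta (xi - eta) * q eta)) /\
  Rintegral mu setT (fun xi => Rintegral mu setT (fun eta => heat delta (xi - eta) * q eta)) =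
  (2 * pi) ^+ n * Rintegral mu setT q.
Proof.
move=> d0 iq q0.
have mker : measurable_fun setT (fun z : E * E => heat delta (z.1 - z.2)).
  by apply: measurable_heat; exact: measurable_rVB.
have kerK z : `|heat delta (z.1 - z.2)| <= Num.sqrt (pi / delta) ^+ n.
  by rewrite ger0_norm ?heat_ge0// heat_le.
have m1 := measurable_kernel_Rint iq mker kerK.
have E1 : (\int[mu]_xi (Rintegral mu setT (fun eta => heat delta (xi - eta) * q eta))%:E =
   ((2 * pi) ^+ n * Rintegral mu setT q)%:E)%E.
  transitivity (\int[mu]_xi \int[mu]_eta (heat delta (xi - eta) * q eta)%:E)%E.
    apply: eq_integral => xi _; rewrite EFin_Rint//.
    exact: (L1_kernel_l iq mker kerK).
  rewrite (fubini_tonelli (fun z : E * E => (heat delta (z.1 - z.2) * q z.2)%:E))/=; last 2 first.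
  - apply/measurable_EFinP; apply: measurable_funM => //.
    by apply: measurableT_comp => //; exact: L1_measurable iq.
  - by move=> z; rewrite lee_fin mulr_ge0 ?heat_ge0.
  rewrite -RintZ// EFin_Rint; last exact: L1Z.
  apply: eq_integral => eta _.
  have [iheat Iheat] := heat_mass eta d0.
  have sym xi : heat delta (xi - eta) * q eta = q eta * heat delta (eta - xi).
    by rewrite mulrC /heat gauss_distC.
  under eq_integral do rewrite sym.
  by rewrite -EFin_Rint; [rewrite RintZ// Iheat mulrC|exact: L1Z].
split; last by rewrite /Rintegral E1.
apply: L1_ge0 => //.
  move=> xi; apply: Rintegral_ge0 => eta _; by rewrite mulr_ge0 ?heat_ge0.
by rewrite E1 ltry.
Qed.

End trigonometric_transform.

(** * Plancherel and Parseval by Gaussian regularisation *)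

Section plancherel.
Context {R : realType} {n : nat}.
Local Notation E := 'rV[R]_n.
Local Notation mu := (@lebesgue_rV R n).
Local Notation cosT := (tft cos).
Local Notation sinT := (tft sin).
Implicit Types (h k : E -> R).

Let mC : measurable_fun setT (@cos R). Proof. exact: measurable_cos. Qed.
Let mS : measurable_fun setT (@sin R). Proof. exact: measurable_sin. Qed.

Let delta (m : nat) : R := m.+1%:R^-1.

Let delta_gt0 m : 0 < delta m. Proof. by rewrite invr_gt0 ltr0n. Qed.

Let delta_cvg0 : delta @ \oo --> (0 : R).
Proof. exact: cvg_harmonic. Qed.

Lemma gauss_delta_cvg (x : E) : (fun m => gauss (delta m) x) @ \oo --> (1 : R).
Proof.
have h : (fun m => - (delta m * dotp x x)) @ \oo --> (0 : R).
  rewrite -[X in _ --> X]oppr0 -(mul0r (dotp x x)); apply: cvgN.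
  by apply: cvgMl.
rewrite -[X in _ --> X]expR0; exact: (cvg_comp _ _ h (@continuous_expR R 0)).
Qed.

Let gauss_cvg_Rint (P : E -> R) : L1 mu P ->
  (fun m => Rintegral mu setT (fun x => gauss (delta m) x * P x)) @ \oo --> Rintegral mu setT P.
Proof.
move=> iP; have mP := L1_measurable iP.
have [] // := @L1_dominated_cvg _ _ _ mu (fun m x => gauss (delta m) x * P x) P (fun x => `|P x|).
- by move=> m; apply: measurable_funM => //; exact: measurable_gauss.
- apply: aeW => x; rewrite -[X in _ --> X]mul1r.
  by apply: cvgMl; exact: gauss_delta_cvg.
- exact: L1_norm.
- apply: aeW => x m; rewrite normrM (ger0_norm (gauss_ge0 _ _)) ler_piMl//.
  by rewrite gauss_le1// ltW.
Qed.

Let heat_ker m : measurable_fun setT (fun z : E * E => heat (delta m) (z.1 - z.2)).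
Proof. by apply: measurable_heat; exact: measurable_rVB. Qed.

Let heat_kerK m (z : E * E) :
  `|heat (delta m) (z.1 - z.2)| <= Num.sqrt (pi / delta m) ^+ n.
Proof. by rewrite ger0_norm ?heat_ge0// heat_le. Qed.

Lemma L1_heat_mul m k xi : L1 mu k -> L1 mu (fun eta => heat (delta m) (xi - eta) * k eta).
Proof. by move=> ik; exact: (L1_kernel_l ik (heat_ker m) (heat_kerK m)). Qed.

Section plancherel_le.
Variable h : E -> R.
Hypotheses (ih : L1 mu h) (lh : L2 mu h).

Let P x := cosT h x * cosT h x + sinT h x * sinT h x.

Let mP : measurable_fun setT P.
Proof.
have m1 : measurable_fun setT (cosT h) by apply: measurable_tft => //; exact: cos_max.
have m2 : measurable_fun setT (sinT h) by apply: measurable_tft => //; exact: sin_max.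
by apply: measurable_funD; exact: measurable_funM.
Qed.

Let P0 x : 0 <= P x. Proof. by rewrite addr_ge0// -expr2 sqr_ge0. Qed.

(** The kernel being nonnegative, [h xi * h eta <= (h xi ^+ 2 + h eta ^+ 2) / 2] can be used under
    it, each square being integrated against a heat kernel of mass [(2 pi)^n]; the bound does not
    depend on [m]. *)
Let bound m : (\int[mu]_x (gauss (delta m) x * P x)%:E <=
  ((2 * pi) ^+ n * Rintegral mu setT (fun x => h x ^+ 2))%:E)%E.
Proof.
have d0 := delta_gt0 m.
have iP : L1 mu (fun x => gauss (delta m) x * P x).
  apply: (@L1_eq _ _ _ mu (fun x => gauss (delta m) x * cosT h x * cosT h x +
    gauss (delta m) x * sinT h x * sinT h x)).
    by move=> x; rewrite /P; ring.
  apply: L1D.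
    apply: L1_mul_tft => //; first exact: cos_max.
    by apply: L1_gauss_tft => //; exact: cos_max.
  apply: L1_mul_tft => //; first exact: sin_max.
  by apply: L1_gauss_tft => //; exact: sin_max.
rewrite -EFin_Rint// lee_fin gauss_pairing_cos//.
have ih2 := lh.2.
have [ic Ic] := Rint_heat_conv d0 ih2 (fun x => sqr_ge0 _).
set J := fun xi => Rintegral mu setT _ in ic Ic.
(* The right-hand side is written as an integral over [xi], half of it through [J], so that the
   inequality can be checked for each [xi] and then for each [eta]. *)
have -> : (2 * pi) ^+ n * Rintegral mu setT (fun x => h x ^+ 2) =
  Rintegral mu setT (fun xi => 2^-1 * ((2 * pi) ^+ n * h xi ^+ 2 + J xi)).
  rewrite RintZ; last by apply: L1D => //; exact: L1Z.
  rewrite RintD//; last exact: L1Z.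
  by rewrite RintZ// Ic; field.
apply: le_Rint.
- exact: (L1_Fubini_kernel ih ih (heat_ker m) (heat_kerK m)).
- by apply: L1Z; apply: L1D => //; exact: L1Z.
move=> xi; rewrite /J.
have [iH IH] := heat_mass xi d0.
rewrite -RintZ; last exact: L1_heat_mul.
rewrite -IH -(mulrC (h xi ^+ 2)) -RintZ// -RintD; last 2 first.
- exact: L1Z.
- exact: L1_heat_mul.
rewrite -RintZ; last by apply: L1D; [exact: L1Z|exact: L1_heat_mul].
apply: le_Rint.
- by apply: L1Z; exact: L1_heat_mul.
- by apply: L1Z; apply: L1D; [exact: L1Z|exact: L1_heat_mul].
move=> eta; have := heat_ge0 (delta m) (xi - eta).
set H := heat _ _ => H0.
rewrite -subr_ge0 (_ : _ - _ = 2^-1 * (H * (h xi - h eta) ^+ 2)); last by field.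
by rewrite mulr_ge0// mulr_ge0// sqr_ge0.
Qed.

(** The damping Gaussians increase to 1, so monotone convergence removes them from [bound]. The
    inequality puts the transforms in L2; the exact formula used later is [pairing_cos]. *)
Lemma plancherel_le : [/\ L2 mu (cosT h), L2 mu (sinT h) &
  (\int[mu]_x (cosT h x ^+ 2 + sinT h x ^+ 2)%:E <=
  ((2 * pi) ^+ n * Rintegral mu setT (fun x => h x ^+ 2))%:E)%E].
Proof.
have IP : (\int[mu]_x (P x)%:E <=
  ((2 * pi) ^+ n * Rintegral mu setT (fun x => h x ^+ 2))%:E)%E.
  pose g m x := (gauss (delta m) x * P x)%:E.
  have gl x : limn (g ^~ x) = (P x)%:E.
    apply/cvg_lim => //; apply: cvg_EFin; first exact: nearW.
    rewrite -[X in _ --> X]mul1r; apply: cvgMl; exact: gauss_delta_cvg.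
  under eq_integral do rewrite -gl.
  have mc : (\int[mu]_x g m x)%E @[m --> \oo] --> (\int[mu]_x limn (g ^~ x))%E.
    apply: cvg_monotone_convergence => //.
    - move=> m; apply/measurable_EFinP; apply: measurable_funM => //.
      exact: measurable_gauss.
    - by move=> m x _; rewrite lee_fin mulr_ge0// gauss_ge0.
    - move=> x _ a b ab; rewrite lee_fin ler_wpM2r// ler_expR lerN2.
      by rewrite ler_wpM2r ?dotpxx_ge0// lef_pV2 ?posrE ?ltr0n// ler_nat.
  rewrite -(cvg_lim _ mc)//; apply: lime_le; first by apply/cvg_ex; eexists; exact: mc.
  exact: nearW.
have m1 : measurable_fun setT (cosT h) by apply: measurable_tft => //; exact: cos_max.
have m2 : measurable_fun setT (sinT h) by apply: measurable_tft => //; exact: sin_max.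
have iP : L1 mu P by apply: L1_ge0 => //; exact: le_lt_trans IP (ltry _).
split.
- split => //; apply: (@L1_dominated _ _ _ mu _ P) => //; first exact: measurable_funX.
  by move=> x; rewrite ger0_norm ?sqr_ge0// /P -!expr2 lerDl sqr_ge0.
- split => //; apply: (@L1_dominated _ _ _ mu _ P) => //; first exact: measurable_funX.
  by move=> x; rewrite ger0_norm ?sqr_ge0// /P -!expr2 lerDr sqr_ge0.
- by under eq_integral do rewrite !expr2.
Qed.

End plancherel_le.

(** Continuity for the Euclidean norm, in the form in which the second moment of the heat kernel can
    use it. *)
Definition enorm_continuous k (xi : E) := forall e : R, 0 < e ->
  exists2 d : R, 0 < d & forall eta, enorm (xi - eta) < d -> `|k eta - k xi| <= e.

Lemma heat_bounded m k K xi : measurable_fun setT k -> (forall x, `|k x| <= K) ->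
  L1 mu (fun eta => heat (delta m) (xi - eta) * k eta) /\
  `|Rintegral mu setT (fun eta => heat (delta m) (xi - eta) * k eta)| <= (2 * pi) ^+ n * K.
Proof.
move=> mk kK; have [iH IH] := heat_mass xi (delta_gt0 m).
have i1 : L1 mu (fun eta => heat (delta m) (xi - eta) * k eta).
  exact: (L1_bounded_mul iH mk kK).
split => //; apply: (le_trans (norm_Rint i1)).
rewrite -IH mulrC -RintZ//; apply: le_Rint; [exact: L1_norm|exact: L1Z|].
move=> eta; rewrite normrM (ger0_norm (heat_ge0 _ _)) mulrC ler_wpM2r//.
exact: heat_ge0.
Qed.

(** Near [xi] the difference [k eta - k xi] is at most [eps]; at distance [d] or more it is at most
    [2 K <= C * |xi - eta|^2] with [C = 2 K / d^2]. Integrated against the heat kernel, the second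
    term is [O(delta m)] by the second moment. *)
Lemma heat_approx k K xi : measurable_fun setT k -> (forall x, `|k x| <= K) ->
  enorm_continuous k xi ->
  (fun m => Rintegral mu setT (fun eta => heat (delta m) (xi - eta) * k eta)) @ \oo -->
  (2 * pi) ^+ n * k xi.
Proof.
move=> mk kK ck.
have [M M0 hM] := @heat_second_moment R n.
have Cn0 : 0 < (2 * pi) ^+ n :> R by rewrite exprn_gt0// mulr_gt0// pi_gt0.
apply/cvgrPdist_le => e e0.
(* This tolerance becomes [e / 2] after multiplication by the mass [(2 pi)^n]. *)
have e1 : 0 < e / (2 * (2 * pi) ^+ n) by rewrite divr_gt0// mulr_gt0.
have [d d0 hd] := ck _ e1; set eps := e / _ in hd e1.
have K0 : 0 <= K by rewrite (le_trans _ (kK 0)).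
pose C := 2 * K / d ^+ 2.
have C0 : 0 <= C by rewrite divr_ge0 ?mulr_ge0 ?exprn_ge0// ltW.
have kb eta : `|k eta - k xi| <= eps + C * dotp (xi - eta) (xi - eta).
  have [lt|ge] := ltP (enorm (xi - eta)) d.
    by rewrite (le_trans (hd _ lt))// lerDl mulr_ge0 ?dotpxx_ge0.
  rewrite (le_trans (ler_normB _ _))// (le_trans (lerD (kK _) (kK _)))//.
  rewrite (@le_trans _ _ (C * dotp (xi - eta) (xi - eta)))//; last by rewrite lerDr ltW.
  rewrite -sqr_enorm /C (_ : K + K = 2 * K); last by ring.
  rewrite -mulrA ler_peMr ?mulr_ge0//.
  rewrite mulrC ler_pdivlMr ?exprn_gt0// mul1r ler_pXn2r ?nnegrE ?enorm_ge0//.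
  exact: ltW.
near=> m.
have [iH IH] := heat_mass xi (delta_gt0 m).
have [iM IM] := hM _ xi (delta_gt0 m).
have [i1 _] := @heat_bounded m k K xi mk kK.
rewrite distrC -IH mulrC -RintZ// -RintB//; last exact: L1Z.
have i2 : L1 mu (fun x => heat (delta m) (xi - x) * k x - k xi * heat (delta m) (xi - x)).
  by apply: L1B => //; exact: L1Z.
apply: (le_trans (norm_Rint i2)).
have i3 : L1 mu (fun x => eps * heat (delta m) (xi - x) +
    C * (heat (delta m) (xi - x) * dotp (xi - x) (xi - x))).
  by apply: L1D; exact: L1Z.
apply: (@le_trans _ _ (Rintegral mu setT (fun x => eps * heat (delta m) (xi - x) +
    C * (heat (delta m) (xi - x) * dotp (xi - x) (xi - x))))).
  apply: le_Rint => //; first exact: L1_norm.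
  move=> x; have := heat_ge0 (delta m) (xi - x); set H := heat _ _ => H0.
  rewrite (mulrC (k xi)) -mulrBr normrM (ger0_norm H0).
  apply: (le_trans (ler_wpM2l H0 (kb x))).
  by rewrite le_eqVlt; apply/orP; left; apply/eqP; ring.
rewrite RintD; [|exact: L1Z|exact: L1Z].
rewrite RintZ// IH RintZ//.
have -> : eps * (2 * pi) ^+ n = e / 2.
  by rewrite /eps; field; rewrite gt_eqF// pi_gt0.
rewrite [leRHS](splitr e) lerD2l.
apply: (@le_trans _ _ (C * (delta m * M))); first by rewrite ler_wpM2l.
rewrite mulrCA.
near: m.
have cv : (fun m => delta m * (C * M)) @ \oo --> (0 : R).
  rewrite -[X in _ --> X](mul0r (C * M)).
  by apply: cvgMl.
have /cvgrPdist_le/(_ (e / 2)) := cv.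
move=> /(_ (divr_gt0 e0 (ltr0Sn _ 1))); apply: filterS => m.
by rewrite sub0r normrN; apply: le_trans; exact: ler_norm.
Unshelve. all: by end_near. Qed.

(** Parseval's formula. The convolutions of the bounded continuous [k] with heat kernels converge at
    every point and stay bounded by [(2 pi)^n * K], so dominated convergence with a multiple of
    [|h|] passes to the limit. *)
Lemma pairing_cos h k K : L1 mu h -> L2 mu h -> L1 mu k -> (forall x, `|k x| <= K) ->
  (forall xi, enorm_continuous k xi) ->
  Rintegral mu setT (fun x => cosT h x * cosT k x + sinT h x * sinT k x) =
  (2 * pi) ^+ n * Rintegral mu setT (fun x => h x * k x).
Proof.
move=> ih lh ik kK ck; have lk := L2_bounded ik kK.
have [lch lsh _] := plancherel_le ih lh.
have [lck lsk _] := plancherel_le ik lk.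
have iP := L1D (L2_mul lch lck) (L2_mul lsh lsk).
have cv1 := gauss_cvg_Rint iP.
have mk := L1_measurable ik.
have E1 : (fun m => Rintegral mu setT (fun x => gauss (delta m) x *
     (cosT h x * cosT k x + sinT h x * sinT k x))) =
   (fun m => Rintegral mu setT (fun xi => h xi *
      Rintegral mu setT (fun eta => heat (delta m) (xi - eta) * k eta))).
  by apply/funext => m; rewrite gauss_pairing_cos.
rewrite E1 in cv1.
have ihk : L1 mu (fun x => h x * k x) by exact: (L1_bounded_mul ih mk kK).
have [_ cv2] : L1 mu (fun xi => (2 * pi) ^+ n * (h xi * k xi)) /\
   (fun m => Rintegral mu setT (fun xi => h xi *
      Rintegral mu setT (fun eta => heat (delta m) (xi - eta) * k eta))) @ \oo -->
   Rintegral mu setT (fun xi => (2 * pi) ^+ n * (h xi * k xi)).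
  apply: (@L1_dominated_cvg _ _ _ mu _ _ (fun xi => (2 * pi) ^+ n * K * `|h xi|)).
  - move=> m; apply: measurable_funM; first exact: L1_measurable ih.
    exact: (measurable_kernel_Rint ik (heat_ker m) (heat_kerK m)).
  - by apply: measurable_funM => //; exact: L1_measurable ihk.
  - apply: aeW => xi; rewrite mulrCA; apply: cvgMr.
    exact: (heat_approx mk kK (ck xi)).
  - by apply: L1Z; exact: L1_norm.
  - apply: aeW => xi m; rewrite normrM mulrC ler_wpM2r//.
    by have [] := heat_bounded m xi mk kK.
rewrite -RintZ//.
exact: (cvg_unique _ cv1 cv2).
Qed.

Lemma pairing_sin h k : L1 mu h -> L2 mu h -> L1 mu k -> L2 mu k ->
  Rintegral mu setT (fun x => sinT h x * cosT k x - cosT h x * sinT k x) = 0.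
Proof.
move=> ih lh ik lk.
have [lch lsh _] := plancherel_le ih lh.
have [lck lsk _] := plancherel_le ik lk.
have iP := L1B (L2_mul lsh lck) (L2_mul lch lsk).
have cv1 := gauss_cvg_Rint iP.
have E1 : (fun m => Rintegral mu setT (fun x => gauss (delta m) x *
     (sinT h x * cosT k x - cosT h x * sinT k x))) = (fun=> 0).
  by apply/funext => m; rewrite gauss_pairing_sin.
rewrite E1 in cv1.
exact: (cvg_unique _ cv1 (cvg_cst _)).
Qed.

End plancherel.

(** * Schwartz functions *)

Section continuous_rV.
Context {R : realType} {n : nat}.
Local Notation E := 'rV[R]_n.
Local Notation mu := (@lebesgue_rV R n).

(** The sigma-algebra is generated by the coordinates, while continuity refers to the norm. Rounding
    each coordinate down to a multiple of [1 / (m+1)] gives functions constant on countably many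
    boxes, and [f] is their pointwise limit. *)
Lemma continuous_rV_measurable (f : E -> R) : continuous f -> measurable_fun setT f.
Proof.
move=> cf.
pose fl (m : nat) (x : E) : 'rV[int]_n := \row_i Num.floor (m.+1%:R * x ord0 i).
pose emb (m : nat) (z : 'rV[int]_n) : E := \row_i ((z ord0 i)%:~R / m.+1%:R).
apply: (@measurable_fun_cvg _ _ _ _ (fun m x => f (emb m (fl m x)))).
  move=> m _ B mB; rewrite setTI.
  rewrite (_ : _ @^-1` B = \bigcup_(z in [set z | B (f (emb m z))]) (fl m @^-1` [set z])); last first.
    apply/seteqP; split => x /=; last by move=> [z /= Bz ->].
    by move=> Bx; exists (fl m x).
  rewrite bigcup_mkcond; apply: countable_bigcupT_measurable; first exact: countableP.
  move=> z; case: ifPn => // _.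
  rewrite (_ : _ @^-1` _ = [set x : E | forall i, (fun r : measurableTypeR R =>
      Num.floor (m.+1%:R * (r : R)) = z ord0 i) (rV_coord i x)]); last first.
    apply/seteqP; split => x /=.
      by move=> <- i; rewrite mxE.
    by move=> H; apply/rowP => i; rewrite mxE H.
  apply: (@measurable_box R n (fun i (r : measurableTypeR R) =>
      Num.floor (m.+1%:R * (r : R)) = z ord0 i)) => i.
  rewrite (_ : (fun r => _) = [set` `[(z ord0 i)%:~R / m.+1%:R : R, ((z ord0 i) + 1)%:~R / m.+1%:R[]).
    exact: measurable_itv.
  apply/seteqP; split => r /=; rewrite in_itv/= ler_pdivrMr ?ltr0n// ltr_pdivlMr ?ltr0n//.
    by move=> <-; rewrite (mulrC r); exact: floor_itv.
  by move=> H; apply/floor_def; rewrite (mulrC m.+1%:R).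
move=> x _; suff H : (fun m => emb m (fl m x)) @ \oo --> x.
  exact: (cvg_comp _ _ H (cf x)).
apply/cvgrPdist_le => e e0; near=> m.
have m0 : 0 < m.+1%:R :> R by rewrite ltr0n.
rewrite -[leLHS]/(mx_norm (x - emb m (fl m x))).
have [->|/mx_norm_neq0[[i j] ->]] := eqVneq (mx_norm (x - emb m (fl m x))) 0; first exact: ltW.
rewrite (ord1 i) /= !mxE.
have /andP[f1 f2] := floor_itv (m.+1%:R * x ord0 j).
set z := Num.floor _ in f1 f2 *.
have -> : x ord0 j - z%:~R / m.+1%:R = (m.+1%:R * x ord0 j - z%:~R) / m.+1%:R.
  by field; rewrite gt_eqF.
rewrite ger0_norm; last by rewrite divr_ge0 ?subr_ge0// ltW.
apply: (@le_trans _ _ (m.+1%:R^-1)).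
  rewrite ler_pdivrMr// mulVf ?gt_eqF// lerBlDr addrC.
  by move: f2; rewrite intrD => /ltW.
near: m; have /cvgrPdist_le/(_ e e0) := @cvg_harmonic R.
by apply: filterS => m; rewrite sub0r normrN ger0_norm// invr_ge0.
Unshelve. all: by end_near. Qed.

Lemma continuous_enorm_continuous (f : E -> R) xi : {for xi, continuous f} -> enorm_continuous f xi.
Proof.
move=> cf e e0.
have /cvgrPdist_le/(_ e e0) := cf.
rewrite -nbhs_ballE => -[d /= d0 hd]; exists d => // eta etad.
rewrite distrC; apply: hd; rewrite -ball_normE /=.
exact: le_lt_trans (norm_le_enorm _) etad.
Qed.

(** Comparison with a product of one-variable functions [1 / (1 + r^2)]: each factor [1 + x_i^2] is
    at most [(1 + |x|)^2], whence the exponent [2 n]. *)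
Lemma L1_polynomial_decay (f : E -> R) (M : R) : measurable_fun setT f ->
  (forall x, (1 + enorm x) ^+ (2 * n) * `|f x| <= M) -> L1 mu f.
Proof.
move=> mf fM.
pose q (r : R) := (1 + r ^+ 2)^-1.
have q0 r : 0 < q r by rewrite invr_gt0 ltr_wpDr ?sqr_ge0.
have cq : continuous q.
  move=> r; apply: cvgV; first by rewrite gt_eqF// ltr_wpDr ?sqr_ge0.
  by apply: cvgD; [exact: cvg_cst|exact: exprn_continuous].
have mq : measurable_fun setT q by exact: continuous_measurable_fun.
have Iq : (\int[@lebesgue_measure R]_r (q r)%:E < +oo)%E.
  rewrite (@ge0_symfun_integralT R q)//; last 2 first.
  - by move=> r; exact: ltW.
  - by move=> r; rewrite /q /= sqrrN.
  rewrite -set_itvcy.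
  have -> : (\int[@lebesgue_measure R]_(r in `[0%R, +oo[) (q r)%:E)%E = (pi / 2)%:E.
    by rewrite -integral0y_oneDsqr.
  by rewrite -EFinM ltry.
pose Q (x : E) := \prod_(i < n) q (x ord0 i).
have iQ : L1 mu Q.
  apply: L1_ge0.
  - apply: measurable_prod => i _.
    by apply: (@measurableT_comp _ _ _ _ _ _ q) => //; exact: measurable_coord.
  - by move=> x; apply: prodr_ge0 => i _; exact: ltW.
  - rewrite /Q (ge0_integral_prod (h := fun=> q))//; last by move=> i r; exact: ltW.
    rewrite (eq_bigr (fun=> (fine (\int[@lebesgue_measure R]_r (q r)%:E)%E)%:E)).
      by rewrite prodEFin ltry.
    move=> i _; rewrite fineK// ge0_fin_numE//.
    by apply: integral_ge0 => r _; rewrite lee_fin ltW.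
have M0 : 0 <= M by apply: le_trans (fM 0); rewrite mulr_ge0// exprn_ge0// addr_ge0// enorm_ge0.
apply: (@L1_dominated _ _ _ mu _ (fun x => M * Q x)) => //; last exact: L1Z.
move=> x.
have QE : (1 + enorm x) ^- (2 * n) <= Q x.
  rewrite exprM -exprVn -[X in _ ^+ X]card_ord -prodr_const; apply: ler_prod => i _.
  rewrite invr_ge0 exprn_ge0 ?addr_ge0 ?enorm_ge0//=.
  rewrite lef_pV2 ?posrE; last 2 first.
  - by rewrite exprn_gt0// ltr_wpDr ?enorm_ge0.
  - by rewrite ltr_wpDr ?sqr_ge0.
  have := sqr_coord_le x i; rewrite -sqr_enorm; have := enorm_ge0 x.
  by move: (enorm x) (x ord0 i) => u v u0 uv; rewrite sqrrD; nra.
apply: (@le_trans _ _ (M * (1 + enorm x) ^- (2 * n))); last by rewrite ler_wpM2l.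
by rewrite ler_pdivlMr ?exprn_gt0 ?ltr_wpDr ?enorm_ge0// mulrC.
Qed.

(** What is used of a Schwartz test function: the seminorm of order 0 gives the bound and that of
    order [2 n] the integrability. *)
Lemma schwartz_part (phi : E -> R[i]) : schwartz phi ->
  forall k, k = fRe phi \/ k = fIm phi ->
  [/\ measurable_fun setT k, exists K, forall x, `|k x| <= K, L1 mu k &
      forall xi, enorm_continuous k xi].
Proof.
move=> [s1 s2 sb] k hk.
have ck : continuous k.
  move=> x; apply: differentiable_continuous.
  by case: hk => ->; [exact: (s1 [::] x)|exact: (s2 [::] x)].
have mk := continuous_rV_measurable ck.
have le_normc x : `|k x| <= Normc.normc (cpderivs [::] phi x).
  rewrite /cpderivs /= /fRe /fIm -sqrtr_sqr ler_wsqrtr//.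
  by case: hk => ->; rewrite /fRe /fIm ?lerDl ?lerDr sqr_ge0.
split => //.
- have [M hM] := sb 0%N [::]; exists M => x.
  by rewrite (le_trans (le_normc x))//; have := hM x; rewrite expr0 mul1r.
- have [M hM] := sb (2 * n)%N [::].
  apply: (@L1_polynomial_decay _ M) => // x; apply: le_trans (hM x).
  by rewrite ler_wpM2l// exprn_ge0// addr_ge0// enorm_ge0.
- by move=> xi; apply: continuous_enorm_continuous; exact: ck.
Qed.

Lemma derive_line (f : E -> R) (x v : E) (D : R) :
  is_derive (0 : R) (1 : R) (fun t => f (x + t *: v)) D -> 'D_v f x = D.
Proof.
move=> [_ <-]; rewrite /derive.
rewrite (_ : (fun h : R => h^-1 *: ((f \o shift x) (h *: v) - f x)) =
  (fun h : R => h^-1 *: (((fun t => f (x + t *: v)) \o shift 0) (h *: (1 : R)) - f (x + 0 *: v))))//.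
apply/funext => h /=.
by rewrite scale0r !addr0 /GRing.scale/= mulr1 (addrC x).
Qed.


(** A class that contains the modulated Gaussians and is closed under partial derivatives, so that
    differentiability and decay need only be proved on the class itself. The phase [theta] makes
    sines available as cosines. *)
Inductive expoly : (E -> R) -> Prop :=
| expoly_gauss c (y eta : E) theta : 0 < c ->
    expoly (fun x => gauss c (x - y) * cos (dotp eta x + theta))
| expoly_coord i h : expoly h -> expoly (fun x => x ord0 i * h x)
| expoly_add h k : expoly h -> expoly k -> expoly (fun x => h x + k x)
| expoly_scale a h : expoly h -> expoly (fun x => a * h x).

Lemma differentiable_dotp_const (eta : E) x : differentiable (fun z : E => dotp eta z) x.
Proof.
rewrite (_ : (fun z => _) = \sum_(i < n) (fun z : E => eta ord0 i * z ord0 i)); last first.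
  by apply/funext => z; rewrite fct_sumE.
apply: differentiable_sum => i.
exact: (differentiableZ (eta ord0 i) (differentiable_coord x ord0 i)).
Qed.

Lemma differentiable_sqdist (y : E) x : differentiable (fun z : E => dotp (z - y) (z - y)) x.
Proof.
rewrite (_ : (fun z => _) = \sum_(i < n) (fun z : E => (z ord0 i - y ord0 i) * (z ord0 i - y ord0 i))); last first.
  by apply/funext => z; rewrite fct_sumE; apply: eq_bigr => i _; rewrite !mxE.
apply: differentiable_sum => i.
have d1 : differentiable (fun z : E => z ord0 i - y ord0 i) x.
  exact: (differentiableB (differentiable_coord x ord0 i) (differentiable_cst _ _)).
exact: (differentiableM d1 d1).
Qed.

Lemma differentiable_real_comp (u : R -> R) (f : E -> R) x (du : R -> R) :
  (forall r, is_derive r (1 : R) u (du r)) -> differentiable f x ->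
  differentiable (fun z => u (f z)) x.
Proof.
move=> hu df; apply: (differentiable_comp df).
by apply/derivable1_diffP; exact: (@ex_derive _ _ _ _ _ _ _ (hu _)).
Qed.

Lemma expoly_differentiable h : expoly h -> forall x, differentiable h x.
Proof.
elim=> {h} [c y eta theta c0 x|i h _ IH x|h k _ IHh _ IHk x|a h _ IH x].
- apply: (@differentiableM _ _ (fun x => gauss c (x - y)) (fun x => cos (dotp eta x + theta))).
    apply: (@differentiable_real_comp (fun r => expR (- (c * r))) _ _ (fun r => expR (- (c * r)) * - c)).
      move=> r; apply: is_derive_comp.
      have -> : (fun y => - (c * y)) = (fun y => - c * y + 0) :> (R -> R).
        by apply/funext => t; rewrite addr0 mulNr.
      exact: is_derive_affine.
    exact: differentiable_sqdist.
  apply: (@differentiable_real_comp cos _ _ (fun r => - sin r)).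
  exact: (differentiableD (differentiable_dotp_const eta x) (differentiable_cst _ _)).
- exact: (differentiableM (differentiable_coord x ord0 i) (IH x)).
- exact: (differentiableD (IHh x) (IHk x)).
- exact: (differentiableZ a (IH x)).
Qed.

Lemma dotp_delta (x : E) i : dotp x (delta_mx ord0 i) = x ord0 i.
Proof.
rewrite /dotp (bigD1 i)//= mxE !eqxx mulr1 big1 ?addr0// => j ji.
by rewrite mxE eqxx /= (negbTE ji) mulr0.
Qed.

Lemma expoly_line h : expoly h -> forall i, exists2 h', expoly h' &
  forall x, is_derive (0 : R) (1 : R) (fun t => h (x + t *: delta_mx ord0 i)) (h' x).
Proof.
move=> H i; elim: H => {h} [c y eta theta c0|j h Hh [h' Hh' dh]|h k _ [h' Hh' dh] _ [k' Hk' dk]|a h _ [h' Hh' dh]].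
(* Differentiating the Gaussian gives the factor [- 2 c (x_i - y_i)]; the derivative of the cosine
   is a cosine again since [- sin z = cos (z + pi / 2)]. *)
- exists (fun x : E => (- 2 * c) * (x ord0 i * (gauss c (x - y) * cos (dotp eta x + theta)))
     + ((2 * c * y ord0 i) * (gauss c (x - y) * cos (dotp eta x + theta))
     + eta ord0 i * (gauss c (x - y) * cos (dotp eta x + (theta + pi / 2))))).
    apply: expoly_add; first by apply: expoly_scale; apply: expoly_coord; exact: expoly_gauss.
    by apply: expoly_add; apply: expoly_scale; exact: expoly_gauss.
  move=> x; set e := delta_mx _ _.
  have E1 t : gauss c (x + t *: e - y) * cos (dotp eta (x + t *: e) + theta) =
    expR (- c * (t * t) + (- (2 * c * (x ord0 i - y ord0 i)) * t + - (c * dotp (x - y) (x - y)))) *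
      cos (eta ord0 i * t + (dotp eta x + theta)).
    have q1 : dotp (x + t *: e - y) (x + t *: e - y) =
        dotp (x - y) (x - y) + 2 * t * (x ord0 i - y ord0 i) + t * t.
      rewrite addrAC dotpDl !(dotpDr (x - y)) !dotpZl !dotpZr (dotpC e).
      by rewrite !dotp_delta !mxE !eqxx /=; ring.
    have q2 : dotp eta (x + t *: e) = dotp eta x + t * eta ord0 i.
      by rewrite dotpDr dotpZr dotp_delta.
    by rewrite /gauss q1 q2; congr (expR _ * cos _); ring.
  have -> : (fun t : R => gauss c (x + t *: e - y) * cos (dotp eta (x + t *: e) + theta)) = _ := funext E1.
  apply: (is_derive_eq (is_derive_mul (is_derive_comp (is_derive_expR _)
    (is_derive_add (is_derive_mul (is_derive_const (- c) 0) (is_derive_mul (is_derive_var 0) (is_derive_var 0)))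
       (is_derive_affine _ _ 0)))
    (is_derive_comp (is_derive_cos _) (is_derive_affine _ _ 0)))).
  rewrite (_ : - c * (0 * 0) + _ = - (c * dotp (x - y) (x - y))); last first.
    by rewrite !mulr0 !add0r.
  rewrite (_ : eta ord0 i * 0 + _ = dotp eta x + theta); last by rewrite mulr0 add0r.
  rewrite (addrA (dotp eta x)) (cosD _ (pi / 2)) cos_pihalf sin_pihalf /gauss.
  move: (expR _) (cos _) (sin _) => G C S.
  by move: (x ord0 i) (y ord0 i) (eta ord0 i) => p q r; ring.
- exists (fun x => (i == j)%:R * h x + x ord0 j * h' x).
    by apply: expoly_add; [exact: expoly_scale|exact: expoly_coord].
  move=> x.
  have E1 : (fun t : R => (x + t *: delta_mx ord0 i) ord0 j * h (x + t *: delta_mx ord0 i)) =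
    (fun t => ((i == j)%:R * t + x ord0 j) * h (x + t *: delta_mx ord0 i)).
    apply/funext => t; rewrite !mxE eqxx /= (eq_sym j i) addrC (mulrC t); congr (_ * _).
  rewrite E1; apply: (is_derive_eq (is_derive_mul (is_derive_affine _ _ 0) (dh x))).
  by rewrite scale0r addr0 mulr0 add0r.
- exists (fun x => h' x + k' x); first exact: expoly_add.
  by move=> x; exact: is_derive_add.
- exists (fun x => a * h' x); first exact: expoly_scale.
  move=> x; apply: (is_derive_eq (is_derive_mul (is_derive_const a 0) (dh x))).
  by rewrite mul0r add0r.
Qed.

Lemma expoly_pderivs h l : expoly h -> expoly (pderivs l h).
Proof.
move=> Hh; elim: l => [//|i l IH] /=.
have [h' Hh' dh] := expoly_line IH i.
rewrite (_ : pderiv i _ = h')//; apply/funext => x.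
exact: derive_line (dh x).
Qed.

(** For a Gaussian, [1 + |x|] is at most [A + 4 |x - y|^2], hence at most
    [B * expR (c |x - y|^2 / (N+1))], and the Gaussian pays for the power [N+1] of this; [N+1]
    rather than [N] avoids a division by 0. A coordinate factor costs one more power of
    [1 + |x|]. *)
Lemma expoly_decay h : expoly h -> forall N, exists M, forall x, (1 + enorm x) ^+ N * `|h x| <= M.
Proof.
elim=> {h} [c y eta theta c0|j h _ IH|h k _ IHh _ IHk|a h _ IH] N.
- pose A := 2 + 4 * dotp y y.
  have A0 : 0 <= A by rewrite addr_ge0// mulr_ge0// dotpxx_ge0.
  pose B := A + 4 * N.+1%:R / c.
  have N0 : 0 < N.+1%:R :> R by rewrite ltr0n.
  have B0 : 0 <= B by rewrite addr_ge0// divr_ge0 ?mulr_ge0// ltW.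
  exists (B ^+ N.+1) => x; set w := dotp (x - y) (x - y).
  have w0 : 0 <= w by exact: dotpxx_ge0.
  have u0 := enorm_ge0 x; set u := enorm x in u0 *.
  have h1 : 1 + u <= A + 4 * w.
    have hu : u ^+ 2 <= 2 * dotp y y + 2 * w.
      rewrite sqr_enorm /w /dotp !mulr_sumr -big_split /=; apply: ler_sum => i _.
      rewrite !mxE; move: (x ord0 i) (y ord0 i) => p q.
      have := sqr_ge0 (p - 2 * q); nra.
    rewrite /A; nra.
  have h2 : A + 4 * w <= B * expR (c * w / N.+1%:R).
    apply: (@le_trans _ _ (B * (1 + c * w / N.+1%:R))); last by rewrite ler_wpM2l// expR_ge1Dx.
    have -> : B * (1 + c * w / N.+1%:R) =
        A + A * (c * w / N.+1%:R) + 4 * N.+1%:R / c + 4 * w.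
      by rewrite /B; field; rewrite !gt_eqF.
    have p1 : 0 <= 4 * N.+1%:R / c by rewrite divr_ge0 ?mulr_ge0// ltW.
    have p2 : 0 <= A * (c * w / N.+1%:R) by rewrite mulr_ge0// divr_ge0 ?mulr_ge0// ltW.
    by rewrite lerD2r -addrA lerDl addr_ge0.
  have h3 : (1 + u) ^+ N <= B ^+ N.+1 * expR (c * w).
    apply: (@le_trans _ _ ((1 + u) ^+ N.+1)).
      by rewrite exprS ler_peMl ?exprn_ge0 ?addr_ge0// lerDl.
    apply: (@le_trans _ _ ((B * expR (c * w / N.+1%:R)) ^+ N.+1)).
      rewrite ler_pXn2r ?nnegrE ?addr_ge0 ?mulr_ge0 ?expR_ge0//.
      exact: le_trans h1 h2.
    rewrite exprMn -expRM_natl.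
    by rewrite (mulrC N.+1%:R) mulfVK// gt_eqF.
  rewrite normrM (ger0_norm (gauss_ge0 _ _)) mulrA.
  apply: (@le_trans _ _ ((1 + u) ^+ N * gauss c (x - y))).
    by rewrite ler_piMr ?cos_max// mulr_ge0 ?gauss_ge0// exprn_ge0// addr_ge0.
  by rewrite /gauss -/w expRN ler_pdivrMr ?expR_gt0.
- have [M hM] := IH N.+1; exists M => x; apply: le_trans (hM x).
  rewrite normrM exprS mulrCA -mulrA ler_wpM2r//; first by rewrite mulr_ge0// exprn_ge0// addr_ge0// enorm_ge0.
  by rewrite (le_trans (coord_le_enorm _ _))// lerDr.
- have [M hM] := IHh N; have [M' hM'] := IHk N; exists (M + M') => x.
  apply: le_trans (lerD (hM x) (hM' x)); rewrite -mulrDr ler_wpM2l ?ler_normD//.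
  by rewrite exprn_ge0// addr_ge0// enorm_ge0.
- have [M hM] := IH N; exists (`|a| * M) => x.
  by rewrite normrM mulrCA ler_wpM2l.
Qed.

Lemma normc_le (a b : R) : Normc.normc (Complex a b) <= `|a| + `|b|.
Proof.
rewrite /= -(ger0_norm (addr_ge0 (normr_ge0 a) (normr_ge0 b))) -sqrtr_sqr ler_wsqrtr//.
rewrite -(real_normK (num_real a)) -(real_normK (num_real b)) sqrrD.
by rewrite lerD2r lerDl mulrn_wge0// mulr_ge0.
Qed.

Lemma expoly_schwartz h k : expoly h -> expoly k -> schwartz (fun x => Complex (h x) (k x)).
Proof.
move=> Hh Hk; split.
- by move=> l x; apply: expoly_differentiable; exact: expoly_pderivs.
- by move=> l x; apply: expoly_differentiable; exact: expoly_pderivs.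
- move=> N l.
  have [M hM] := expoly_decay (expoly_pderivs l Hh) N.
  have [M' hM'] := expoly_decay (expoly_pderivs l Hk) N.
  exists (M + M') => x; apply: le_trans (lerD (hM x) (hM' x)).
  rewrite -mulrDr ler_wpM2l ?normc_le//.
  by rewrite exprn_ge0// addr_ge0// enorm_ge0.
Qed.

End continuous_rV.

(** * Functions determined by their Gaussian averages *)

Section gaussian_uniqueness.
Context {R : realType} {n : nat}.
Local Notation E := 'rV[R]_n.
Local Notation mu := (@lebesgue_rV R n).

(** [None] leaves a coordinate free, so the family contains the whole space and the half-spaces in
    one coordinate, and is closed under intersection. *)
Definition lower_box (a : 'I_n -> option R) : set E :=
  [set x | forall i, if a i is Some r then x ord0 i < r else true].

Lemma lower_box_measurableE : @measurable _ E `<=` <<s range lower_box >>.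
Proof.
apply: smallest_sub; first exact: smallest_sigma_algebra.
rewrite -bigcup_seq => _ [i _ [B mB <-]]; rewrite setTI.
pose H := [set B : set (measurableTypeR R) | <<s range lower_box >> (rV_coord i @^-1` B)].
suff : @measurable _ (measurableTypeR R) `<=` H by apply.
have [s0 sC sU] := @smallest_sigma_algebra E setT (range lower_box).
have -> : @measurable _ (measurableTypeR R) = <<s @RGenInftyO.G R >>.
  exact: RGenInftyO.measurableE.
apply: smallest_sub.
  split.
  - by rewrite /H /= preimage_set0.
  - by move=> A HA; rewrite /H /= setTD preimage_setC -setTD; exact: sC.
  - by move=> F HF; rewrite /H /= preimage_bigcup; exact: sU.
move=> _ [r ->]; apply: sub_sigma_algebra.
exists (fun j => if j == i then Some r else None) => //.
apply/seteqP; split => x /=.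
  by move=> /(_ i); rewrite eqxx /rV_coord in_itv.
by rewrite /rV_coord in_itv/= => xr j; case: eqP => // ->.
Qed.

Lemma lower_box_setI : setI_closed (range lower_box).
Proof.
move=> _ _ [a _ <-] [b _ <-].
exists (fun i => match a i, b i with
  | Some r, Some s => Some (Num.min r s)
  | Some r, None => Some r
  | None, o => o end) => //.
apply/seteqP; split => x /=.
  move=> H; split=> i; have := H i.
    by case: (a i) (b i) => [r|] [s|]//; rewrite lt_min => /andP[].
  by case: (a i) (b i) => [r|] [s|]//; rewrite lt_min => /andP[].
move=> [Ha Hb] i; have := Ha i; have := Hb i.
by case: (a i) (b i) => [r|] [s|]//; rewrite lt_min => -> ->.
Qed.

Lemma lower_box_measurable a : measurable (lower_box a).
Proof.
pose A i := [set x : measurableTypeR R | if a i is Some r then (x : R) < r else true].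
rewrite (_ : lower_box a = [set x | forall i, A i (rV_coord i x)]); last first.
  by apply/seteqP; split => x h i; have := h i; rewrite /A /= /rV_coord; case: (a i).
apply: measurable_box => i; rewrite /A.
case: (a i) => [r|]; last by rewrite (_ : mkset _ = setT)//; apply/seteqP; split.
rewrite (_ : mkset _ = [set` `]-oo, r[]); first exact: measurable_itv.
by apply/seteqP; split => x /=; rewrite in_itv.
Qed.

(** Dynkin's theorem: the measurable sets on which [w] integrates to 0 form a lambda-system, and the
    boxes are a generating pi-system. A function with zero integral on every measurable set vanishes
    almost everywhere. *)
Lemma L1_eq0_of_boxes (w : E -> R) : L1 mu w ->
  (forall a, Rintegral mu (lower_box a) w = 0) -> {ae mu, forall x, w x = 0}.
Proof.
move=> iw w0; have mw := L1_measurable iw.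
pose D := [set A : set E | measurable A /\ Rintegral mu A w = 0].
have iwA A : measurable A -> mu.-integrable A (EFin \o w).
  by move=> mA; apply: (integrableS measurableT).
have DE A : measurable A -> Rintegral mu A w = Rintegral mu setT (w \_ A).
  by move=> mA; rewrite Rintegral_mkcond.
have lam : lambda_system setT D.
  split => //.
  - split => //; rewrite -(w0 (fun=> None)); congr (Rintegral _ _ _).
    by apply/seteqP; split => x.
  - move=> A B BA [mA A0] [mB B0]; have mAB : measurable (A `\` B) by exact: measurableD.
    split => //.
    have : Rintegral mu A w = Rintegral mu (A `\` B) w + Rintegral mu B w.
      rewrite -Rintegral_setU//.
      - by rewrite setUC setDUK.
      - by rewrite setUC setDUK//; exact: iwA.
      - by apply/disj_setPS => x [[_ +] Bx].
    by rewrite A0 B0 addr0 => <-.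
  - move=> F ndF HF; have mF i : measurable (F i) by have [] := HF i.
    have mU : measurable (\bigcup_i F i) by exact: bigcup_measurable.
    split => //; rewrite DE//.
    have [_ cv] : L1 mu (w \_ (\bigcup_i F i)) /\
      (fun k => Rintegral mu setT (w \_ (F k))) @ \oo --> Rintegral mu setT (w \_ (\bigcup_i F i)).
      apply: (@L1_dominated_cvg _ _ _ mu _ _ (fun x => `|w x|)).
      + move=> k; apply: (iffLR (measurable_restrictT w (mF k))).
        exact: (measurable_funS measurableT (@subsetT _ _) mw).
      + apply: (iffLR (measurable_restrictT w mU)).
        exact: (measurable_funS measurableT (@subsetT _ _) mw).
      + apply: aeW => x; apply: cvg_near_cst; rewrite patchE.
        case: ifPn => [|/negP xU].
          rewrite inE => -[k _ Fkx]; exists k => // m /= km.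
          rewrite patchE mem_set//; move: x Fkx; exact/subsetPset/ndF.
        apply: nearW => m; rewrite patchE ifN//; apply/negP => xm; apply: xU.
        by move: xm; rewrite !inE => xm; exists m.
      + exact: L1_norm.
      + by apply: aeW => x k; rewrite patchE; case: ifP => // _; rewrite normr0.
    have E0 : (fun k => Rintegral mu setT (w \_ (F k))) = fun=> 0.
      by apply/funext => k; rewrite -DE//; have [] := HF k.
    by rewrite E0 in cv; exact: (cvg_unique _ cv (cvg_cst _)).
have GD : range lower_box `<=` D.
  by move=> _ [a _ <-]; split; [exact: lower_box_measurable|exact: w0].
have all A : measurable A -> Rintegral mu A w = 0.
  move=> mA; have := lambda_system_subset lower_box_setI lam GD (fun X _ => @subsetT _ X).
  by move=> /(_ A (lower_box_measurableE mA))[].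
have : ae_eq mu setT (EFin \o w) (cst 0%E).
  apply: integral_ae_eq => //.
  move=> A _ mA; rewrite integral_cst// mul0e -[LHS]fineK; last first.
    by apply: integrable_fin_num => //; exact: iwA.
  by have := all A mA; rewrite /Rintegral => ->.
by apply: filterS => x /(_ I) [].
Qed.

(** Completing the square; the new centre is [d / (c + d) * y]. *)
Lemma gauss_mul c d (x y : E) : 0 < c -> 0 <= d -> exists2 K : R, 0 < K &
  exists z : E, forall x : E, gauss c x * gauss d (x - y) = K * gauss (c + d) (x - z).
Proof.
move=> c0 d0; have s0 : 0 < c + d by rewrite ltr_wpDr.
exists (expR (- ((d - d ^+ 2 / (c + d)) * dotp y y))); first exact: expR_gt0.
exists ((d / (c + d)) *: y) => {}x.
rewrite /gauss -!expRD; congr expR.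
rewrite !(dotpBl, dotpBr, dotpZl, dotpZr) (dotpC y x).
by field; rewrite gt_eqF.
Qed.

Lemma cvg_prod_ord (T : Type) (F : set_system T) {FF : Filter F} m
    (f : 'I_m -> T -> R) (l : 'I_m -> R) :
  (forall i, f i x @[x --> F] --> l i) ->
  (\prod_(i < m) f i x) @[x --> F] --> \prod_(i < m) l i.
Proof.
elim: m f l => [|m IH] f l fl.
  rewrite (_ : (fun x => _) = fun=> 1); last by apply/funext => x; rewrite big_ord0.
  by rewrite big_ord0; exact: cvg_cst.
rewrite (_ : (fun x => _) = (fun x => f ord0 x * \prod_(i < m) f (lift ord0 i) x)); last first.
  by apply/funext => x; rewrite big_ord_recl.
rewrite big_ord_recl; apply: cvgM; first exact: fl.
by apply: IH => i; exact: fl.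
Qed.

(** [(s - r) + |s - r|] is twice the positive part of [s - r], so this continuous function is 0 for
    [r >= s] and increases to 1 with [l] for [r < s]. *)
Definition ramp (l : nat) (a : option R) (r : R) : R :=
  if a is Some s then 1 - expR (- (l%:R * ((s - r) + `|s - r|))) else 1.

Lemma ramp_ge0 l a r : 0 <= ramp l a r.
Proof.
case: a => [s|] //=; rewrite subr_ge0 -[leRHS]expR0 ler_expR oppr_le0 mulr_ge0//.
by have := ler_norm (- (s - r)); rewrite normrN; move: `|_| => u; lra.
Qed.

Lemma ramp_le1 l a r : ramp l a r <= 1.
Proof. by case: a => [s|] //=; rewrite gerBl expR_ge0. Qed.

Lemma continuous_ramp l a : continuous (ramp l a).
Proof.
case: a => [s|] r /=; last exact: cvg_cst.
have h : (fun x => - (l%:R * ((s - x) + `|s - x|))) @ r --> - (l%:R * ((s - r) + `|s - r|)).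
  apply: cvgN; apply: cvgMr.
  have h1 : (fun x => s - x) @ r --> s - r by apply: cvgB; [exact: cvg_cst|exact: cvg_id].
  by apply: cvgD => //; exact: cvg_norm.
apply: cvgB; first exact: cvg_cst.
exact: (cvg_comp _ _ h (@continuous_expR R _)).
Qed.

Definition below (a : option R) (r : R) : R :=
  if a is Some s then ((r < s)%R)%:R else 1.

Lemma ramp_cvg a r : (fun l => ramp l a r) @ \oo --> below a r.
Proof.
rewrite /below; case: a => [s|] /=; last exact: cvg_cst.
case: ltP => [rs|sr]; last first.
  rewrite (_ : (fun l => _) = fun=> 0); first exact: cvg_cst.
  apply/funext => l; rewrite ler0_norm ?subr_le0// subrr mulr0 oppr0 expR0.
  by rewrite subrr.
rewrite -[X in _ --> X]subr0; apply: cvgB; first exact: cvg_cst.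
apply/cvgrPdist_lt => e e0; near=> l; rewrite sub0r normrN ger0_norm ?expR_ge0//.
have sr0 : 0 < s - r by rewrite subr_gt0.
rewrite expRN invf_plt ?posrE ?expR_gt0//.
apply: (lt_le_trans _ (expR_ge1Dx _)).
have : e^-1 / (2 * (s - r)) < l%:R by near: l; exact: nbhs_infty_gtr.
rewrite ltr_pdivrMr ?mulr_gt0// gtr0_norm// => /lt_trans; apply.
rewrite (_ : 2 * (s - r) = s - r + (s - r)); last by ring.
by rewrite ltrDr.
Unshelve. all: by end_near. Qed.

Lemma continuous_gauss : continuous (@gauss R n 1).
Proof.
move=> x; apply: differentiable_continuous.
have := expoly_differentiable (expoly_gauss 0 0 0 ltr01) x.
rewrite (_ : (fun x0 : E => gauss 1 (x0 - 0) * cos (dotp 0 x0 + 0)) = @gauss R n 1)//.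
by apply/funext => z; rewrite subr0 dotp0l addr0 cos0 mulr1.
Qed.

Let delta (m : nat) : R := m.+1%:R^-1.

(** Multiplying [w] by a Gaussian makes it integrable, and the heat averages of the product are
    multiples of Gaussian averages of [w], hence 0. Letting [delta m] tend to 0 against continuous
    test functions gives zero integrals, and products of ramps carry this over to boxes. *)
Lemma gauss_uniqueness (w : E -> R) :
  (forall c y, 0 < c -> L1 mu (fun x => w x * gauss c (x - y))) ->
  (forall c y, 0 < c -> Rintegral mu setT (fun x => w x * gauss c (x - y)) = 0) ->
  {ae mu, forall x, w x = 0}.
Proof.
move=> iw w0.
pose W0 x := w x * gauss 1 x.
have iW0 : L1 mu W0.
  by have := iw 1 0 ltr01; apply: L1_eq => x; rewrite subr0.
have kerK m (z : E * E) : `|heat (delta m) (z.1 - z.2)| <= Num.sqrt (pi / delta m) ^+ n.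
  by rewrite ger0_norm ?heat_ge0//; apply: heat_le; rewrite invr_gt0 ltr0n.
have conv0 m y : Rintegral mu setT (fun x => heat (delta m) (y - x) * W0 x) = 0.
  have d0 : 0 < (4 * delta m)^-1 by rewrite invr_gt0 mulr_gt0// invr_gt0 ltr0n.
  have [K K0 [z hz]] := gauss_mul 0 y ltr01 (ltW d0).
  have s0 : 0 < 1 + (4 * delta m)^-1 by rewrite addr_gt0.
  rewrite (@eq_Rint _ _ _ mu _ (fun x => (Num.sqrt (pi / delta m) ^+ n * K) *
      (w x * gauss (1 + (4 * delta m)^-1) (x - z)))).
    by rewrite RintZ; [rewrite w0// mulr0|exact: iw].
  move=> x; rewrite /heat /W0 (gauss_distC _ y x).
  transitivity (Num.sqrt (pi / delta m) ^+ n * (w x * (gauss 1 x * gauss (4 * delta m)^-1 (x - y)))).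
    by ring.
  by rewrite hz; ring.
(* The second factor [gauss 1] makes the test function integrable, as Fubini's theorem requires. *)
have test (psi : E -> R) : measurable_fun setT psi -> (forall x, `|psi x| <= 1) ->
    continuous psi -> Rintegral mu setT (fun x => W0 x * (gauss 1 x * psi x)) = 0.
  move=> mpsi psi1 cpsi.
  pose k x := gauss 1 x * psi x.
  have ig : L1 mu (@gauss R n 1) by exact: L1_gauss0.
  have ik : L1 mu k by exact: (L1_bounded_mul ig mpsi psi1).
  have mk := L1_measurable ik.
  have k1 x : `|k x| <= 1.
    by rewrite normrM (ger0_norm (gauss_ge0 _ _)) mulr_ile1// ?gauss_ge0// gauss_le1.
  have ck : continuous k.
    by move=> x; first [exact: (cvgM (@continuous_gauss x) (cpsi x)) | exact: (continuousM (@continuous_gauss x) (cpsi x))].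
  have [_ cv] : L1 mu (fun x => (2 * pi) ^+ n * (W0 x * k x)) /\
    (fun m => Rintegral mu setT (fun x => W0 x *
       Rintegral mu setT (fun y => heat (delta m) (x - y) * k y))) @ \oo -->
    Rintegral mu setT (fun x => (2 * pi) ^+ n * (W0 x * k x)).
    apply: (@L1_dominated_cvg _ _ _ mu _ _ (fun x => (2 * pi) ^+ n * 1 * `|W0 x|)).
    - move=> m; apply: measurable_funM; first exact: L1_measurable iW0.
      have d0 : 0 < delta m by rewrite invr_gt0 ltr0n.
      apply: (@measurable_kernel_Rint _ _ _ _ R mu k (fun z : E * E => heat (delta m) (z.1 - z.2))
        (Num.sqrt (pi / delta m) ^+ n)) => //.
        by apply: measurable_heat; exact: measurable_rVB.
    - apply: measurable_funM => //; apply: measurable_funM => //.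
      exact: L1_measurable iW0.
    - apply: aeW => x; rewrite mulrCA; apply: cvgMr.
      apply: (heat_approx mk k1); apply: continuous_enorm_continuous; exact: ck.
    - by apply: L1Z; exact: L1_norm.
    - apply: aeW => x m; rewrite normrM mulrC ler_wpM2r//.
      by have [] := heat_bounded m x mk k1.
  have E0 : (fun m => Rintegral mu setT (fun x => W0 x *
       Rintegral mu setT (fun y => heat (delta m) (x - y) * k y))) = fun=> 0.
    apply/funext => m.
    have d0 : 0 < delta m by rewrite invr_gt0 ltr0n.
    have := @Rint_Fubini_kernel _ _ _ _ R mu mu k W0 (fun z : E * E => heat (delta m) (z.1 - z.2))
      (Num.sqrt (pi / delta m) ^+ n) ik iW0.
    have mker : measurable_fun setT (fun z : E * E => heat (delta m) (z.1 - z.2)).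
      by apply: measurable_heat; exact: measurable_rVB.
    move=> /(_ mker (kerK m)) H.
    rewrite -[RHS](Rint0 mu).
    transitivity (Rintegral mu setT (fun y => k y *
       Rintegral mu setT (fun x => heat (delta m) (y - x) * W0 x))).
      rewrite H; apply: eq_Rint => x; congr (_ * _); apply: eq_Rint => y.
      by rewrite mulrC /heat gauss_distC.
    by apply: eq_Rint => y; rewrite conv0 mulr0.
  rewrite E0 in cv.
  have E1 : Rintegral mu setT (fun x => (2 * pi) ^+ n * (W0 x * k x)) = 0.
    exact: (cvg_unique _ cv (cvg_cst _)).
  rewrite RintZ in E1; last exact: (L1_bounded_mul iW0 mk k1).
  move: E1 => /eqP; rewrite mulf_eq0 gt_eqF ?exprn_gt0 ?mulr_gt0 ?pi_gt0//= => /eqP.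
  exact.
pose W x := W0 x * gauss 1 x.
have iW : L1 mu W.
  apply: (@L1_bounded_mul _ _ _ mu _ _ 1) => //; first exact: measurable_gauss.
  by move=> x; rewrite ger0_norm ?gauss_ge0// gauss_le1.
suff : {ae mu, forall x, W x = 0}.
  apply: filterS => x /eqP; rewrite /W /W0 !mulf_eq0.
  have g0 : gauss 1 x != 0 by rewrite gt_eqF// expR_gt0.
  by rewrite !(negbTE g0) !orbF => /eqP.
apply: L1_eq0_of_boxes => // a.
pose psi l (x : E) := \prod_(i < n) ramp l (a i) (x ord0 i).
have psi0 l x : 0 <= psi l x by apply: prodr_ge0 => i _; exact: ramp_ge0.
have psi1 l x : psi l x <= 1.
  by apply: prodr_ile1 => i _; rewrite ramp_ge0 ramp_le1.
have mpsi l : measurable_fun setT (psi l).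
  apply: measurable_prod => i _.
  apply: (@measurableT_comp _ _ _ _ _ _ (ramp l (a i))); last exact: measurable_coord.
  by apply: continuous_measurable_fun; exact: continuous_ramp.
have cpsi l : continuous (psi l).
  move=> x.
  have H i : (fun z : E => ramp l (a i) (z ord0 i)) @ x --> ramp l (a i) (x ord0 i).
    have hc : (fun z : E => z ord0 i) @ x --> x ord0 i by exact: (@coord_continuous R 1 n ord0 i x).
    exact: (cvg_comp _ _ hc (@continuous_ramp l (a i) _)).
  exact: (@cvg_prod_ord E (nbhs x) (nbhs_filter x) n (fun i (z : E) => ramp l (a i) (z ord0 i)) _ H).
have [_ cv] : L1 mu (fun x => W x * \prod_(i < n) below (a i) (x ord0 i)) /\
  (fun l => Rintegral mu setT (fun x => W x * psi l x)) @ \oo -->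
  Rintegral mu setT (fun x => W x * \prod_(i < n) below (a i) (x ord0 i)).
  have cvx x : (fun l => psi l x) @ \oo --> (\prod_(i < n) below (a i) (x ord0 i)).
    by apply: (@cvg_prod_ord _ _ _ _ (fun i l => ramp l (a i) (x ord0 i))) => i; exact: ramp_cvg.
  apply: (@L1_dominated_cvg _ _ _ mu _ _ (fun x => `|W x|)).
  - by move=> l; apply: measurable_funM => //; exact: L1_measurable iW.
  - apply: measurable_funM; first exact: L1_measurable iW.
    by apply: (@measurable_fun_cvg _ _ _ _ psi) => // x _.
  - by apply: aeW => x; apply: cvgMr.
  - exact: L1_norm.
  - by apply: aeW => x l; rewrite normrM (ger0_norm (psi0 l x)) ler_piMr.
rewrite Rintegral_mkcond.
rewrite (@eq_Rint _ _ _ mu _ (fun x => W x * \prod_(i < n) below (a i) (x ord0 i))).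
  have E0 : (fun l => Rintegral mu setT (fun x => W x * psi l x)) = fun=> 0.
    apply/funext => l; rewrite -[RHS](test (psi l))//; last by move=> x; rewrite ger0_norm.
    by apply: eq_Rint => x; rewrite /W mulrA.
  by rewrite E0 in cv; exact: (cvg_unique _ cv (cvg_cst _)).
move=> x; rewrite patchE; case: ifPn => [|/negP].
  rewrite inE => ax; rewrite big1 ?mulr1// => i _.
  by have := ax i; rewrite /below; case: (a i) => // r ->.
move=> ax; have /asboolPn/existsp_asboolPn[i hi] : ~ lower_box a x by move=> h; apply: ax; rewrite inE.
rewrite (bigD1 i)//= /below; move: hi; case: (a i) => //= r; case: ltP => // _ _.
by rewrite mul0r mulr0.
Qed.

End gaussian_uniqueness.

(** * Weighted series *)

Section weighted_sums.
Context {R : realType}.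
Implicit Types (c z : nat -> R) (r : R).

Lemma weighted_cauchy_schwarz c z N : (forall m, 0 < c m) ->
  (\sum_(0 <= m < N) z m) ^+ 2 <=
  (\sum_(0 <= m < N) c m) * (\sum_(0 <= m < N) (c m)^-1 * z m ^+ 2).
Proof.
move=> c0; elim: N => [|N IH]; first by rewrite !big_geq// expr0n mulr0.
rewrite !big_nat_recr//=.
have A0 : 0 <= \sum_(0 <= m < N) c m by apply: sumr_ge0 => m _; exact: ltW.
have B0 : 0 <= \sum_(0 <= m < N) (c m)^-1 * z m ^+ 2.
  by apply: sumr_ge0 => m _; rewrite mulr_ge0 ?invr_ge0 ?sqr_ge0// ltW.
move: IH A0 B0 (c0 N).
move: (\sum_(0 <= m < N) z m) (\sum_(0 <= m < N) c m) (\sum_(0 <= m < N) (c m)^-1 * z m ^+ 2) (c N) (z N) => S A B d w.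
move=> IH A0 B0 d0.
have E1 : (A + d) * (B + d^-1 * w ^+ 2) = A * B + (A * (d^-1 * w ^+ 2) + d * B) + w ^+ 2.
  by field; rewrite gt_eqF.
rewrite E1 sqrrD lerD2r lerD// -mulr_natl.
set p := A * _; set q := d * B.
have p0 : 0 <= p by rewrite mulr_ge0// mulr_ge0 ?invr_ge0 ?sqr_ge0// ltW.
have q0 : 0 <= q by rewrite mulr_ge0// ltW.
have pq : (S * w) ^+ 2 <= p * q.
  have -> : p * q = A * B * w ^+ 2 by rewrite /p /q; field; rewrite gt_eqF.
  by rewrite exprMn ler_wpM2r// sqr_ge0.
have [Sw|Sw] := leP 0 (S * w); last first.
  by rewrite (@le_trans _ _ 0)// ?addr_ge0// mulr_ge0_le0// ltW.
have n1 : 0 <= 2 * (S * w) by rewrite mulr_ge0.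
rewrite -(@ler_pXn2r _ 2%N) ?nnegrE ?addr_ge0//.
have := sqr_ge0 (p - q); rewrite exprMn; nra.
Qed.

Lemma geometric_sum_le r N : 0 <= r -> r < 1 -> \sum_(0 <= m < N) r ^+ m <= (1 - r)^-1.
Proof.
move=> r0 r1; have h : 0 < 1 - r by rewrite subr_gt0.
rewrite -[leRHS]mul1r ler_pdivlMr// mulrC.
suff -> : (1 - r) * \sum_(0 <= m < N) r ^+ m = 1 - r ^+ N by rewrite gerBl exprn_ge0.
elim: N => [|N IH]; first by rewrite big_geq// mulr0 expr0 subrr.
by rewrite big_nat_recr//= mulrDr IH exprS; ring.
Qed.

(** One of the two truncated subtractions is 0, so the exponent is [|m - j|]; the terms on either
    side of [j] form a geometric series. *)
Lemma dist_geometric_sum_le r j N : 0 <= r -> r < 1 ->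
  \sum_(0 <= m < N) r ^+ ((m - j) + (j - m)) <= 2 * (1 - r)^-1.
Proof.
move=> r0 r1; have h : 0 < 1 - r by rewrite subr_gt0.
have hi : 0 <= (1 - r)^-1 by rewrite invr_ge0 ltW.
suff H : \sum_(0 <= m < N) r ^+ ((m - j) + (j - m)) <= (1 - r)^-1 + \sum_(0 <= m < j) r ^+ m.
  apply: (le_trans H); rewrite mulr_natl mulr2n lerD2l.
  exact: geometric_sum_le.
elim: j N => [|j IH] [|N].
- by rewrite !big_geq// addr0.
- rewrite [X in _ + X]big_geq// addr0.
  rewrite (eq_bigr (fun m => r ^+ m)); first exact: geometric_sum_le.
  by move=> m _; rewrite subn0 sub0n addn0.
- by rewrite big_geq// addr_ge0// sumr_ge0// => m _; exact: exprn_ge0.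
- rewrite big_nat_recl//= sub0n subn0 add0n [X in _ <= _ + X]big_nat_recr//=.
  rewrite (eq_bigr (fun m => r ^+ ((m - j) + (j - m)))); last first.
    by move=> m _; rewrite !subSS.
  have := IH N => {}IH.
  have hj : r ^+ j.+1 <= r ^+ j by rewrite exprS ler_piMl ?exprn_ge0// ltW.
  by rewrite [leLHS]addrC addrA lerD.
Qed.

End weighted_sums.

(** * Almost everywhere and weak convergence of a series with weighted square bounds *)

Section L2_series.
Context d (T : measurableType d) (R : realType).
Variable mu : {measure set T -> \bar R}.
Variables (u : nat -> T -> R) (om M : nat -> R) (K G : R).
Hypotheses (mu_ : forall m, measurable_fun setT (u m)).
Hypotheses (om_gt0 : forall m, 0 < om m) (K0 : 0 <= K) (M0 : forall m, 0 <= M m).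
Hypothesis om_sum : forall N, \sum_(0 <= m < N) (om m)^-1 <= G.
Hypothesis u_le : forall m, (\int[mu]_x (u m x ^+ 2)%:E <= (K * M m)%:E)%E.
Hypothesis M_sum : (\sum_(m <oo) (om m * M m)%:E < +oo)%E.

Let V x : \bar R := (\sum_(m <oo) (om m * u m x ^+ 2)%:E)%E.

Let term_ge0 m x : (0 <= (om m * u m x ^+ 2)%:E)%E.
Proof. by rewrite lee_fin mulr_ge0 ?sqr_ge0// ltW. Qed.

Let V_ge0 x : (0 <= V x)%E. Proof. exact: nneseries_ge0. Qed.

Let mterm m : measurable_fun setT (fun x => (om m * u m x ^+ 2)%:E).
Proof. by apply/measurable_EFinP; apply: measurable_funM => //; exact: measurable_funX. Qed.

Let mV : measurable_fun setT V.
Proof. by apply: ge0_emeasurable_sum => // m x _ _; exact: term_ge0. Qed.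

Let V_int : (\int[mu]_x V x < +oo)%E.
Proof.
rewrite integral_nneseries//.
apply: (@le_lt_trans _ _ (\sum_(m <oo) (K%:E * (om m * M m)%:E))%E).
  apply: lee_nneseries => m _; first by move=> _; apply: integral_ge0.
  under eq_integral do rewrite EFinM.
  rewrite ge0_integralZl_EFin//; last 3 first.
  - by move=> x _; rewrite lee_fin sqr_ge0.
  - by apply/measurable_EFinP; exact: measurable_funX.
  - exact: ltW.
  by rewrite -EFinM mulrCA EFinM lee_wpmul2l// lee_fin ltW.
rewrite nneseriesZl; last by move=> m _; rewrite lee_fin mulr_ge0// ltW.
by rewrite lte_mul_pinfty// lee_fin.
Qed.

(** Where [V] is finite the series converges absolutely. Multiplying the partial sums by the
    indicator of [F] makes their limit exist everywhere, hence measurable, and [D] dominates their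
    squares. *)
Let F := [set x | (V x < +oo)%E].

Let mF : measurable F.
Proof. by rewrite -[F]setTI; apply: emeasurable_fun_infty_o. Qed.

Let s N x : R := (\sum_(0 <= m < N) u m x) * \1_F x.
Let D x : R := G * fine (V x).

Let G0 : 0 <= G. Proof. by have := om_sum 0; rewrite big_geq. Qed.

Let partial_le x N : F x -> \sum_(0 <= m < N) om m * u m x ^+ 2 <= fine (V x).
Proof.
move=> Fx; have Vfin : V x \is a fin_num by rewrite ge0_fin_numE.
rewrite -lee_fin fineK// -sumEFin; exact: nneseries_lim_ge.
Qed.

Let s_le N x : s N x ^+ 2 <= D x.
Proof.
rewrite /s; have [Fx|nFx] := pselect (F x); last first.
  by rewrite indicE memNset// mulr0 expr0n mulr_ge0// fine_ge0.
rewrite indicE mem_set// mulr1.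
have := @weighted_cauchy_schwarz R (fun m => (om m)^-1) (fun m => u m x) N.
have oi m : 0 < (om m)^-1 by rewrite invr_gt0.
move=> /(_ oi) H; apply: (le_trans H); apply: ler_pM => //.
- by apply: sumr_ge0 => m _; rewrite invr_ge0 ltW.
- by apply: sumr_ge0 => m _; rewrite mulr_ge0 ?sqr_ge0// invrK ltW.
rewrite (eq_bigr (fun m => om m * u m x ^+ 2)); first exact: partial_le.
by move=> m _; rewrite invrK.
Qed.

Let s_cvg x : F x -> cvgn (fun N => \sum_(0 <= m < N) u m x).
Proof.
move=> Fx.
apply: (@normed_cvg R (R^o : completeNormedModType R) (fun m => u m x)).
apply: (@series_le_cvg R _ (fun m => (om m)^-1 + om m * u m x ^+ 2)).
- by move=> m; exact: normr_ge0.
- by move=> m; have o0 := ltW (om_gt0 m); rewrite addr_ge0 ?invr_ge0// mulr_ge0// sqr_ge0.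
- move=> m; have o0 := om_gt0 m.
  have -> : (om m)^-1 + om m * u m x ^+ 2 = (om m)^-1 * (1 + (om m * `|u m x|) ^+ 2).
    by rewrite exprMn real_normK ?num_real//; field; rewrite gt_eqF.
  rewrite mulrC ler_pdivlMr// mulrC.
  by move: (om m * _) => z; have := sqr_ge0 (z - 1); nra.
- apply: nondecreasing_is_cvgn.
    apply/nondecreasing_series => m _ _.
    by have o0 := ltW (om_gt0 m); rewrite addr_ge0 ?invr_ge0// mulr_ge0// sqr_ge0.
  exists (G + fine (V x)) => _ [N _ <-]; rewrite /series /= big_split /=.
  by rewrite lerD// partial_le.
Qed.

Let s_cvgn x : cvgn (s ^~ x).
Proof.
have [Fx|nFx] := pselect (F x).
  rewrite (_ : s ^~ x = fun N => \sum_(0 <= m < N) u m x); first exact: s_cvg.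
  by apply/funext => N; rewrite /s indicE mem_set// mulr1.
rewrite (_ : s ^~ x = fun=> 0); first exact: is_cvg_cst.
by apply/funext => N; rewrite /s indicE memNset// mulr0.
Qed.

Let S x : R := limn (s ^~ x).

Let ms N : measurable_fun setT (s N).
Proof.
apply: measurable_funM; first by apply: measurable_sum.
exact: measurable_indic.
Qed.

Let mS : measurable_fun setT S.
Proof. by apply: (@measurable_fun_cvg _ _ _ _ s) => // x _; exact: s_cvgn. Qed.

Let mD : measurable_fun setT D.
Proof. by apply: measurable_funM => //; exact: measurableT_comp. Qed.

Let iD : L1 mu D.
Proof.
apply: L1Z; apply: L1_ge0.
- exact: measurableT_comp.
- by move=> x; exact: fine_ge0.
- apply: le_lt_trans V_int; apply: ge0_le_integral => //.
  + by move=> x _; rewrite lee_fin fine_ge0.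
  + by apply/measurable_EFinP; exact: measurableT_comp.
  + by move=> x _; have := V_ge0 x; case: (V x) => //= _; rewrite leey.
Qed.

Let F_ae : {ae mu, forall x, F x}.
Proof.
have iV : mu.-integrable setT V.
  apply/integrableP; split => //.
  by under eq_integral do rewrite gee0_abs//.
have := integrable_ae measurableT iV.
by apply: filterS => x /(_ I); rewrite ge0_fin_numE.
Qed.

(** Cauchy-Schwarz with weights [om] bounds the square of every partial sum by [G * V], an
    integrable function. This puts the limit in L2 and, with majorant [D + psi^2], gives the limit
    of the pairings. *)
Lemma L2_series : exists S : T -> R, [/\ L2 mu S,
  {ae mu, forall x, (fun N => \sum_(0 <= m < N) u m x) @ \oo --> S x} &
  forall psi, L2 mu psi -> (forall N, L1 mu (fun x => (\sum_(0 <= m < N) u m x) * psi x)) /\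
   (fun N => Rintegral mu setT (fun x => (\sum_(0 <= m < N) u m x) * psi x)) @ \oo -->
   Rintegral mu setT (fun x => S x * psi x)].
Proof.
have L2u m : L2 mu (u m).
  split => //; apply: L1_ge0.
  - exact: measurable_funX.
  - by move=> x; exact: sqr_ge0.
  - exact: le_lt_trans (u_le m) (ltry _).
have L2s N : L2 mu (fun x => \sum_(0 <= m < N) u m x).
  elim: N => [|N IH].
    apply: (L2_eq (h := fun=> 0)); first by move=> x; rewrite big_geq.
    split => //; rewrite expr0n; exact: integrable0.
  apply: (L2_eq (h := fun x => \sum_(0 <= m < N) u m x + u N x)).
    by move=> x; rewrite big_nat_recr.
  exact: L2D.
exists S; split.
- split => //; apply: (@L1_dominated _ _ _ mu _ D) => //; first exact: measurable_funX.
  move=> x; rewrite ger0_norm ?sqr_ge0//.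
  have cv : (fun N => s N x ^+ 2) @ \oo --> S x ^+ 2.
    by rewrite expr2; under eq_fun do rewrite expr2; apply: cvgM; exact: s_cvgn.
  by apply: (ler_cvg_to cv (cvg_cst (D x))); apply: nearW => N; exact: s_le.
- apply: filterS F_ae => x Fx; rewrite (_ : (fun N => _) = s ^~ x); first exact: s_cvgn.
  by apply/funext => N; rewrite /s indicE mem_set// mulr1.
- move=> psi lpsi; split; first by move=> N; exact: L2_mul.
  have [mpsi ipsi] := lpsi.
  have [] // := @L1_dominated_cvg _ _ _ mu (fun N x => (\sum_(0 <= m < N) u m x) * psi x)
     (fun x => S x * psi x) (fun x => D x + psi x ^+ 2).
  + by move=> N; apply: measurable_funM => //; exact: (L2s N).1.
  + exact: measurable_funM.
  + apply: filterS F_ae => x Fx; apply: cvgMl.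
    rewrite (_ : (fun N => _) = s ^~ x); first exact: s_cvgn.
    by apply/funext => N; rewrite /s indicE mem_set// mulr1.
  + exact: L1D.
  + apply: filterS F_ae => x Fx N.
    have := s_le N x; rewrite /s indicE mem_set// mulr1.
    move: (\sum_(0 <= m < N) u m x) (D x) (psi x) => p q r pq.
    rewrite normrM; apply: (@le_trans _ _ (p ^+ 2 + r ^+ 2)); last by rewrite lerD2r.
    rewrite -(real_normK (num_real p)) -(real_normK (num_real r)).
    have := normr_ge0 p; have := normr_ge0 r; move: `|p| `|r| => v w; nra.
Qed.

End L2_series.

(** * Convergence along the sequence *)

(** Additivity of the counting measure over singletons. It turns the cardinality of a block into a
    series over the indices [k], the form needed when a maximum over a block is replaced by a
    sum. *)
Lemma sum_singletons_counting (R : realType) (t : nat -> R) (A : set R) :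
  injective t -> (forall x, A x -> range t x) ->
  (\sum_(k <oo) ((t k \in A)%:R : R)%:E = counting A)%E.
Proof.
move=> tI At.
pose F k : set (measurableTypeR R) := if t k \in A then [set t k] else set0.
have AE : A = \bigcup_k F k.
  apply/seteqP; split => x.
    by move=> Ax; have [k _ tk] := At _ Ax; exists k => //; rewrite /F tk mem_set.
  by move=> [k _]; rewrite /F; case: ifPn => [|_ []]; rewrite inE => Atk ->.
have mF k : measurable (F k) by rewrite /F; case: ifPn => _; [exact: measurable_set1|exact: measurable0].
have tF : trivIset setT F.
  apply/trivIsetP => i j _ _ ij; rewrite /F.
  case: ifPn => _; last by rewrite set0I.
  case: ifPn => _; last by rewrite setI0.
  apply/seteqP; split => x //= [-> /tI ji]; by rewrite ji eqxx in ij.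
have -> : counting A = (\sum_(k <oo) counting (F k) :> \bar R)%E.
  rewrite [in LHS]AE.
  have H : measurable (\bigcup_k F k) by exact: bigcup_measurable.
  by apply: measure_semi_bigcup.
apply: eq_eseriesr => k _; rewrite /F; case: ifPn => kA.
  by rewrite /counting asboolT// fset_set1 finmap.cardfs1.
by rewrite /counting asboolT// fset_set0 finmap.cardfs0.
Qed.

Section maximal.
Context d (T : measurableType d) (R : realType).
Variable mu : {measure set T -> \bar R}.
Variables (b C L K : R) (M lam : nat -> R) (t : nat -> R) (u : nat -> R -> T -> R).
Hypotheses (b0 : 0 < b) (C0 : 0 <= C) (L0 : 0 <= L) (K0 : 0 <= K).
Hypotheses (M0 : forall m, 0 <= M m) (lam0 : forall m, 0 < lam m).
Hypothesis lam_le : forall m, lam m <= L * 2 `^ ((1 + b) * m%:R).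
Hypotheses (t_lt1 : t 0%N < 1) (t_decr : forall k, t k.+1 < t k).
Hypotheses (t_gt0 : forall k, 0 < t k) (t_cvg0 : t @ \oo --> (0 : R)).
Hypothesis block_le : forall j, (1 <= j)%N ->
  (counting (dyadic_block t j) <= (C * 2 `^ (b * j%:R))%:E)%E.
Hypothesis mu_ : forall m tau, measurable_fun setT (u m tau).
Hypothesis u_diff : forall m tau sigma, 0 <= tau -> 0 <= sigma ->
  (\int[mu]_x ((u m tau x - u m sigma x) ^+ 2)%:E <= (K * M m)%:E)%E.
Hypothesis u_lip : forall m tau sigma, 0 <= tau -> 0 <= sigma ->
  (\int[mu]_x ((u m tau x - u m sigma x) ^+ 2)%:E <=
   (K * (lam m * (tau - sigma)) ^+ 2 * M m)%:E)%E.
Hypothesis u_cvg : forall m x, (fun i => u m (t i) x) @ \oo --> u m 0 x.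
Hypothesis M_sum : (\sum_(m <oo) (2 `^ (b * m%:R) * M m)%:E < +oo)%E.

Let om m : R := 2 `^ (b * m%:R).
(** [p] is the slower of the two decay rates in [|m - j|]: [2^-b] comes from counting points when
    [j <= m], [1 / 2] from the discrete Sobolev inequality when [m < j]. Its square root [r] splits
    the decay into two halves, one used as Cauchy-Schwarz weight and one kept for the summation. *)
Let p : R := Num.max (2 `^ (- b)) (1 / 2).
Let r : R := Num.sqrt p.
Let dist m j : nat := ((m - j) + (j - m))%N.

Let om_gt0 m : 0 < om m. Proof. exact: powR_gt0. Qed.

Let p_gt0 : 0 < p. Proof. by rewrite lt_max powR_gt0. Qed.

Let p_lt1 : p < 1.
Proof.
rewrite gt_max; apply/andP; split; last by lra.
by rewrite /powR pnatr_eq0/= expR_lt1 mulNr oppr_lt0 mulr_gt0// ln_gt0// ltr1n.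
Qed.

Let r_gt0 : 0 < r. Proof. by rewrite sqrtr_gt0. Qed.

Let r_sqr : r * r = p. Proof. by rewrite -expr2 sqr_sqrtr// ltW. Qed.

Let r_lt1 : r < 1. Proof. by have := p_lt1; have := r_gt0; rewrite -r_sqr; nra. Qed.

Let t_homo i j : (i <= j)%N -> t j <= t i.
Proof.
elim: j => [|j IH]; first by rewrite leqn0 => /eqP ->.
rewrite leq_eqVlt => /predU1P[->//|]; rewrite ltnS => /IH; apply: le_trans.
exact: ltW.
Qed.

Let t_inj : injective t.
Proof.
have lt i j : (i < j)%N -> t j < t i.
  by move=> ij; rewrite (le_lt_trans (t_homo ij)).
move=> i j tij; apply/eqP; rewrite eqn_leq; apply/andP; split; rewrite leqNgt; apply/negP => /lt;
  by rewrite tij ltxx.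
Qed.

Let F k m x : R := u m (t k) x - u m 0 x.
Let Dl i : R := t i - t i.+1.
(* AM-GM with the weight [lam m * Dl i] bounds [F i m ^+ 2 - F i.+1 m ^+ 2] by
   [D i m], whose integral is proportional to [t i - t i.+1]: a Sobolev
   inequality in time, discretized along [t]. *)
Let D i m x : R := (lam m * Dl i)^-1 * (u m (t i) x - u m (t i.+1) x) ^+ 2 +
   lam m * Dl i * (F i m x ^+ 2 + F i.+1 m x ^+ 2).

Let Dl_gt0 i : 0 < Dl i. Proof. by rewrite subr_gt0. Qed.

Let mF k m : measurable_fun setT (F k m).
Proof. exact: measurable_funB. Qed.

Let mD i m : measurable_fun setT (D i m).
Proof.
apply: measurable_funD; apply: measurable_funM => //.
  by apply: measurable_funX; exact: measurable_funB.
by apply: measurable_funD; exact: measurable_funX.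
Qed.

Let D_ge0 i m x : 0 <= D i m x.
Proof.
have h : 0 <= lam m * Dl i by rewrite mulr_ge0// ltW.
by rewrite addr_ge0// mulr_ge0 ?invr_ge0 ?addr_ge0 ?sqr_ge0.
Qed.

Let D_ge i m x : F i m x ^+ 2 - F i.+1 m x ^+ 2 <= D i m x.
Proof.
rewrite /D; have : 0 < lam m * Dl i by rewrite mulr_gt0.
have -> : u m (t i) x - u m (t i.+1) x = F i m x - F i.+1 m x by rewrite /F; ring.
move: (lam m * Dl i) (F i m x) (F i.+1 m x) => e v w e0.
have ei : 0 < e^-1 by rewrite invr_gt0.
rewrite -subr_ge0.
(* Completing the square; [(v + w)^2 = 2 (v^2 + w^2) - (v - w)^2] leaves only squares. *)
have -> : e^-1 * (v - w) ^+ 2 + e * (v ^+ 2 + w ^+ 2) - (v ^+ 2 - w ^+ 2) =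
  e^-1 * (((v - w) - e / 2 * (v + w)) ^+ 2 + (e * (v - w) / 2) ^+ 2 + (e ^+ 2) * (v^+2 + w^+2) / 2).
  by field; rewrite gt_eqF.
apply: mulr_ge0; first exact: ltW.
apply: addr_ge0; first by apply: addr_ge0; exact: sqr_ge0.
by apply: mulr_ge0 => //; apply: mulr_ge0; rewrite ?addr_ge0 ?sqr_ge0.
Qed.

(** With weight [lam m * Dl i] the increment estimate contributes [K * lam m * Dl i * M m] once, and
    the uniform bounds at [t i] and [t i.+1] once each, whence the 3. *)
Let int_D i m : (\int[mu]_x (D i m x)%:E <= (3 * K * lam m * Dl i * M m)%:E)%E.
Proof.
have h : 0 < lam m * Dl i by rewrite mulr_gt0.
have ms k : measurable_fun setT (fun x => (F k m x ^+ 2)%:E).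
  by apply/measurable_EFinP; exact: measurable_funX.
have md : measurable_fun setT (fun x => ((u m (t i) x - u m (t i.+1) x) ^+ 2)%:E).
  by apply/measurable_EFinP; apply: measurable_funX; exact: measurable_funB.
rewrite (eq_integral (fun x => ((lam m * Dl i)^-1)%:E * ((u m (t i) x - u m (t i.+1) x) ^+ 2)%:E +
   (lam m * Dl i)%:E * ((F i m x ^+ 2)%:E + (F i.+1 m x ^+ 2)%:E))%E); last by [].
rewrite ge0_integralD//; last 4 first.
- by move=> x _; rewrite lee_fin mulr_ge0 ?invr_ge0 ?sqr_ge0// ltW.
- exact: measurable_funeM.
- by move=> x _; rewrite lee_fin mulr_ge0 ?addr_ge0 ?sqr_ge0// ltW.
- by apply: measurable_funeM; exact: emeasurable_funD.
rewrite ge0_integralZl_EFin//; last 2 first.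
- by move=> x _; rewrite lee_fin sqr_ge0.
- by rewrite invr_ge0 ltW.
rewrite ge0_integralZl_EFin//; last 3 first.
- by move=> x _; rewrite lee_fin addr_ge0// sqr_ge0.
- exact: emeasurable_funD.
- exact: ltW.
rewrite ge0_integralD//; last 2 first.
- by move=> x _; rewrite lee_fin sqr_ge0.
- by move=> x _; rewrite lee_fin sqr_ge0.
have -> : 3 * K * lam m * Dl i * M m = (lam m * Dl i)^-1 * (K * (lam m * (t i - t i.+1)) ^+ 2 * M m) +
   lam m * Dl i * (K * M m + K * M m).
  by rewrite -/(Dl i); field; rewrite !gt_eqF.
rewrite EFinD (EFinM (lam m * Dl i)^-1) (EFinM (lam m * Dl i)); apply: leeD.
  apply: lee_wpmul2l; first by rewrite lee_fin invr_ge0 ltW.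
  by apply: u_lip; exact: ltW.
apply: lee_wpmul2l; first by rewrite lee_fin ltW.
by rewrite EFinD; apply: leeD; apply: u_diff => //; exact: ltW.
Qed.

(* [\sum_k bt j k m] dominates [F k m ^+ 2] for all [t k] in the [j]-th dyadic
   block. For [j <= m] this is the trivial bound, paid for by the cardinality of
   the block; for [m < j] the decrements [D] telescope down to time 0. *)
Let bt (j k m : nat) x : R := if (j <= m)%N then (t k \in dyadic_block t j)%:R * F k m x ^+ 2
   else ((t k <= 2 ^- j)%R)%:R * D k m x.

Let bt_ge0 j k m x : 0 <= bt j k m x.
Proof. by rewrite /bt; case: ifP => _; rewrite mulr_ge0// sqr_ge0. Qed.

Let mbt j k m : measurable_fun setT (fun x => (bt j k m x)%:E).
Proof.
apply/measurable_EFinP; rewrite /bt; case: (j <= m)%N; apply: measurable_funM => //.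
exact: measurable_funX.
Qed.

Let B j m x : \bar R := (\sum_(k <oo) (bt j k m x)%:E)%E.

Let B_ge0 j m x : (0 <= B j m x)%E.
Proof. by apply: nneseries_ge0 => k _ _; rewrite lee_fin. Qed.

Let mB j m : measurable_fun setT (B j m).
Proof. by apply: ge0_emeasurable_sum; [move=> k x _ _; rewrite lee_fin|move=> k _]. Qed.

(** Telescoping over the times at most [2^-j]. The maximum with 0 takes care of the [N] for which no
    such time has occurred yet. *)
Let sum_Dl j N : \sum_(0 <= i < N) ((t i <= 2 ^- j)%R)%:R * Dl i <= 2 ^- j.
Proof.
suff H : \sum_(0 <= i < N) ((t i <= 2 ^- j)%R)%:R * Dl i <= Num.max 0 (2 ^- j - t N).
  apply: (le_trans H); rewrite ge_max invr_ge0 exprn_ge0//= gerBl ltW//.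
elim: N => [|N IH]; first by rewrite big_geq// le_max lexx.
rewrite big_nat_recr//=; case: (leP (t N) (2 ^- j)) => h.
  rewrite mul1r le_max; apply/orP; right.
  move: IH; rewrite max_r ?subr_ge0// => IH.
  by rewrite (le_trans (lerD IH (lexx _)))// /Dl; lra.
by rewrite mul0r addr0 (le_trans IH)// ge_max le_max lexx/= le_max subr_le0 ltW.
Qed.

Let powN2 j : 2 `^ (- j%:R) = 2 ^- j :> R.
Proof. by rewrite powRN powR_mulrn. Qed.

Let half_le i : (2 : R) ^- i <= p ^+ i.
Proof.
rewrite -exprVn; apply: lerXn2r; rewrite ?nnegrE ?invr_ge0 ?(ltW p_gt0)//.
by rewrite le_max; apply/orP; right; lra.
Qed.

Let bpow_le i : 2 `^ (- (b * i%:R)) <= p ^+ i :> R.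
Proof.
rewrite -mulNr powRrM powR_mulrn ?powR_ge0//; apply: lerXn2r; rewrite ?nnegrE ?powR_ge0 ?(ltW p_gt0)//.
by rewrite le_max lexx.
Qed.

(** For [j <= m], [2^(bj) = 2^(bm) 2^(-b(m-j))]. For [m < j], the lengths [Dl k] of the relevant
    steps sum to at most [2^-j], and [lam m * 2^-j <= L 2^(bm) 2^(-(j-m))]. The last power in each
    case is at most [p ^+ dist m j]. *)
Let int_B j m : (1 <= j)%N ->
  (\int[mu]_x B j m x <= ((K * C + 3 * K * L) * (om m * M m) * p ^+ dist m j)%:E)%E.
Proof.
move=> j1; rewrite integral_nneseries//; last by move=> k x _; rewrite lee_fin.
have KC0 : 0 <= K * C by rewrite mulr_ge0.
have KL0 : 0 <= 3 * K * L by rewrite !mulr_ge0.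
have oM0 : 0 <= om m * M m by rewrite mulr_ge0// ltW.
have pd0 : 0 <= p ^+ dist m j by rewrite exprn_ge0// ltW.
case: (leqP j m) => jm.
  apply: (@le_trans _ _ (\sum_(k <oo) ((K * M m)%:E * ((t k \in dyadic_block t j)%:R : R)%:E))%E).
    apply: lee_nneseries => k _; first by move=> _; apply: integral_ge0 => x _; rewrite lee_fin.
    rewrite /bt jm; case: (_ \in _) => /=; last first.
      rewrite mule0 (eq_integral (cst 0%E)) ?integral0//.
      by move=> x _; rewrite mul0r.
    rewrite mule1 (eq_integral (fun x => (F k m x ^+ 2)%:E)); last by move=> x _; rewrite mul1r.
    by apply: u_diff => //; exact: ltW.
  rewrite nneseriesZl; last by move=> k _; rewrite lee_fin.
  rewrite sum_singletons_counting//; last by move=> x [].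
  apply: (@le_trans _ _ ((K * M m)%:E * (C * 2 `^ (b * j%:R))%:E)%E).
    by apply: lee_wpmul2l; [rewrite lee_fin mulr_ge0|exact: block_le].
  rewrite -EFinM lee_fin.
  have -> : 2 `^ (b * j%:R) = om m * 2 `^ (- (b * (m - j)%:R)) :> R.
    rewrite /om -powRD; last by rewrite pnatr_eq0 implybT.
    by rewrite natrB//; congr (_ `^ _); ring.
  have dE : dist m j = (m - j)%N by apply/eqP; rewrite /dist -[X in _ == X]addn0 eqn_add2l subn_eq0.
  have := bpow_le (m - j); rewrite -dE => h.
  apply: (@le_trans _ _ (K * C * (om m * M m) * p ^+ dist m j)).
    rewrite [leLHS](_ : _ = K * C * (om m * M m) * 2 `^ (- (b * (dist m j)%:R))); last by rewrite dE; ring.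
    by rewrite ler_wpM2l// mulr_ge0.
  by rewrite ler_wpM2r// ler_wpM2r// lerDl.
have jm' : (j <= m)%N = false by rewrite leqNgt jm.
apply: (@le_trans _ _ (\sum_(k <oo) ((3 * K * lam m * M m)%:E * (((t k <= 2 ^- j)%R)%:R * Dl k)%:E))%E).
  apply: lee_nneseries => k _; first by move=> _; apply: integral_ge0 => x _; rewrite lee_fin.
  rewrite /bt jm'; case: (_ <= _) => /=; last first.
    rewrite mul0r mule0 (eq_integral (cst 0%E)) ?integral0//.
    by move=> x _; rewrite mul0r.
  rewrite mul1r -EFinM (eq_integral (fun x => (D k m x)%:E)); last by move=> x _; rewrite mul1r.
  by rewrite (le_trans (int_D k m))// lee_fin le_eqVlt; apply/orP; left; apply/eqP; ring.
have lM0 : 0 <= 3 * K * lam m * M m by rewrite !mulr_ge0// ltW.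
rewrite nneseriesZl; last by move=> k _; rewrite lee_fin mulr_ge0// ltW.
apply: (@le_trans _ _ ((3 * K * lam m * M m)%:E * (2 ^- j)%:E)%E).
  apply: lee_wpmul2l; first by rewrite lee_fin.
  apply: lime_le.
    by apply: is_cvg_nneseries => k _ _; rewrite lee_fin mulr_ge0// ltW.
  by apply: nearW => N; rewrite sumEFin lee_fin; exact: sum_Dl.
rewrite -EFinM lee_fin.
have dE : dist m j = (j - m)%N by apply/eqP; rewrite /dist -[X in _ == X]add0n eqn_add2r subn_eq0 ltnW.
have h2 : 2 `^ ((1 + b) * m%:R) * 2 ^- j = om m * 2 ^- dist m j :> R.
  rewrite -!powN2 /om -!powRD; try by rewrite pnatr_eq0 implybT.
  by rewrite dE natrB ?(ltnW jm)//; congr (_ `^ _); ring.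
have := half_le (dist m j) => h.
apply: (@le_trans _ _ (3 * K * L * (om m * M m) * p ^+ dist m j)); last first.
  by rewrite ler_wpM2r// ler_wpM2r// lerDr.
apply: (@le_trans _ _ (3 * K * L * M m * (om m * 2 ^- dist m j))).
  rewrite -h2 [leLHS](_ : _ = 3 * K * M m * 2 ^- j * lam m); last by ring.
  rewrite [leRHS](_ : _ = 3 * K * M m * 2 ^- j * (L * 2 `^ ((1 + b) * m%:R))); last by ring.
  by rewrite ler_wpM2l// !mulr_ge0// invr_ge0 exprn_ge0.
rewrite [leLHS](_ : _ = 3 * K * L * (om m * M m) * 2 ^- dist m j); last by ring.
by rewrite ler_wpM2l// mulr_ge0.
Qed.

Let block_term j k m x : t k \in dyadic_block t j -> ((F k m x ^+ 2)%:E <= B j m x)%E.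
Proof.
move=> kj; have bt0 i : (0 <= (bt j i m x)%:E)%E by rewrite lee_fin.
have part N : (\sum_(0 <= i < N) (bt j i m x)%:E <= B j m x)%E.
  by apply: nneseries_lim_ge.
case: (leqP j m) => jm.
  apply: le_trans (part k.+1); rewrite sumEFin lee_fin big_nat_recr//=.
  rewrite {2}/bt jm kj mul1r lerDr sumr_ge0// => i _; exact: bt_ge0.
have jm' : (j <= m)%N = false by rewrite leqNgt jm.
(* An infinite majorant leaves nothing to prove. *)
have [Bfin|] := boolP (B j m x \is a fin_num); last first.
  rewrite ge0_fin_numE// -leNgt leye_eq => /eqP ->; exact: leey.
rewrite -(fineK Bfin) lee_fin.
have tk : t k <= 2 ^- j by move: kj; rewrite inE => -[_ /andP[]].
(* All later times stay below [2^-j], so every indicator in [bt] from index [k] on equals 1 and the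
   decrements add up. *)
have tele N : F k m x ^+ 2 <= \sum_(0 <= i < k + N) bt j i m x + F (k + N) m x ^+ 2.
  elim: N => [|N IH].
    by rewrite addn0 lerDr sumr_ge0// => i _; exact: bt_ge0.
  apply: (le_trans IH); rewrite addnS big_nat_recr//= -addrA lerD2l.
  have -> : bt j (k + N) m x = D (k + N) m x.
    by rewrite /bt jm' (le_trans (t_homo (leq_addr _ _)) tk) mul1r.
  by have := D_ge (k + N) m x; rewrite lerBlDr.
have tele' N : F k m x ^+ 2 <= fine (B j m x) + F (k + N) m x ^+ 2.
  apply: (le_trans (tele N)); rewrite lerD2r -lee_fin fineK// -sumEFin; exact: part.
have cF : (fun N => F (k + N) m x ^+ 2) @ \oo --> (0 : R).
  have c0 : (fun N => F N m x) @ \oo --> (0 : R).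
    by rewrite -(subrr (u m 0 x)); apply: cvgB; [exact: u_cvg|exact: cvg_cst].
  have c1 : (fun N => F (k + N) m x) @ \oo --> (0 : R).
    rewrite (_ : (fun N => _) = [sequence F (N + k)%N m x]_N); last first.
      by apply/funext => N; rewrite addnC.
    rewrite (cvg_shiftn k (fun N => F N m x)).
    exact: c0.
  by rewrite -[X in _ --> X](mulr0 (0 : R)); apply: cvgM.
have cR : (fun N => fine (B j m x) + F (k + N) m x ^+ 2) @ \oo --> fine (B j m x).
  by rewrite -[X in _ --> X]addr0; apply: cvgD => //; exact: cvg_cst.
apply: (ler_cvg_to (cvg_cst (F k m x ^+ 2)) cR).
exact: nearW.
Qed.

(** Up to the factor [2 / (1 - r)], a majorant of the squared sum over [m] for every time in block
    [j], by Cauchy-Schwarz with weights [r ^+ dist m j]; since [p = r * r], its integral still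
    decays like [r ^+ dist m j]. *)
Let Q j x : \bar R := (\sum_(m <oo) ((r ^- dist m j)%:E * B j m x))%E.

Let rd_gt0 i : 0 < r ^- i. Proof. by rewrite invr_gt0 exprn_gt0. Qed.

Let Qt_ge0 j m x : (0 <= (r ^- dist m j)%:E * B j m x)%E.
Proof. by rewrite mule_ge0// lee_fin ltW. Qed.

Let Q_ge0 j x : (0 <= Q j x)%E.
Proof. by apply: nneseries_ge0. Qed.

Let mQt j m : measurable_fun setT (fun x => (r ^- dist m j)%:E * B j m x)%E.
Proof. exact: measurable_funeM. Qed.

Let mQ j : measurable_fun setT (Q j).
Proof. by apply: ge0_emeasurable_sum. Qed.

Let K' : R := K * C + 3 * K * L.

Let K'0 : 0 <= K'. Proof. by rewrite addr_ge0 ?mulr_ge0. Qed.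

Let int_Q j : (1 <= j)%N ->
  (\int[mu]_x Q j x <= \sum_(m <oo) ((K' * (om m * M m)) * r ^+ dist m j)%:E)%E.
Proof.
move=> j1; rewrite integral_nneseries//; apply: lee_nneseries => m _.
  by move=> _; apply: integral_ge0.
rewrite ge0_integralZl_EFin//; last by rewrite ltW.
apply: (@le_trans _ _ ((r ^- dist m j)%:E * (K' * (om m * M m) * p ^+ dist m j)%:E)%E).
  by apply: lee_wpmul2l; [rewrite lee_fin ltW|exact: int_B].
rewrite -EFinM lee_fin -r_sqr exprMn.
have h : r ^+ dist m j != 0 by rewrite expf_neq0// gt_eqF.
rewrite le_eqVlt; apply/orP; left; apply/eqP.
by rewrite mulrC -!mulrA mulfV// mulr1.
Qed.

(** The shift starts the sum at block 1, the first for which the number of points is controlled. *)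
Let TQ x : \bar R := (\sum_(j <oo) Q j.+1 x)%E.

(** Exchanging the two sums: for fixed [m] the sum over [j] of [r^|m-j|] is bounded, and what
    remains is the summability of [om m * M m]. *)
Let int_TQ : (\int[mu]_x TQ x < +oo)%E.
Proof.
have t0 i m j : (0 <= ((K' * (om m * M m)) * r ^+ dist i j)%:E)%E.
  by rewrite lee_fin mulr_ge0 ?exprn_ge0 ?(ltW r_gt0)// mulr_ge0// mulr_ge0// ltW.
rewrite integral_nneseries//.
apply: (@le_lt_trans _ _ (\sum_(j <oo) \sum_(m <oo) ((K' * (om m * M m)) * r ^+ dist m j.+1)%:E)%E).
  by apply: lee_nneseries => j _; [move=> _; exact: integral_ge0|exact: int_Q].
rewrite (@nneseries_interchange R (fun j m => ((K' * (om m * M m)) * r ^+ dist m j.+1)%:E) xpredT xpredT)//.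
apply: (@le_lt_trans _ _ (\sum_(m <oo) ((2 * (1 - r)^-1 * K')%:E * (om m * M m)%:E))%E).
  apply: lee_nneseries => m _; first by move=> _; apply: nneseries_ge0.
  apply: lime_le; first by apply: is_cvg_nneseries.
  apply: nearW => N; rewrite sumEFin -EFinM lee_fin -mulr_sumr mulrC.
  rewrite [leRHS](_ : _ = 2 * (1 - r)^-1 * (K' * (om m * M m))); last by ring.
  rewrite ler_wpM2r//; first by rewrite mulr_ge0// mulr_ge0// ltW.
  (* Adding the missing term [j = 0] gives a sum over all indices, centred at [m]. *)
  apply: (@le_trans _ _ (\sum_(0 <= j < N.+1) r ^+ ((j - m) + (m - j)))).
    rewrite big_nat_recl//= (eq_bigr (fun i => r ^+ ((i.+1 - m) + (m - i.+1)))).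
      by rewrite lerDr exprn_ge0// ltW.
    by move=> i _; rewrite /dist addnC.
  by apply: dist_geometric_sum_le => //; exact: ltW.
rewrite nneseriesZl; last by move=> m _; rewrite lee_fin mulr_ge0// ltW.
rewrite lte_mul_pinfty// lee_fin !mulr_ge0// invr_ge0 subr_ge0 ltW//.
Qed.

(** Take the least [j] with [2^-(j+1) < t k]; minimality gives the upper bound, or [t k < 1] when
    [j = 0]. *)
Let exists_block k : exists j, t k \in dyadic_block t j.
Proof.
have tk1 : t k < 1 by rewrite (le_lt_trans (t_homo (leq0n k))).
have ex : exists j, (2 : R) ^- j.+1 < t k.
  have [N _ hN] : \forall N \near \oo, (t k)^-1 < N%:R by exact: nbhs_infty_gtr.
  exists N; rewrite invf_plt ?posrE ?exprn_gt0// (lt_trans (hN N (leqnn N)))//.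
  by rewrite -natrX ltr_nat (leq_trans _ (ltn_expl _ _)).
have [j hj minj] := ex_minnP ex; exists j; rewrite inE /dyadic_block /=; split; first by exists k.
rewrite hj /=; case: j hj minj => [|j] hj minj; first by rewrite expr0 invr1 ltW.
by rewrite leNgt; apply/negP => /minj; rewrite ltnn.
Qed.

(** Where [TQ] is finite its terms tend to 0, and each dominates, up to a constant,
    [(S k x - S0 x)^2] for all times of its block. The block of [t k] moves off to infinity with
    [k]. *)
Lemma maximal_cvg (S : nat -> T -> R) (S0 : T -> R) :
  (forall k, {ae mu, forall x, (fun N => \sum_(0 <= m < N) u m (t k) x) @ \oo --> S k x}) ->
  {ae mu, forall x, (fun N => \sum_(0 <= m < N) u m 0 x) @ \oo --> S0 x} ->
  {ae mu, forall x, (fun k => S k x) @ \oo --> S0 x}.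
Proof.
move=> /ae_foralln hS hS0.
have mTQ : measurable_fun setT TQ by apply: ge0_emeasurable_sum.
have TQ0 x : (0 <= TQ x)%E by apply: nneseries_ge0.
have aeTQ : {ae mu, forall x, (TQ x < +oo)%E}.
  have iTQ : mu.-integrable setT TQ.
    apply/integrableP; split => //.
    by rewrite (eq_integral TQ)// => x _; rewrite gee0_abs.
  have := integrable_ae measurableT iTQ.
  by apply: filterS => x /(_ I); rewrite ge0_fin_numE.
apply: filterS3 hS hS0 aeTQ => x hS hS0 TQx.
have Qfin j : Q j.+1 x \is a fin_num.
  rewrite ge0_fin_numE//; apply: le_lt_trans TQx.
  have h : (\sum_(0 <= i < j.+1) Q i.+1 x <= TQ x)%E by apply: nneseries_lim_ge.
  apply: le_trans h; rewrite big_nat_recr//= leeDr// sume_ge0//.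
have G0 : 0 < 2 * (1 - r)^-1 by rewrite mulr_gt0// invr_gt0 subr_gt0.
have key j k : t k \in dyadic_block t j.+1 -> (S k x - S0 x) ^+ 2 <= 2 * (1 - r)^-1 * fine (Q j.+1 x).
  move=> kj.
  have cv : (fun N => (\sum_(0 <= m < N) F k m x) ^+ 2) @ \oo --> (S k x - S0 x) ^+ 2.
    have c1 : (fun N => \sum_(0 <= m < N) F k m x) @ \oo --> S k x - S0 x.
      rewrite (_ : (fun N => _) = (fun N => \sum_(0 <= m < N) u m (t k) x - \sum_(0 <= m < N) u m 0 x)).
        by apply: cvgB => //; exact: hS.
      by apply/funext => N; rewrite /F sumrB.
    by rewrite expr2; under eq_fun do rewrite expr2; apply: cvgM.
  apply: (ler_cvg_to cv (cvg_cst _)); apply: nearW => N.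
  have rd m : 0 < r ^+ dist m j.+1 by rewrite exprn_gt0.
  apply: (le_trans (weighted_cauchy_schwarz _ _ rd)); apply: ler_pM.
  - by apply: sumr_ge0 => m _; exact: ltW.
  - by apply: sumr_ge0 => m _; rewrite mulr_ge0 ?sqr_ge0// invr_ge0 ltW.
  - by apply: dist_geometric_sum_le => //; exact: ltW.
  rewrite -lee_fin fineK//.
  have h : (\sum_(0 <= m < N) ((r ^- dist m j.+1)%:E * B j.+1 m x) <= Q j.+1 x)%E by apply: nneseries_lim_ge.
  apply: le_trans h; rewrite -sumEFin; apply: lee_sum => m _.
  by rewrite EFinM lee_wpmul2l ?lee_fin ?(ltW (rd_gt0 _))//; exact: block_term.
have cQ : (fun j => fine (Q j.+1 x)) @ \oo --> (0 : R).
  apply: (@cvg_series_cvg_0 R R^o); apply: nondecreasing_is_cvgn.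
    by apply/nondecreasing_series => j _ _; exact: fine_ge0.
  exists (fine (TQ x)) => _ [N _ <-]; rewrite -lee_fin fineK ?ge0_fin_numE// /series /= -sumEFin.
  apply: (@le_trans _ _ (\sum_(0 <= i < N) Q i.+1 x)%E); last exact: nneseries_lim_ge.
  by apply: lee_sum => i _; rewrite fineK.
apply/cvgrPdist_lt => e e0.
have e1 : 0 < e ^+ 2 / (2 * (1 - r)^-1) by rewrite divr_gt0// exprn_gt0.
have /cvgrPdist_lt/(_ _ e1)[J _ hJ] := cQ.
have J0 : 0 < (2 : R) ^- J.+1 by rewrite invr_gt0 exprn_gt0.
have /cvgrPdist_lt/(_ _ J0) := t_cvg0.
apply: filterS => k; rewrite sub0r normrN gtr0_norm// => tkJ.
have [j kj] := exists_block k.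
(* From [2^-(j+1) < t k < 2^-(J+1)]; in particular [j] is positive, so that [key] applies. *)
have jJ : (J < j)%N.
  rewrite ltnNge; apply/negP => jJ; move: kj; rewrite inE => -[_ /andP[tj _]].
  have := lt_trans tj tkJ.
  by rewrite ltf_pV2 ?posrE ?exprn_gt0// ltr_eXn2l ?ltr1n// ltnS ltnNge jJ.
case: j kj jJ => [//|j] kj; rewrite ltnS => jJ.
have := hJ j jJ; rewrite /= sub0r normrN ger0_norm ?fine_ge0// => Qj.
rewrite distrC -(@ltr_pXn2r _ 2%N) ?nnegrE ?(ltW e0)// real_normK ?num_real//.
apply: (le_lt_trans (key _ _ kj)).
by rewrite mulrC -ltr_pdivlMr.
Qed.

End maximal.

(** * Dyadic blocks of the solution *)

Section dispersive_blocks.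
Context {R : realType} {n : nat}.
Local Notation E := 'rV[R]_n.
Local Notation mu := (@lebesgue_rV R n).
Local Notation cosT := (tft cos).
Local Notation sinT := (tft sin).
Implicit Types (g h k : E -> R) (a rho tau sigma : R).

Let mC : measurable_fun setT (@cos R). Proof. exact: measurable_cos. Qed.
Let mS : measurable_fun setT (@sin R). Proof. exact: measurable_sin. Qed.

Lemma sin_le_norm (x : R) : `|sin x| <= `|x|.
Proof.
suff H (y : R) : 0 <= y -> `|sin y| <= y.
  by have [x0|/ltW x0] := leP 0 x; [rewrite (ger0_norm x0) H|
    rewrite -normrN -sinN (ler0_norm x0) H// oppr_ge0].
move=> y0.
have [c _ h] := @MVT_segment R sin cos 0 y y0 (fun x _ => is_derive_sin x)
  (continuous_subspaceT (@continuous_sin R)).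
move: h; rewrite sin0 !subr0 => ->.
by rewrite normrM (ger0_norm y0) ler_piMl// cos_max.
Qed.

(** The left-hand side is [|e^(ix) - 1|^2 = 4 sin^2 (x / 2)]. *)
Lemma one_minus_cos_le (x : R) : 2 - 2 * cos x <= x ^+ 2.
Proof.
have E1 : cos x = 1 - 2 * sin (x / 2) ^+ 2.
  rewrite {1}(_ : x = x / 2 + x / 2); last by field.
  by rewrite cosD -!expr2; have := cos2Dsin2 (x / 2); lra.
rewrite E1.
have := sin_le_norm (x / 2); rewrite -(@ler_pXn2r _ 2%N) ?nnegrE// !real_normK ?num_real//.
by rewrite expr_div_n; lra.
Qed.

(** The real part of the inverse Fourier transform of [h + i k]. *)
Definition wave h k (x : E) : R := ((2 * pi) ^+ n)^-1 * (cosT h x - sinT k x).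

Let Cn_gt0 : 0 < (2 * pi) ^+ n :> R.
Proof. by rewrite exprn_gt0// mulr_gt0// pi_gt0. Qed.

Definition L12 h := L1 mu h /\ L2 mu h.

Lemma waveB h k h' k' x : L1 mu h -> L1 mu k -> L1 mu h' -> L1 mu k' ->
  wave h k x - wave h' k' x = wave (fun y => h y - h' y) (fun y => k y - k' y) x.
Proof.
move=> ih ik ih' ik'.
rewrite /wave (tftB mC (@cos_max R))// (tftB mS (@sin_max R))//; ring.
Qed.

(** Plancherel applies to [h] and [k] separately because the square of [cosT h - sinT k] is at most
    twice the sum of the squares; the factor 2 spares the cross term. *)
Lemma L2_wave h k : L12 h -> L12 k -> L2 mu (wave h k) /\
  (\int[mu]_x (wave h k x ^+ 2)%:E <=
   (2 * ((2 * pi) ^+ n)^-1 * Rintegral mu setT (fun x => h x ^+ 2 + k x ^+ 2))%:E)%E.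
Proof.
move=> [ih lh] [ik lk].
have [lch lsh Ih] := plancherel_le ih lh.
have [lck lsk Ik] := plancherel_le ik lk.
have lw : L2 mu (wave h k) by apply: L2Z; exact: L2B.
split => //; rewrite -EFin_Rint ?lee_fin; last exact: lw.2.
have i1 := L1D lch.2 lsh.2; have i2 := L1D lck.2 lsk.2.
have {}Ih : Rintegral mu setT (fun x => cosT h x ^+ 2 + sinT h x ^+ 2) <=
  (2 * pi) ^+ n * Rintegral mu setT (fun x => h x ^+ 2) by rewrite -lee_fin EFin_Rint.
have {}Ik : Rintegral mu setT (fun x => cosT k x ^+ 2 + sinT k x ^+ 2) <=
  (2 * pi) ^+ n * Rintegral mu setT (fun x => k x ^+ 2) by rewrite -lee_fin EFin_Rint.
set c := (2 * pi) ^+ n in Ih Ik *.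
apply: (@le_trans _ _ (Rintegral mu setT (fun x => (2 * c^-1 ^+ 2) *
   ((cosT h x ^+ 2 + sinT h x ^+ 2) + (cosT k x ^+ 2 + sinT k x ^+ 2))))).
  apply: le_Rint; first exact: lw.2.
    by apply: L1Z; exact: L1D.
  move=> x.
  have -> : wave h k x ^+ 2 = c^-1 ^+ 2 * (cosT h x - sinT k x) ^+ 2 by exact: exprMn.
  rewrite -[leRHS]mulrA [leRHS]mulrCA ler_wpM2l ?sqr_ge0//.
  move: (cosT h x) (sinT h x) (cosT k x) (sinT k x) => p q v w.
  have := sqr_ge0 (p + w); have := sqr_ge0 q; have := sqr_ge0 v; nra.
rewrite RintZ; last exact: L1D.
rewrite (RintD i1 i2) (RintD lh.2 lk.2).
have -> : 2 * c^-1 * (Rintegral mu setT (fun x => h x ^+ 2) + Rintegral mu setT (fun x => k x ^+ 2)) =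
  2 * c^-1 ^+ 2 * (c * Rintegral mu setT (fun x => h x ^+ 2) + c * Rintegral mu setT (fun x => k x ^+ 2)).
  by field; rewrite gt_eqF.
by apply: ler_wpM2l; [rewrite mulr_ge0 ?sqr_ge0|exact: lerD].
Qed.

(* Parseval's formula for [f^ = h + i k] and [phi = p + i q]: the real part of
   [\int f phi^ = \int f^ phi], where [wave h k] and [wave k (- h)] are the real
   and imaginary parts of [f]. *)
Lemma wave_pairing h k p q : L12 h -> L12 k -> L1 mu p -> L1 mu q ->
  (exists K, forall x, `|p x| <= K) -> (exists K, forall x, `|q x| <= K) ->
  (forall x, enorm_continuous p x) -> (forall x, enorm_continuous q x) ->
  Rintegral mu setT (fun x => wave h k x * (cosT p x + sinT q x) -
     wave k (fun y => - h y) x * (cosT q x - sinT p x)) =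
  Rintegral mu setT (fun x => h x * p x - k x * q x).
Proof.
move=> [ih lh] [ik lk] ip iq [Kp pK] [Kq qK] cp cq.
have lp := L2_bounded ip pK; have lq := L2_bounded iq qK.
have [lch lsh _] := plancherel_le ih lh.
have [lck lsk _] := plancherel_le ik lk.
have [lcp lsp _] := plancherel_le ip lp.
have [lcq lsq _] := plancherel_le iq lq.
have sN x : sinT (fun y => - h y) x = - sinT h x.
  rewrite /tft -RintN; last by apply: L1_tft_arg => //; exact: sin_max.
  by apply: eq_Rint => y; rewrite mulrN.
have j1 := L1D (L2_mul lch lcp) (L2_mul lsh lsp).
have j2 := L1D (L2_mul lck lcq) (L2_mul lsk lsq).
have j3 := L1B (L2_mul lsh lcq) (L2_mul lch lsq).
have j4 := L1B (L2_mul lsk lcp) (L2_mul lck lsp).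
have m1 := L2_mul lh lp; have m2 := L2_mul lk lq.
rewrite (@eq_Rint _ _ _ mu _ (fun x => ((2 * pi) ^+ n)^-1 *
  (((cosT h x * cosT p x + sinT h x * sinT p x) - (cosT k x * cosT q x + sinT k x * sinT q x))
  - ((sinT h x * cosT q x - cosT h x * sinT q x) + (sinT k x * cosT p x - cosT k x * sinT p x)))));
  last by move=> x; rewrite /wave sN; ring.
rewrite RintZ; last by apply: L1B; [exact: L1B|exact: L1D].
rewrite RintB; [|exact: L1B|exact: L1D].
rewrite (RintB j1 j2) (RintD j3 j4) (pairing_sin ih lh iq lq) (pairing_sin ik lk ip lp) addr0 subr0.
rewrite (pairing_cos ih lh ip pK cp) (pairing_cos ik lk iq qK cq) -mulrBr mulKf ?gt_eqF//.
by rewrite RintB.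
Qed.

(** The radius 0 for [m = 0] makes the first annulus the ball [|xi| < rho], so that low frequencies
    are included. *)
Definition lower_radius rho m : R := if m is _.+1 then rho ^+ m else 0.

Definition cutoff rho m (xi : E) : R :=
  (((lower_radius rho m <= enorm xi) && (enorm xi < lower_radius rho m.+1))%R)%:R.

Lemma cutoff_ge0 rho m xi : 0 <= cutoff rho m xi. Proof. exact: ler0n. Qed.

Lemma cutoff_le1 rho m xi : cutoff rho m xi <= 1.
Proof. by rewrite /cutoff; case: (_ && _). Qed.

Lemma cutoff_sqr rho m xi : cutoff rho m xi ^+ 2 = cutoff rho m xi.
Proof. by rewrite /cutoff; case: (_ && _); rewrite ?expr1n ?expr0n. Qed.

Lemma lower_radius_homo rho m : 1 < rho -> lower_radius rho m < lower_radius rho m.+1.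
Proof.
move=> r1; have r0 : 0 < rho by rewrite (lt_trans _ r1).
by case: m => [|m] /=; rewrite ?exprn_gt0// ltr_eXn2l.
Qed.

Lemma sum_cutoff rho N xi : 1 < rho ->
  \sum_(0 <= m < N) cutoff rho m xi = ((enorm xi < lower_radius rho N)%R)%:R.
Proof.
move=> r1; elim: N => [|N IH].
  by rewrite big_geq// ltNge enorm_ge0.
rewrite big_nat_recr//= IH /cutoff; have := lower_radius_homo N r1.
case: (ltP (enorm xi) (lower_radius rho N)) => h1 h2 /=.
  by rewrite (lt_trans h1 h2) addr0.
by rewrite add0r.
Qed.

Lemma measurable_cutoff rho m : measurable_fun setT (cutoff rho m).
Proof.
have me : measurable_fun setT (@enorm R n) by exact: measurable_enorm.
pose A : set E := [set xi | lower_radius rho m <= enorm xi] `&` [set xi | enorm xi < lower_radius rho m.+1].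
have mA : measurable A.
  apply: measurableI.
    rewrite (_ : mkset _ = setT `&` @enorm R n @^-1` `[lower_radius rho m, +oo[).
      exact: me.
    by apply/seteqP; split => x /=; rewrite in_itv/= andbT// => -[].
  rewrite (_ : mkset _ = setT `&` @enorm R n @^-1` `]-oo, lower_radius rho m.+1[).
    exact: me.
  by apply/seteqP; split => x /=; rewrite in_itv/=// => -[].
rewrite (_ : cutoff rho m = \1_A); first exact: measurable_indic.
apply/funext => xi; rewrite indicE /cutoff; congr ((nat_of_bool _)%:R).
apply/idP/idP => [/andP[h1 h2]|]; first by rewrite inE.
by rewrite inE => -[h1 h2]; apply/andP.
Qed.

(** On the ball of radius [r] the constant [expR (r^2)] times the Gaussian is at least 1, which
    avoids computing a volume. *)
Lemma L1_cutoff rho m : L1 mu (cutoff rho m).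
Proof.
pose r := lower_radius rho m.+1.
apply: (@L1_dominated _ _ _ mu _ (fun xi => expR (r ^+ 2) * gauss 1 xi)).
- exact: measurable_cutoff.
- move=> xi; rewrite ger0_norm ?cutoff_ge0// /cutoff.
  have [/andP[_ h]|_] := boolP (_ && _); last by rewrite mulr_ge0 ?expR_ge0.
  rewrite /gauss -expRD -[leLHS]expR0 ler_expR mul1r subr_ge0 -sqr_enorm.
  by rewrite ler_pXn2r ?nnegrE ?enorm_ge0// ?(le_trans (enorm_ge0 xi))// ltW.
- by apply: L1Z; exact: L1_gauss0.
Qed.

Lemma L12_cutoff rho m h : L2 mu h -> L12 (fun xi => cutoff rho m xi * h xi).
Proof.
move=> lh; have mc := measurable_cutoff rho m.
have c1 x : `|cutoff rho m x| <= 1 by rewrite ger0_norm ?cutoff_ge0 ?cutoff_le1.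
split; last first.
  by apply: (L2_eq (h := fun x => h x * cutoff rho m x));
    [move=> x; rewrite mulrC|exact: (L2_bounded_mul lh mc c1)].
apply: L2_mul => //; exact: (L2_bounded (L1_cutoff rho m) c1).
Qed.

(** With [roti], the real and imaginary parts of [e^(i tau |xi|^a) (g1 + i g2)]. *)
Definition rotr a g1 g2 tau (xi : E) : R :=
  g1 xi * cos (tau * enorm xi `^ a) - g2 xi * sin (tau * enorm xi `^ a).
Definition roti a g1 g2 tau (xi : E) : R :=
  g1 xi * sin (tau * enorm xi `^ a) + g2 xi * cos (tau * enorm xi `^ a).

Lemma measurable_phase a tau : measurable_fun setT (fun xi : E => tau * enorm xi `^ a).
Proof.
apply: measurable_funM => //.
apply: (@measurableT_comp _ _ _ _ _ _ (fun y : R => y `^ a)); first exact: measurable_powR.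
exact: measurable_enorm.
Qed.

Lemma L2_rotr a g1 g2 tau : L2 mu g1 -> L2 mu g2 -> L2 mu (rotr a g1 g2 tau).
Proof.
move=> l1 l2; have mp := measurable_phase a tau.
by apply: L2B; [apply: (L2_bounded_mul (K := 1) l1)|apply: (L2_bounded_mul (K := 1) l2)];
  try (by move=> x; rewrite ?cos_max ?sin_max); exact: measurableT_comp.
Qed.

Lemma L2_roti a g1 g2 tau : L2 mu g1 -> L2 mu g2 -> L2 mu (roti a g1 g2 tau).
Proof.
move=> l1 l2; have mp := measurable_phase a tau.
by apply: L2D; [apply: (L2_bounded_mul (K := 1) l1)|apply: (L2_bounded_mul (K := 1) l2)];
  try (by move=> x; rewrite ?cos_max ?sin_max); exact: measurableT_comp.
Qed.

(** The real part of the piece [u_m(tau)] when [f^ = g1 + i g2]. *)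
Definition block rho a g1 g2 m tau (x : E) : R :=
  wave (fun xi => cutoff rho m xi * rotr a g1 g2 tau xi)
       (fun xi => cutoff rho m xi * roti a g1 g2 tau xi) x.

Section block_estimates.
Variables (rho a : R) (g1 g2 : E -> R).
Hypotheses (rho1 : 1 < rho) (a0 : 0 <= a) (l1 : L2 mu g1) (l2 : L2 mu g2).

Let q m xi : R := cutoff rho m xi * (g1 xi ^+ 2 + g2 xi ^+ 2).
Definition block_mass m : R := Rintegral mu setT
  (fun xi => cutoff rho m xi * (g1 xi ^+ 2 + g2 xi ^+ 2)).

Lemma L1_block_mass m : L1 mu (fun xi => cutoff rho m xi * (g1 xi ^+ 2 + g2 xi ^+ 2)).
Proof.
apply: (@L1_eq _ _ _ mu (fun xi => (g1 xi ^+ 2 + g2 xi ^+ 2) * cutoff rho m xi)).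
  by move=> x; rewrite mulrC.
apply: (@L1_bounded_mul _ _ _ mu _ _ 1).
- by apply: L1D; [exact: l1.2|exact: l2.2].
- exact: measurable_cutoff.
- by move=> x; rewrite ger0_norm ?cutoff_ge0 ?cutoff_le1.
Qed.

Lemma block_mass_ge0 m : 0 <= block_mass m.
Proof.
by apply: Rintegral_ge0 => x _; rewrite mulr_ge0 ?cutoff_ge0// addr_ge0 ?sqr_ge0.
Qed.

Let hr m tau xi := cutoff rho m xi * rotr a g1 g2 tau xi.
Let hi m tau xi := cutoff rho m xi * roti a g1 g2 tau xi.

Let Lr m tau : L12 (hr m tau). Proof. by apply: L12_cutoff; exact: L2_rotr. Qed.
Let Li m tau : L12 (hi m tau). Proof. by apply: L12_cutoff; exact: L2_roti. Qed.

Lemma measurable_block m tau : measurable_fun setT (block rho a g1 g2 m tau).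
Proof. by have [[]] := L2_wave (Lr m tau) (Li m tau). Qed.

Let c : R := ((2 * pi) ^+ n)^-1.
Let c_ge0 : 0 <= c. Proof. by rewrite invr_ge0 ltW. Qed.

Lemma int_block m tau : (\int[mu]_x (block rho a g1 g2 m tau x ^+ 2)%:E <=
  (8 * ((2 * pi) ^+ n)^-1 * block_mass m)%:E)%E.
Proof.
have [_ h] := L2_wave (Lr m tau) (Li m tau); apply: (le_trans h).
rewrite lee_fin -/c (@eq_Rint _ _ _ mu _ (fun xi => cutoff rho m xi * (g1 xi ^+ 2 + g2 xi ^+ 2))).
  (* The factor 2 is weakened to 8, the constant of the difference estimates, so that a single
     constant serves throughout. *)
  by rewrite -/(block_mass m) ler_wpM2r ?block_mass_ge0// ler_wpM2r//; lra.
move=> xi; rewrite /hr /hi !exprMn cutoff_sqr -mulrDr; congr (_ * _).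
rewrite /rotr /roti; have := cos2Dsin2 (tau * enorm xi `^ a).
move: (cos _) (sin _) (g1 xi) (g2 xi) => C S v w h1.
transitivity ((v ^+ 2 + w ^+ 2) * (C ^+ 2 + S ^+ 2)); first by ring.
by rewrite h1 mulr1.
Qed.

(** The identity [|e^(i alpha) - e^(i beta)|^2 = 2 - 2 cos (alpha - beta)] for the two phases. *)
Let diff_sqr m tau sigma xi : (hr m tau xi - hr m sigma xi) ^+ 2 + (hi m tau xi - hi m sigma xi) ^+ 2 =
  cutoff rho m xi * (g1 xi ^+ 2 + g2 xi ^+ 2) * (2 - 2 * cos ((tau - sigma) * enorm xi `^ a)).
Proof.
rewrite /hr /hi -!mulrBr !exprMn cutoff_sqr -mulrDr -mulrA; congr (_ * _).
rewrite mulrBl cosB /rotr /roti.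
have := cos2Dsin2 (tau * enorm xi `^ a); have := cos2Dsin2 (sigma * enorm xi `^ a).
move: (cos (tau * _)) (sin (tau * _)) (cos (sigma * _)) (sin (sigma * _)) (g1 xi) (g2 xi).
move=> C S C' S' v w h1 h2.
rewrite (_ : 2 - _ = (C ^+ 2 + S ^+ 2) + (C' ^+ 2 + S' ^+ 2) - 2 * (C * C' + S * S')); last by rewrite h1 h2; ring.
ring.
Qed.

Let int_diff m tau sigma (K : R) :
  (forall xi, cutoff rho m xi != 0 -> 2 - 2 * cos ((tau - sigma) * enorm xi `^ a) <= K) ->
  (\int[mu]_x ((block rho a g1 g2 m tau x - block rho a g1 g2 m sigma x) ^+ 2)%:E <=
  (2 * c * (K * block_mass m))%:E)%E.
Proof.
move=> hK; have [ir lr] := Lr m tau; have [ii li] := Li m tau.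
have [ir' lr'] := Lr m sigma; have [ii' li'] := Li m sigma.
under eq_integral do rewrite /block waveB//.
have Ldr : L12 (fun y => hr m tau y - hr m sigma y) by split; [exact: L1B|exact: L2B].
have Ldi : L12 (fun y => hi m tau y - hi m sigma y) by split; [exact: L1B|exact: L2B].
have [_ h] := L2_wave Ldr Ldi; apply: (le_trans h); rewrite lee_fin -/c.
rewrite ler_wpM2l ?mulr_ge0// -RintZ; last exact: L1_block_mass.
apply: le_Rint.
- by apply: L1D; [exact: Ldr.2.2|exact: Ldi.2.2].
- by apply: L1Z; exact: L1_block_mass.
move=> xi; rewrite diff_sqr mulrC; have [->|c0] := eqVneq (cutoff rho m xi) 0.
  by rewrite !mul0r !mulr0.
by rewrite ler_wpM2r ?hK// mulr_ge0 ?cutoff_ge0 ?addr_ge0 ?sqr_ge0.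
Qed.

Lemma int_block_diff m tau sigma :
  (\int[mu]_x ((block rho a g1 g2 m tau x - block rho a g1 g2 m sigma x) ^+ 2)%:E <=
  (8 * ((2 * pi) ^+ n)^-1 * block_mass m)%:E)%E.
Proof.
apply: (@le_trans _ _ (2 * c * (4 * block_mass m))%:E).
  apply: int_diff => xi _; have := cos_max ((tau - sigma) * enorm xi `^ a).
  by rewrite ler_norml => /andP[]; lra.
by rewrite lee_fin le_eqVlt; apply/orP; left; apply/eqP; rewrite -/c; ring.
Qed.

(** On the support of the cutoff [|xi| < rho^(m+1)], so the phases differ by at most
    [(rho^(m+1))^a * |tau - sigma|], the power being monotone because [a >= 0]. *)
Lemma int_block_lip m tau sigma :
  (\int[mu]_x ((block rho a g1 g2 m tau x - block rho a g1 g2 m sigma x) ^+ 2)%:E <=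
  (8 * ((2 * pi) ^+ n)^-1 * ((rho ^+ m.+1) `^ a * (tau - sigma)) ^+ 2 * block_mass m)%:E)%E.
Proof.
apply: (@le_trans _ _ (2 * c * ((((rho ^+ m.+1) `^ a) * (tau - sigma)) ^+ 2 * block_mass m))%:E).
  apply: int_diff => xi c0; apply: (le_trans (one_minus_cos_le _)).
  rewrite !exprMn mulrC ler_wpM2r ?sqr_ge0//.
  rewrite ler_pXn2r ?nnegrE ?powR_ge0//.
  apply: ge0_ler_powR => //; rewrite ?nnegrE ?enorm_ge0 ?exprn_ge0 ?(ltW (lt_trans ltr01 rho1))//.
  by move: c0; rewrite /cutoff; case: andP => [[_ /ltW//]|_]; rewrite eqxx.
have -> : 8 * ((2 * pi) ^+ n)^-1 * ((rho ^+ m.+1) `^ a * (tau - sigma)) ^+ 2 * block_mass m =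
  4 * (2 * c * ((((rho ^+ m.+1) `^ a) * (tau - sigma)) ^+ 2 * block_mass m)) by rewrite /c; ring.
rewrite lee_fin ler_peMl//; last by lra.
apply: mulr_ge0; first by rewrite mulr_ge0.
by apply: mulr_ge0; [exact: sqr_ge0|exact: block_mass_ge0].
Qed.

(** Dominated convergence in the Fourier integral, the truncated [g1] and [g2] being integrable. It
    applies at every [x], as the telescoping of the decrements requires. *)
Lemma block_cvg m (t : nat -> R) x : t @ \oo --> (0 : R) ->
  (fun i => block rho a g1 g2 m (t i) x) @ \oo --> block rho a g1 g2 m 0 x.
Proof.
move=> t0; rewrite /block /wave; apply: cvgMr.
pose dom xi := cutoff rho m xi * `|g1 xi| + cutoff rho m xi * `|g2 xi|.
have idom : L1 mu dom.
  have ln g : L2 mu g -> L2 mu (fun x => `|g x|).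
    move=> [mg ig]; split; first exact: measurableT_comp.
    by apply: (@L1_eq _ _ _ mu (fun x => g x ^+ 2)) => // y; rewrite real_normK ?num_real.
  by apply: L1D; apply: (proj1 (L12_cutoff _ _ _)); exact: ln.
have cph (f : R -> R) (xi : E) : continuous f ->
    (fun i => f (t i * enorm xi `^ a)) @ \oo --> f (0 * enorm xi `^ a).
  move=> cf.
  have h : (fun i => t i * enorm xi `^ a) @ \oo --> 0 * enorm xi `^ a by apply: cvgMl.
  exact: (cvg_comp _ _ h (cf _)).
have bnd (g g' : E -> R) (C S : R) xi : `|C| <= 1 -> `|S| <= 1 ->
    `|g xi * C| + `|g' xi * S| <= `|g xi| + `|g' xi|.
  by move=> C1 S1; rewrite !normrM lerD// ler_piMr.
have gen (w : R -> R) (rot : R -> E -> R) : measurable_fun setT w -> (forall y, `|w y| <= 1) ->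
   (forall tau, L12 (fun xi => cutoff rho m xi * rot tau xi)) ->
   (forall xi, (fun i => rot (t i) xi) @ \oo --> rot 0 xi) ->
   (forall tau xi, `|rot tau xi| <= `|g1 xi| + `|g2 xi|) ->
   (fun i => tft w (fun xi => cutoff rho m xi * rot (t i) xi) x) @ \oo -->
   tft w (fun xi => cutoff rho m xi * rot 0 xi) x.
  move=> mw w1 Lrot crot brot.
  have marg tau : measurable_fun setT (fun xi => w (dotp x xi) * (cutoff rho m xi * rot tau xi)).
    by apply: L1_measurable; apply: (L1_tft_arg mw w1 x (Lrot tau).1).
  have [] // := @L1_dominated_cvg _ _ _ mu
    (fun i xi => w (dotp x xi) * (cutoff rho m xi * rot (t i) xi))
    (fun xi => w (dotp x xi) * (cutoff rho m xi * rot 0 xi)) dom.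
  - by apply: aeW => xi; apply: cvgMr; apply: cvgMr; exact: crot.
  - apply: aeW => xi i; rewrite !normrM (ger0_norm (cutoff_ge0 _ _ _)) /dom -mulrDr.
    by rewrite (le_trans (ler_piMl _ (w1 _)))// ?mulr_ge0 ?cutoff_ge0// ler_wpM2l ?cutoff_ge0.
apply: cvgB; apply: gen => //.
- exact: cos_max.
- by move=> tau; exact: Lr.
- by move=> xi; apply: cvgB; apply: cvgMr; apply: cph; [exact: continuous_cos|exact: continuous_sin].
- by move=> tau xi; rewrite (le_trans (ler_normB _ _))// bnd ?cos_max ?sin_max.
- exact: sin_max.
- by move=> tau; exact: Li.
- by move=> xi; apply: cvgD; apply: cvgMr; apply: cph; [exact: continuous_sin|exact: continuous_cos].
- by move=> tau xi; rewrite (le_trans (ler_normD _ _))// bnd ?cos_max ?sin_max.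
Qed.

End block_estimates.

(** On the annulus [m] the weight [(1 + |xi|^2)^s] is at least [rho^(2ms) = 2^(bm)], and the cutoffs
    have disjoint supports, so they add up to at most 1. *)
Lemma block_mass_sum rho s b g1 g2 : 1 < rho -> 0 < s -> (rho ^+ 2) `^ s = 2 `^ b ->
  L2 mu g1 -> L2 mu g2 ->
  (\int[mu]_xi ((1 + enorm xi ^+ 2) `^ s * (g1 xi ^+ 2 + g2 xi ^+ 2))%:E < +oo)%E ->
  (\sum_(m <oo) (2 `^ (b * m%:R) * block_mass rho g1 g2 m)%:E < +oo)%E.
Proof.
move=> rho1 s0 rhob l1 l2; apply: le_lt_trans.
have rho0 : 0 < rho by rewrite (lt_trans _ rho1).
pose f m xi := 2 `^ (b * m%:R) * (cutoff rho m xi * (g1 xi ^+ 2 + g2 xi ^+ 2)).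
have f0 m xi : (0 <= (f m xi)%:E)%E.
  by rewrite lee_fin mulr_ge0 ?powR_ge0// mulr_ge0 ?cutoff_ge0// addr_ge0 ?sqr_ge0.
have i_f m : L1 mu (f m) by apply: L1Z; exact: L1_block_mass.
have -> : (\sum_(m <oo) (2 `^ (b * m%:R) * block_mass rho g1 g2 m)%:E =
   \int[mu]_xi \sum_(m <oo) (f m xi)%:E)%E.
  rewrite integral_nneseries//; last by move=> m; exact: measurable_int (i_f m).
  apply: eq_eseriesr => m _; rewrite /block_mass -RintZ; last exact: L1_block_mass.
  by rewrite EFin_Rint//; exact: (i_f m).
apply: ge0_le_integral => //.
- by move=> xi _; exact: nneseries_ge0.
- by apply: ge0_emeasurable_sum => // m _; exact: measurable_int (i_f m).
- apply/measurable_EFinP; apply: measurable_funM; last first.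
    by apply: measurable_funD; apply: measurable_funX; [exact: l1.1|exact: l2.1].
  apply: (@measurableT_comp _ _ _ _ _ _ (fun y : R => y `^ s)); first exact: measurable_powR.
  by apply: measurable_funD => //; apply: measurable_funX; exact: measurable_enorm.
move=> xi _; apply: lime_le; first by apply: is_cvg_nneseries.
apply: nearW => N; rewrite sumEFin lee_fin.
have q0 : 0 <= g1 xi ^+ 2 + g2 xi ^+ 2 by rewrite addr_ge0 ?sqr_ge0.
apply: (@le_trans _ _ (\sum_(0 <= m < N) cutoff rho m xi *
   ((1 + enorm xi ^+ 2) `^ s * (g1 xi ^+ 2 + g2 xi ^+ 2)))).
  apply: ler_sum => m _; rewrite /f.
  have [->|c0] := eqVneq (cutoff rho m xi) 0; first by rewrite !mul0r mulr0.
  rewrite mulrCA ler_wpM2l ?cutoff_ge0// ler_wpM2r//.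
  have lm : lower_radius rho m <= enorm xi.
    by move: c0; rewrite /cutoff; case: andP => [[]//|_]; rewrite eqxx.
  rewrite powRrM powR_mulrn ?powR_ge0// -rhob -powR_mulrn ?powR_ge0// -powRrM mulrC powRrM.
  rewrite powR_mulrn ?exprn_ge0 ?(ltW rho0)//.
  apply: ge0_ler_powR; rewrite ?nnegrE ?exprn_ge0 ?addr_ge0 ?sqr_ge0 ?(ltW s0) ?(ltW rho0)//.
  (* The annulus 0 has no positive inner radius; there [1 <= 1 + |xi|^2] is enough. *)
  case: m lm {c0} => [_|m lm]; first by rewrite expr0 lerDl sqr_ge0.
  rewrite -exprM mulnC exprM (@le_trans _ _ (enorm xi ^+ 2))//; last by rewrite lerDr.
  by rewrite ler_pXn2r ?nnegrE ?enorm_ge0 ?exprn_ge0 ?(ltW rho0).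
rewrite -mulr_suml sum_cutoff// ler_piMl//; first by rewrite mulr_ge0 ?powR_ge0.
by case: (_ < _).
Qed.

End dispersive_blocks.

(** * Complex-valued functions *)

Section complex_valued.
Context {R : realType} {n : nat}.
Local Notation E := 'rV[R]_n.
Local Notation mu := (@lebesgue_rV R n).
Local Notation cosT := (tft cos).
Local Notation sinT := (tft sin).
Implicit Types (f g u v phi : E -> R[i]) (p q : E -> R).

Lemma fReM f g x : fRe (fun x => f x * g x) x = fRe f x * fRe g x - fIm f x * fIm g x.
Proof. by rewrite /fRe /fIm; case: (f x) (g x) => [a b] [c d]. Qed.

Lemma fImM f g x : fIm (fun x => f x * g x) x = fRe f x * fIm g x + fIm f x * fRe g x.
Proof. by rewrite /fRe /fIm; case: (f x) (g x) => [a b] [c d]. Qed.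

Lemma cintegralM f g : cintegral (fun x => f x * g x) =
  Complex (Rintegral mu setT (fun x => fRe f x * fRe g x - fIm f x * fIm g x))
          (Rintegral mu setT (fun x => fRe f x * fIm g x + fIm f x * fRe g x)).
Proof. by congr Complex; apply: eq_Rint => x; rewrite ?fReM ?fImM. Qed.

Lemma fourierE phi xi : L1 mu (fRe phi) -> L1 mu (fIm phi) -> fourier phi xi =
  Complex (cosT (fRe phi) xi + sinT (fIm phi) xi) (cosT (fIm phi) xi - sinT (fRe phi) xi).
Proof.
move=> ip iq; rewrite /fourier cintegralM /tft; congr Complex.
  rewrite -RintD; try (apply: L1_tft_arg => //; first [exact: measurable_cos|exact: measurable_sin|exact: cos_max|exact: sin_max]).
  by apply: eq_Rint => x; rewrite /fRe /fIm /expi /= cosN sinN mulNr opprK.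
rewrite -RintB; try (apply: L1_tft_arg => //; first [exact: measurable_cos|exact: measurable_sin|exact: cos_max|exact: sin_max]).
by apply: eq_Rint => x; rewrite /fRe /fIm /expi /= cosN sinN mulNr.
Qed.

Lemma L2_regular f : L2 mu (fRe f) -> L2 mu (fIm f) -> regular_fun f.
Proof.
move=> lr li; split; first by split; [exact: lr.1|exact: li.1].
move=> phi sphi.
have [_ [K pK] ip _] := schwartz_part sphi (or_introl erefl).
have [_ [K' qK] iq _] := schwartz_part sphi (or_intror erefl).
have lp := L2_bounded ip pK; have lq := L2_bounded iq qK.
split.
- apply: (@L1_eq _ _ _ mu (fun x => fRe f x * fRe phi x - fIm f x * fIm phi x)).
    by move=> x; rewrite fReM.
  by apply: L1B; exact: L2_mul.
- apply: (@L1_eq _ _ _ mu (fun x => fRe f x * fIm phi x + fIm f x * fRe phi x)).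
    by move=> x; rewrite fImM.
  by apply: L1D; exact: L2_mul.
Qed.

Lemma Lfun2P p : p \in Lfun mu 2%:E <-> L2 mu p.
Proof.
split=> [lp|[mp ip]].
  have mp := sub_Lfun_mfun lp; rewrite inE in mp.
  by split => //; exact: Lfun2_integrable_sqr.
rewrite inE; apply/andP; split; first by rewrite inE.
rewrite inE /= /finite_norm unlock /= poweR_lty//.
have := integral_L1_lty ip; congr (_ < _)%E; apply: eq_integral => x _.
by rewrite -[(2 : R)]/(2%:R) powR_mulrn ?normr_ge0// real_normK ?num_real.
Qed.

Lemma gauss_schwartz c (y : E) : 0 < c -> schwartz (fun x => Complex (gauss c (x - y)) 0).
Proof.
move=> c0; have e := expoly_gauss y 0 0 c0.
have := expoly_schwartz e (expoly_scale 0 e).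
congr schwartz; apply/funext => x.
by rewrite dotp0l addr0 cos0 mulr1 mul0r.
Qed.

Lemma regular_gauss v c y : regular_fun v -> 0 < c ->
  L1 mu (fun x => fRe v x * gauss c (x - y)) /\ L1 mu (fun x => fIm v x * gauss c (x - y)).
Proof.
move=> [_ rv] c0; have [ir ii] := rv _ (gauss_schwartz y c0); split.
- by apply: (L1_eq _ ir) => x; rewrite fReM [fIm (fun=> _) x]/= mulr0 subr0.
- by apply: (L1_eq _ ii) => x; rewrite fImM [fIm (fun=> _) x]/= mulr0 add0r.
Qed.

(** The test function is [e^(i y . x) gauss c' x] with [c' = 1 / (4c)]; its imaginary part is
    written as a cosine with phase [- pi / 2] to belong to [expoly]. *)
Lemma fourier_gauss c (y : E) : 0 < c -> exists2 phi : E -> R[i], schwartz phi &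
  exists2 K : R, 0 < K & fourier phi = (fun xi => Complex (K * gauss c (xi - y)) 0).
Proof.
move=> c0; pose c' := (4 * c)^-1.
have c'0 : 0 < c' by rewrite invr_gt0 mulr_gt0.
have ec : (4 * c')^-1 = c by rewrite /c'; field; rewrite gt_eqF.
have e theta := expoly_gauss 0 y theta c'0.
pose p x := gauss c' (x - 0) * cos (dotp y x + 0).
pose q x := gauss c' (x - 0) * cos (dotp y x + - (pi / 2)).
have sphi : schwartz (fun x => Complex (p x) (q x)) := expoly_schwartz (e _) (e _).
exists (fun x => Complex (p x) (q x)) => //.
exists (Num.sqrt (pi / c') ^+ n).
  by rewrite exprn_gt0// sqrtr_gt0 divr_gt0// pi_gt0.
have [_ _ ip _] := schwartz_part sphi (or_introl erefl).
have [_ _ iq _] := schwartz_part sphi (or_intror erefl).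
have qE x : q x = gauss c' x * sin (dotp y x) by rewrite /q subr0 cosB cos_pihalf sin_pihalf mulr0 add0r mulr1.
have pE x : p x = gauss c' x * cos (dotp y x) by rewrite /p subr0 addr0.
have aux (w : R -> R) (h : E -> R) xi : measurable_fun setT w -> (forall r, `|w r| <= 1) -> L1 mu h ->
  L1 mu (fun x => w (dotp xi x) * h x) by move=> *; exact: L1_tft_arg.
have H theta xi := Rint_gauss_cos (y - xi) theta c'0.
apply/funext => xi; rewrite fourierE//; congr Complex.
- rewrite /tft -RintD; try (by apply: aux => //; first [exact: measurable_cos|exact: measurable_sin|exact: cos_max|exact: sin_max]).
  transitivity (Rintegral mu setT (fun x => gauss c' x * cos (dotp (y - xi) x + 0))).
    apply: eq_Rint => x; rewrite [fRe _ x]pE [fIm _ x]qE addr0 dotpBl cosB; ring.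
  by rewrite H cos0 mul1r ec gauss_distC.
- rewrite /tft -RintB; try (by apply: aux => //; first [exact: measurable_cos|exact: measurable_sin|exact: cos_max|exact: sin_max]).
  transitivity (Rintegral mu setT (fun x => gauss c' x * cos (dotp (y - xi) x + - (pi / 2)))).
    apply: eq_Rint => x; rewrite [fRe _ x]pE [fIm _ x]qE cosB cos_pihalf sin_pihalf dotpBl sinB; ring.
  by rewrite H cosN cos_pihalf mul0r.
Qed.

Lemma distr_of_gauss v c (y : E) K : distr_of v (fun x => Complex (K * gauss c (x - y)) 0) =
  Complex (Rintegral mu setT (fun x => K * (fRe v x * gauss c (x - y))))
          (Rintegral mu setT (fun x => K * (fIm v x * gauss c (x - y)))).
Proof.
rewrite /distr_of cintegralM; congr Complex; apply: eq_Rint => x.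
  by rewrite [fIm (fun x => Complex _ 0) x]/(0 : R) mulr0 subr0 mulrCA.
by rewrite [fIm (fun x => Complex _ 0) x]/(0 : R) mulr0 add0r mulrCA.
Qed.

(** Real and imaginary parts are compared separately by [gauss_uniqueness]. The positive factor [K]
    lets one statement serve for direct pairings, with [K = 1], and for pairings through the Fourier
    transform. *)
Let regular_unique v u : regular_fun v -> regular_fun u ->
  (forall c y, 0 < c -> exists2 K : R, 0 < K &
    distr_of v (fun x => Complex (K * gauss c (x - y)) 0) =
    distr_of u (fun x => Complex (K * gauss c (x - y)) 0)) ->
  {ae mu, forall x, v x = u x}.
Proof.
move=> rv ru h.
have part (P : (E -> R[i]) -> E -> R) :
    (forall w c y, regular_fun w -> 0 < c -> L1 mu (fun x => P w x * gauss c (x - y))) ->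
    (forall c y (K : R), distr_of v (fun x => Complex (K * gauss c (x - y)) 0) =
      distr_of u (fun x => Complex (K * gauss c (x - y)) 0) ->
      Rintegral mu setT (fun x => K * (P v x * gauss c (x - y))) =
      Rintegral mu setT (fun x => K * (P u x * gauss c (x - y)))) ->
    {ae mu, forall x, P v x - P u x = 0}.
  move=> iP EP; apply: gauss_uniqueness => c y c0.
    by apply: (L1_eq _ (L1B (iP _ _ y rv c0) (iP _ _ y ru c0))) => x; rewrite mulrBl.
  have [K K0 /EP] := h c y c0.
  rewrite !RintZ; try exact: iP.
  move/(mulfI (lt0r_neq0 K0)) => EE.
  under eq_Rint do rewrite mulrBl.
  by rewrite RintB ?EE ?subrr//; exact: iP.
have hr : {ae mu, forall x, fRe v x - fRe u x = 0}.
  apply: part => [w c y rw c0|c y K]; first exact: (regular_gauss y rw c0).1.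
  by rewrite !distr_of_gauss => -[].
have hi : {ae mu, forall x, fIm v x - fIm u x = 0}.
  apply: part => [w c y rw c0|c y K]; first exact: (regular_gauss y rw c0).2.
  by rewrite !distr_of_gauss => -[].
apply: filterS2 hr hi => x /subr0_eq + /subr0_eq.
by rewrite /fRe /fIm; case: (v x) (u x) => [a b] [c d] /= -> ->.
Qed.

Lemma distr_unique v u : regular_fun v -> regular_fun u ->
  eq_distr (distr_of v) (distr_of u) -> {ae mu, forall x, v x = u x}.
Proof.
move=> rv ru h; apply: regular_unique => // c y c0; exists 1 => //.
rewrite (_ : (fun x => _) = (fun x => Complex (gauss c (x - y)) 0)); first exact: (h _ (gauss_schwartz y c0)).
by apply/funext => x; rewrite mul1r.
Qed.

(** Every translated Gaussian is, up to a positive factor, the transform of a Schwartz function, so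
    Gaussian averages are among the pairings: the Fourier transform is injective. *)
Lemma fourier_unique v u : regular_fun v -> regular_fun u ->
  eq_distr (fourier_distr (distr_of v)) (fourier_distr (distr_of u)) ->
  {ae mu, forall x, v x = u x}.
Proof.
move=> rv ru h; apply: regular_unique => // c y c0.
have [phi sphi [K K0 E1]] := fourier_gauss y c0.
by exists K => //; have := h _ sphi; rewrite /fourier_distr E1.
Qed.

End complex_valued.

(** * The solution as a series of blocks *)

Section schrodinger_series.
Context {R : realType} {n : nat}.
Local Notation E := 'rV[R]_n.
Local Notation mu := (@lebesgue_rV R n).
Local Notation cosT := (tft cos).
Local Notation sinT := (tft sin).
Variables (rho s b a : R).
Hypotheses (rho1 : 1 < rho) (s0 : 0 < s) (b0 : 0 < b) (rhob : (rho ^+ 2) `^ s = 2 `^ b).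

(** The real and imaginary parts of the Fourier transform of an element of [H_s], seen as a pair of
    real functions. *)
Definition Hs_pair (g1 g2 : E -> R) := [/\ L2 mu g1, L2 mu g2 &
  (\int[mu]_xi ((1 + enorm xi ^+ 2) `^ s * (g1 xi ^+ 2 + g2 xi ^+ 2))%:E < +oo)%E].

(** Multiplication of [g1 + i g2] by [- i], which makes the imaginary part of the solution a real
    part. *)
Lemma Hs_pair_rot (g1 g2 : E -> R) : Hs_pair g1 g2 -> Hs_pair g2 (fun x => - g1 x).
Proof.
move=> [l1 l2 h]; split => //; first exact: L2N.
by rewrite (eq_integral (fun xi => ((1 + enorm xi ^+ 2) `^ s * (g1 xi ^+ 2 + g2 xi ^+ 2))%:E))//
  => xi _; rewrite sqrrN [g2 _ ^+ 2 + _]addrC.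
Qed.

(* [S] is the real part of [S_tau f], where [f^ = g1 + i g2]; the imaginary part
   is obtained by replacing [(g1, g2)] by [(g2, - g1)]. *)
Definition block_limit (g1 g2 : E -> R) tau (S : E -> R) := [/\ L2 mu S,
  {ae mu, forall x, (fun N => \sum_(0 <= m < N) block rho a g1 g2 m tau x) @ \oo --> S x} &
  forall psi, L2 mu psi ->
   (forall N, L1 mu (fun x => (\sum_(0 <= m < N) block rho a g1 g2 m tau x) * psi x)) /\
   (fun N => Rintegral mu setT (fun x => (\sum_(0 <= m < N) block rho a g1 g2 m tau x) * psi x))
     @ \oo --> Rintegral mu setT (fun x => S x * psi x)].

(** [L2_series] with weights [2^(bm)]: their inverses form a geometric series of ratio [2^-b < 1],
    and [block_mass_sum] supplies the summability of the masses. *)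
Lemma block_limit_exists g1 g2 tau : Hs_pair g1 g2 -> exists S, block_limit g1 g2 tau S.
Proof.
move=> [l1 l2 h].
have pb (x : R) : 0 < 2 `^ x by rewrite powR_gt0.
apply: (@L2_series _ _ _ mu (fun m => block rho a g1 g2 m tau) (fun m => 2 `^ (b * m%:R))
  (block_mass rho g1 g2) (8 * ((2 * pi) ^+ n)^-1) (1 - 2 `^ (- b))^-1).
- by move=> m; exact: measurable_block.
- by move=> m; exact: pb.
- by rewrite mulr_ge0// invr_ge0 exprn_ge0// mulr_ge0// pi_ge0.
- by move=> m; exact: block_mass_ge0.
- move=> N.
  rewrite (eq_bigr (fun m => (2 `^ (- b)) ^+ m)); last first.
    by move=> m _; rewrite -powR_mulrn ?powR_ge0// -powRrM mulNr powRN.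
  apply: geometric_sum_le; first exact: ltW.
  by rewrite /powR pnatr_eq0 /= -[ltRHS]expR0 ltr_expR mulNr oppr_lt0 mulr_gt0// ln_gt0// ltr1n.
- by move=> m; exact: int_block.
- exact: (block_mass_sum rho1 s0 rhob l1 l2 h).
Qed.

Section pairing.
Variables (g1 g2 : E -> R) (tau : R) (S1 S2 : E -> R).
Hypotheses (hg : Hs_pair g1 g2) (h1 : block_limit g1 g2 tau S1)
  (h2 : block_limit g2 (fun x => - g1 x) tau S2).

(** The properties of the real or imaginary part of a Schwartz function on which Parseval's formula
    rests; they are stable under a change of sign. *)
Definition test_function (p : E -> R) := [/\ measurable_fun setT p, exists K, forall x, `|p x| <= K,
  L1 mu p & forall xi, enorm_continuous p xi].

Lemma test_functionN p : test_function p -> test_function (fun x => - p x).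
Proof.
move=> [mp [K pK] ip cp]; split.
- exact: measurableT_comp.
- by exists K => x; rewrite normrN.
- exact: L1N.
- move=> xi e e0; have [d d0 hd] := cp xi e e0.
  by exists d => // eta /hd; rewrite -opprD normrN.
Qed.

Let L2_block (k1 k2 : E -> R) m : L2 mu k1 -> L2 mu k2 -> L2 mu (block rho a k1 k2 m tau).
Proof.
by move=> l1 l2; apply: (proj1 (L2_wave _ _)); apply: L12_cutoff; [exact: L2_rotr|exact: L2_roti].
Qed.

(** Parseval's formula holds for each block by [wave_pairing]. Summing over [m < N], the left side
    converges by the weak limit in [block_limit] and the right side by dominated convergence, the
    partial sums of the cutoffs being indicators of growing balls. *)
Lemma block_limit_pairing p q : test_function p -> test_function q ->
  Rintegral mu setT (fun x => S1 x * (cosT p x + sinT q x) - S2 x * (cosT q x - sinT p x)) =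
  Rintegral mu setT (fun x => rotr a g1 g2 tau x * p x - roti a g1 g2 tau x * q x).
Proof.
move=> [mp [K pK] ip cp] [mq [K' qK] iq cq].
have [l1 l2 _] := hg.
have l1N := L2N l1.
have lr := L2_rotr a tau l1 l2; have li := L2_roti a tau l1 l2.
have lp := L2_bounded ip pK; have lq := L2_bounded iq qK.
have [lcp lsp _] := plancherel_le ip lp.
have [lcq lsq _] := plancherel_le iq lq.
have lFr := L2D lcp lsq; have lFi := L2B lcq lsp.
have [lS1 _ /(_ _ lFr)[iN1 c1]] := h1; have [lS2 _ /(_ _ lFi)[iN2 c2]] := h2.
have iW : L1 mu (fun x => rotr a g1 g2 tau x * p x - roti a g1 g2 tau x * q x).
  by apply: L1B; exact: L2_mul.
have icW m : L1 mu (fun x => cutoff rho m x * (rotr a g1 g2 tau x * p x - roti a g1 g2 tau x * q x)).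
  apply: (@L1_eq _ _ _ mu (fun x => (rotr a g1 g2 tau x * p x - roti a g1 g2 tau x * q x) * cutoff rho m x)).
    by move=> x; rewrite mulrC.
  apply: (@L1_bounded_mul _ _ _ mu _ _ 1) => //; first exact: measurable_cutoff.
  by move=> x; rewrite ger0_norm ?cutoff_ge0 ?cutoff_le1.
pose V N x := (\sum_(0 <= m < N) cutoff rho m x) *
  (rotr a g1 g2 tau x * p x - roti a g1 g2 tau x * q x).
have VS N x : V N.+1 x = V N x + cutoff rho N x *
    (rotr a g1 g2 tau x * p x - roti a g1 g2 tau x * q x).
  by rewrite /V big_nat_recr//= mulrDl.
have V0 x : V 0 x = 0 by rewrite /V big_geq// mul0r.
have iV N : L1 mu (V N).
  elim: N => [|N IH]; first by apply: (@L1_eq _ _ _ mu (fun x => 0 * p x)); [move=> x; rewrite V0 mul0r|exact: L1Z].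
  by apply: (@L1_eq _ _ _ mu (fun x => V N x + cutoff rho N x *
    (rotr a g1 g2 tau x * p x - roti a g1 g2 tau x * q x))); [move=> x; rewrite VS|exact: L1D].
have piece m : Rintegral mu setT (fun x => block rho a g1 g2 m tau x * (cosT p x + sinT q x)) -
    Rintegral mu setT (fun x => block rho a g2 (fun x => - g1 x) m tau x * (cosT q x - sinT p x)) =
    Rintegral mu setT (fun x => cutoff rho m x * (rotr a g1 g2 tau x * p x - roti a g1 g2 tau x * q x)).
  rewrite -RintB; [|by apply: L2_mul => //; exact: L2_block|by apply: L2_mul => //; exact: L2_block].
  have := @wave_pairing R n (fun xi => cutoff rho m xi * rotr a g1 g2 tau xi)
     (fun xi => cutoff rho m xi * roti a g1 g2 tau xi) p q
     (L12_cutoff rho m lr) (L12_cutoff rho m li) ip iq (ex_intro _ K pK) (ex_intro _ K' qK) cp cq.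
  have -> : wave (fun xi => cutoff rho m xi * roti a g1 g2 tau xi)
      (fun y => - (cutoff rho m y * rotr a g1 g2 tau y)) = block rho a g2 (fun x => - g1 x) m tau.
    rewrite /block; congr wave; apply/funext => xi; rewrite /rotr /roti; ring.
  move=> ->; apply: eq_Rint => x; ring.
have partial N : Rintegral mu setT (fun x => (\sum_(0 <= m < N) block rho a g1 g2 m tau x) *
      (cosT p x + sinT q x)) -
    Rintegral mu setT (fun x => (\sum_(0 <= m < N) block rho a g2 (fun x => - g1 x) m tau x) *
      (cosT q x - sinT p x)) = Rintegral mu setT (V N).
  elim: N => [|N IH].
    rewrite (eq_Rint mu (k := fun=> 0)); last by move=> x; rewrite big_geq// mul0r.
    rewrite [X in _ - X](eq_Rint mu (k := fun=> 0)); last by move=> x; rewrite big_geq// mul0r.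
    by rewrite [RHS](eq_Rint mu (k := fun=> 0))// Rint0 subrr.
  rewrite [RHS](eq_Rint mu (VS N)) RintD// -IH -piece.
  rewrite (eq_Rint mu (k := fun x => (\sum_(0 <= m < N) block rho a g1 g2 m tau x) * (cosT p x + sinT q x)
    + block rho a g1 g2 N tau x * (cosT p x + sinT q x))); last first.
    by move=> x; rewrite big_nat_recr//= mulrDl.
  rewrite [X in _ - X](eq_Rint mu (k := fun x =>
    (\sum_(0 <= m < N) block rho a g2 (fun x => - g1 x) m tau x) * (cosT q x - sinT p x)
    + block rho a g2 (fun x => - g1 x) N tau x * (cosT q x - sinT p x))); last first.
    by move=> x; rewrite big_nat_recr//= mulrDl.
  rewrite !RintD//; try by apply: L2_mul => //; exact: L2_block.
  by ring.
have cv : (fun N => Rintegral mu setT (V N)) @ \oo -->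
   Rintegral mu setT (fun x => rotr a g1 g2 tau x * p x - roti a g1 g2 tau x * q x).
  have [] // := @L1_dominated_cvg _ _ _ mu V
    (fun x => rotr a g1 g2 tau x * p x - roti a g1 g2 tau x * q x)
    (fun x => `|rotr a g1 g2 tau x * p x - roti a g1 g2 tau x * q x|).
  - by move=> N; exact: L1_measurable (iV N).
  - exact: L1_measurable iW.
  - apply: aeW => x; rewrite -[X in _ --> X]mul1r; apply: cvgMl.
    (* For fixed [x] the balls of radius [rho^k] eventually contain [x], so the sum of the cutoffs
       is eventually 1. *)
    apply: cvg_near_cst.
    have r0 : 0 < rho by rewrite (lt_trans _ rho1).
    have x0 : 0 < 1 + enorm x by rewrite ltr_wpDr ?enorm_ge0.
    have /cvgrPdist_lt/(_ (1 + enorm x)^-1) : (GRing.exp rho^-1 : nat -> R) @ \oo --> (0 : R).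
      by apply: cvg_expr; rewrite ger0_norm ?invr_ge0 ?ltW// invf_lt1.
    rewrite invr_gt0 => /(_ x0)[N _ hN].
    exists N.+1 => //= -[//|k] hk; rewrite sum_cutoff//=.
    have := hN k.+1 (ltnW hk); rewrite /= sub0r normrN exprVn ger0_norm ?invr_ge0 ?exprn_ge0 ?ltW//.
    rewrite ltf_pV2 ?posrE ?exprn_gt0// => h.
    by rewrite (lt_trans _ h)// ltrDr.
  - exact: L1_norm.
  - apply: aeW => x N; rewrite /V normrM ler_piMl// sum_cutoff//.
    by case: (_ < _); rewrite ?normr1 ?normr0.
rewrite RintB; [|exact: L2_mul|exact: L2_mul].
apply: (cvg_unique _ (cvgB c1 c2)) => //.
apply: cvg_trans cv; apply: near_eq_cvg; apply: nearW => N; exact/esym/partial.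
Qed.

(** The imaginary part of the pairing with [phi = p + i q] is the real part of the pairing with
    [- i phi = q - i p], so [block_limit_pairing] is used twice. *)
Lemma block_limit_fourier phi : schwartz phi ->
  cintegral (fun x => Complex (S1 x) (S2 x) * fourier phi x) =
  cintegral (fun x => Complex (rotr a g1 g2 tau x) (roti a g1 g2 tau x) * phi x).
Proof.
move=> sphi.
have hp : test_function (fRe phi) := schwartz_part sphi (or_introl erefl).
have hq : test_function (fIm phi) := schwartz_part sphi (or_intror erefl).
have [_ _ ip _] := hp; have [_ _ iq _] := hq.
have sN p x : L1 mu p -> sinT (fun y => - p y) x = - sinT p x.
  move=> ihp; rewrite /tft -RintN; last first.
    by apply: L1_tft_arg => //; [exact: measurable_sin|exact: sin_max].
  by apply: eq_Rint => y; rewrite mulrN.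
have cN p x : L1 mu p -> cosT (fun y => - p y) x = - cosT p x.
  move=> ihp; rewrite /tft -RintN; last first.
    by apply: L1_tft_arg => //; [exact: measurable_cos|exact: cos_max].
  by apply: eq_Rint => y; rewrite mulrN.
rewrite !cintegralM; congr Complex.
  rewrite -(block_limit_pairing hp hq); apply: eq_Rint => x.
  by rewrite /fRe /fIm (fourierE _ ip iq).
transitivity (Rintegral mu setT
  (fun x => rotr a g1 g2 tau x * fIm phi x - roti a g1 g2 tau x * - fRe phi x)).
  rewrite -(block_limit_pairing hq (test_functionN hp)); apply: eq_Rint => x.
  have -> : fRe (fourier phi) x = cosT (fRe phi) x + sinT (fIm phi) x by rewrite {1}/fRe fourierE.
  have -> : fIm (fourier phi) x = cosT (fIm phi) x - sinT (fRe phi) x by rewrite {1}/fIm fourierE.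
  by rewrite sN// cN// /fRe /fIm /=; ring.
by apply: eq_Rint => x; rewrite mulrN opprK.
Qed.

End pairing.

End schrodinger_series.

(** * Identification of the solution and conclusion *)

Section assembly.
Context {R : realType} {n : nat}.
Local Notation E := 'rV[R]_n.
Local Notation mu := (@lebesgue_rV R n).
Implicit Types (f g u v : E -> R[i]).

Lemma normc_sqr (z : R[i]) : Normc.normc z ^+ 2 = complex.Re z ^+ 2 + complex.Im z ^+ 2.
Proof. by case: z => u v; rewrite /= sqr_sqrtr// addr_ge0 ?sqr_ge0. Qed.

(** Since [s > 0] the weight is at least 1, which puts the transform itself in L2. *)
Lemma sobolev_Hs_pair s g : 0 < s -> regular_fun g -> (sobolev_norm_of s g < +oo)%E ->
  Hs_pair s (fRe g) (fIm g).
Proof.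
move=> s0 [[m1 m2] _]; rewrite /sobolev_norm_of => /lty_poweRy h.
have {}h : (\int[mu]_xi ((1 + enorm xi ^+ 2) `^ s * (fRe g xi ^+ 2 + fIm g xi ^+ 2))%:E < +oo)%E.
  have /h : 1 / 2 != 0 :> R by lra.
  by congr (_ < _)%E; apply: eq_integral => xi _; rewrite normc_sqr.
have mw : measurable_fun setT (fun xi : E => (1 + enorm xi ^+ 2) `^ s * (fRe g xi ^+ 2 + fIm g xi ^+ 2)).
  apply: measurable_funM; last by apply: measurable_funD; exact: measurable_funX.
  apply: (@measurableT_comp _ _ _ _ _ _ (fun y : R => y `^ s)); first exact: measurable_powR.
  by apply: measurable_funD => //; apply: measurable_funX; exact: measurable_enorm.
have q0 xi : 0 <= fRe g xi ^+ 2 + fIm g xi ^+ 2 by rewrite addr_ge0 ?sqr_ge0.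
have iw : L1 mu (fun xi : E => (1 + enorm xi ^+ 2) `^ s * (fRe g xi ^+ 2 + fIm g xi ^+ 2)).
  by apply: L1_ge0 => // xi; rewrite mulr_ge0 ?powR_ge0.
have w1 xi : fRe g xi ^+ 2 + fIm g xi ^+ 2 <=
    (1 + enorm xi ^+ 2) `^ s * (fRe g xi ^+ 2 + fIm g xi ^+ 2).
  have e1 : 1 `^ s = 1 :> R by rewrite powR1.
  rewrite ler_peMl// -[leLHS]e1; apply: ge0_ler_powR; rewrite ?nnegrE ?addr_ge0 ?sqr_ge0 ?(ltW s0)//.
  by rewrite lerDl sqr_ge0.
split => //; split => //; (apply: L1_dominated iw; first exact: measurable_funX);
  move=> xi; rewrite ger0_norm ?sqr_ge0// (le_trans _ (w1 xi))//.
- by rewrite lerDl sqr_ge0.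
- by rewrite lerDr sqr_ge0.
Qed.

Lemma ae_eq_Rint (h k : E -> R) : measurable_fun setT h -> measurable_fun setT k ->
  {ae mu, forall x, h x = k x} -> Rintegral mu setT h = Rintegral mu setT k.
Proof.
move=> mh mk hk; congr fine; apply: ae_eq_integral => //; try exact/measurable_EFinP.
by apply: filterS hk => x /= -> _.
Qed.

Lemma ae_eq_cintegral f g : cintegrable f -> cintegrable g ->
  {ae mu, forall x, f x = g x} -> cintegral f = cintegral g.
Proof.
move=> [/L1_measurable fr /L1_measurable fi] [/L1_measurable gr /L1_measurable gi] fg.
by congr Complex; apply: ae_eq_Rint => //; apply: filterS fg => x; rewrite /fRe /fIm => ->.
Qed.

Definition evolve a tau g : E -> R[i] := fun xi => expi (tau * enorm xi `^ a) * g xi.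

Lemma evolveE a tau g xi : evolve a tau g xi =
  Complex (rotr a (fRe g) (fIm g) tau xi) (roti a (fRe g) (fIm g) tau xi).
Proof.
rewrite /evolve /rotr /roti /fRe /fIm; case: (g xi) => u v.
by rewrite /= /expi; congr Complex; ring.
Qed.

Lemma evolve0 a g : evolve a 0 g = g.
Proof.
by apply/funext => xi; rewrite /evolve mul0r /expi cos0 sin0 mul1r.
Qed.

Section series_solution.
Variables (rho s a : R).
Hypothesis rho1 : 1 < rho.

Definition series_solution tau g (S1 S2 : E -> R) :=
  block_limit rho a (fRe g) (fIm g) tau S1 /\
  block_limit rho a (fIm g) (fun x => - fRe g x) tau S2.

Lemma series_solution_exists b tau g : 0 < s -> 0 < b -> (rho ^+ 2) `^ s = 2 `^ b ->
  Hs_pair s (fRe g) (fIm g) ->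
  exists S1 S2, series_solution tau g S1 S2.
Proof.
move=> s0 b0 rhob hg; have [S1 h1] := block_limit_exists a rho1 s0 b0 rhob tau hg.
have [S2 h2] := block_limit_exists a rho1 s0 b0 rhob tau (Hs_pair_rot hg).
by exists S1, S2.
Qed.

Section one_time.
Variables (tau : R) (g : E -> R[i]) (S1 S2 : E -> R).
Hypotheses (hg : Hs_pair s (fRe g) (fIm g)) (hS : series_solution tau g S1 S2).

Let u x := Complex (S1 x) (S2 x).

Lemma regular_evolve : regular_fun (evolve a tau g).
Proof.
have [l1 l2 _] := hg.
apply: L2_regular.
- apply: (L2_eq (h := rotr a (fRe g) (fIm g) tau)); last exact: L2_rotr.
  by move=> x; rewrite [RHS]/fRe evolveE.
- apply: (L2_eq (h := roti a (fRe g) (fIm g) tau)); last exact: L2_roti.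
  by move=> x; rewrite [RHS]/fIm evolveE.
Qed.

Lemma regular_series : regular_fun u.
Proof. by case: hS => -[l1 _ _] [l2 _ _]; exact: L2_regular. Qed.

Lemma is_fourier_series : is_fourier (distr_of u) (evolve a tau g).
Proof.
split; first exact: regular_evolve.
move=> phi sphi; rewrite /fourier_distr /distr_of.
rewrite (block_limit_fourier rho1 hg hS.1 hS.2 sphi).
by congr cintegral; apply/funext => x; rewrite evolveE.
Qed.

Lemma is_schrodinger_series f : is_fourier (distr_of f) g -> is_schrodinger a tau f u.
Proof.
move=> fg; split; last by exists g; split => //; exact: is_fourier_series.
by case: hS => -[l1 _ _] [l2 _ _]; split; exact/Lfun2P.
Qed.

(** The series shows that the set from which [schrodinger] selects is nonempty, so the selected
    function satisfies the definition, possibly with another version [g'] of the Fourier transform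
    of [f]. [distr_unique] gives [g' = g] almost everywhere, and [fourier_unique] then identifies
    the two solutions. *)
Lemma schrodinger_series f : is_fourier (distr_of f) g ->
  {ae mu, forall x, schrodinger a tau f x = u x}.
Proof.
move=> fg; have [[lr li] [g' [fg' vg']]] : is_schrodinger a tau f (schrodinger a tau f).
  by apply: (@xgetPex _ (fun=> 0) [set u | is_schrodinger a tau f u]);
    exists u; exact: is_schrodinger_series.
move: lr li => /Lfun2P lr /Lfun2P li.
have gg' : {ae mu, forall x, g' x = g x}.
  apply: distr_unique; [exact: fg'.1|exact: fg.1|].
  by move=> phi sphi; rewrite -(fg'.2 _ sphi) -(fg.2 _ sphi).
apply: fourier_unique; [exact: L2_regular|exact: regular_series|].
move=> phi sphi; rewrite (vg'.2 _ sphi) (is_fourier_series.2 _ sphi).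
apply: ae_eq_cintegral; [exact: vg'.1.2|exact: regular_evolve.2|].
by apply: filterS gg' => x; rewrite /evolve => ->.
Qed.

End one_time.

End series_solution.

Lemma complex_cvg (z : nat -> R[i]) (l : R[i]) :
  (fun k => complex.Re (z k)) @ \oo --> complex.Re l ->
  (fun k => complex.Im (z k)) @ \oo --> complex.Im l ->
  (fun k => z k : (R[i] : numFieldType)) @ \oo --> (l : (R[i] : numFieldType)).
Proof.
move=> hr hi; apply/cvgrPdist_lt => -[e e'].
(* A positive element of [R[i]] is real, so the tolerance has zero imaginary part. *)
rewrite ltcE /= => /andP[/eqP -> e0].
have e20 : 0 < e / 2 by rewrite divr_gt0.
have small (p q : R[i]) : `|complex.Re p - complex.Re q| < e / 2 ->
    `|complex.Im p - complex.Im q| < e / 2 -> `|p - q| < Complex e 0.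
  case: p q => [p1 p2] [q1 q2] /= h1 h2; rewrite ltcR; apply: le_lt_trans (normc_le _ _) _.
  by rewrite (splitr e) ltrD.
move/cvgrPdist_lt/(_ _ e20) : hr => hr; move/cvgrPdist_lt/(_ _ e20) : hi => hi.
by apply: filterS2 hr hi => k; exact: small.
Qed.

End assembly.

Theorem corollary6 (R : realType) (n : nat) (s a b : R) (t : nat -> R) (C : R)
    (f : 'rV[R]_n -> R[i])
    (n_ge1 : (1 <= n)%N) (s_gt0 : 0 < s) (s_le : s <= 1 / 2)
    (a_ge : 2 * s <= a) (b_lt : (a - 2 * s) / (2 * s) < 1 / b)
    (t_lt1 : t 0%N < 1) (t_decr : forall k, t k.+1 < t k)
    (t_gt0 : forall k, 0 < t k) (t_cvg0 : t @ \oo --> 0)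
    (block_le : forall j, (1 <= j)%N ->
       (counting (dyadic_block t j) <= (C * 2 `^ (b * j%:R))%:E)%E)
    (f_Hs : in_sobolev s f) :
  {ae lebesgue_rV n, forall x,
    ((fun k => schrodinger a (t k) f x : (R[i] : numFieldType)) @ \oo
       --> (f x : (R[i] : numFieldType)))}.
Proof.
(* [a >= 2 s] makes the left-hand side of [b_lt] nonnegative, hence [1 / b > 0]. *)
have b0 : 0 < b.
  rewrite -invr_gt0 -[ltRHS]mul1r (le_lt_trans _ b_lt)// divr_ge0 ?subr_ge0//.
  by rewrite mulr_ge0// ltW.
have a0 : 0 <= a by rewrite (le_trans _ a_ge)// mulr_ge0// ltW.
have s20 : 0 < 2 * s by rewrite mulr_gt0.
have p2 (x y : R) : x < y -> 2 `^ x < 2 `^ y.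
  by move=> xy; rewrite /powR pnatr_eq0 /= ltr_expR ltr_pM2r// ln_gt0// ltr1n.
pose rho : R := 2 `^ (b / (2 * s)).
have rho1 : 1 < rho by rewrite -(powRr0 2) p2// divr_gt0.
have rhob : (rho ^+ 2) `^ s = 2 `^ b.
  rewrite -powR_mulrn ?powR_ge0// -!powRrM; congr powR.
  by field; rewrite gt_eqF.
pose L : R := rho `^ a.
have lam_le m : (rho ^+ m.+1) `^ a <= L * 2 `^ ((1 + b) * m%:R).
  have rho0 : 0 <= rho by rewrite powR_ge0.
  rewrite exprS powRM ?exprn_ge0// -/L ler_wpM2l ?powR_ge0//.
  rewrite -powR_mulrn// -!powRrM ler_powR ?ler1n//.
  rewrite mulrCA [leRHS]mulrC ler_wpM2l//.
  rewrite -mulrA [_^-1 * _]mulrC mulrA ler_pdivrMr//.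
  (* After division by [L] the left-hand side is [2^(m a b / (2s))], and [a b / (2s) <= 1 + b]
     follows from [b_lt] cleared of denominators. *)
  have : (a - 2 * s) * b < 2 * s by move: b_lt; rewrite ltr_pdivrMr// mulrAC mul1r ltr_pdivlMr.
  by nra.
have C0 : 0 <= C.
  have := le_trans (measure_ge0 _ _) (block_le 1%N isT).
  by rewrite lee_fin pmulr_lge0// powR_gt0.
have [rf [_ [g [fg Hg]]]] := f_Hs.
have hg := sobolev_Hs_pair s_gt0 fg.1 Hg.
have [l1 l2 ig] := hg; have [_ _ ig'] := Hs_pair_rot hg; have l1N := L2N l1.
have ex tau := series_solution_exists a rho1 tau s_gt0 b0 rhob hg.
have /choice[S1 /choice[S2 hS]] := fun k => ex (t k).
have [T1 [T2 hT]] := ex 0.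
have K0 : 0 <= 8 * ((2 * pi) ^+ n)^-1 :> R.
  by rewrite mulr_ge0// invr_ge0 exprn_ge0// mulr_ge0// pi_ge0.
have lam0 m : 0 < (rho ^+ m.+1) `^ a.
  by rewrite powR_gt0// exprn_gt0// (lt_trans _ rho1).
(* Stated for a general pair, to be used with [(g1, g2)] for the real parts and with [(g2, - g1)]
   for the imaginary parts. *)
have max_cvg (g1 g2 : 'rV[R]_n -> R) (S : nat -> 'rV[R]_n -> R) S0 : Hs_pair s g1 g2 ->
    (forall k, block_limit rho a g1 g2 (t k) (S k)) -> block_limit rho a g1 g2 0 S0 ->
    {ae lebesgue_rV n, forall x, (fun k => S k x) @ \oo --> S0 x}.
  move=> [k1 k2 ik] hk h0.
  apply: (@maximal_cvg _ _ _ _ b C L (8 * ((2 * pi) ^+ n)^-1) (block_mass rho g1 g2)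
    (fun m => (rho ^+ m.+1) `^ a) t (block rho a g1 g2)) => //.
  - by rewrite powR_ge0.
  - by move=> m; exact: block_mass_ge0.
  - by move=> m tau; exact: measurable_block.
  - by move=> m tau sigma _ _; exact: int_block_diff.
  - by move=> m tau sigma _ _; exact: int_block_lip.
  - by move=> m x; exact: block_cvg.
  - exact: (block_mass_sum rho1 s_gt0 rhob k1 k2 ik).
  - by move=> k; have [] := hk k.
  - by have [] := h0.
have cv1 := max_cvg _ _ S1 T1 hg (fun k => (hS k).1) hT.1.
have cv2 := max_cvg _ _ S2 T2 (Hs_pair_rot hg) (fun k => (hS k).2) hT.2.
have /ae_foralln sS := fun k => schrodinger_series rho1 hg (hS k) fg.
(* At time 0 the series has the Fourier transform of [f], so injectivity of the transform identifies
   its sum with [f]. *)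
have fT : {ae lebesgue_rV n, forall x, f x = Complex (T1 x) (T2 x)}.
  apply: fourier_unique => //; first exact: regular_series hT.
  have := is_fourier_series rho1 hg hT.
  by rewrite evolve0 => hT' phi sphi; rewrite (fg.2 _ sphi) (hT'.2 _ sphi).
apply: filterS2 (filterI cv1 cv2) (filterI sS fT) => x [c1 c2] [sx fx].
rewrite fx.
have -> : (fun k => schrodinger a (t k) f x) = (fun k => Complex (S1 k x) (S2 k x)).
  exact/funext.
exact: (@complex_cvg R (fun k => Complex (S1 k x) (S2 k x)) (Complex (T1 x) (T2 x)) c1 c2).
Qed.
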